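(* Let $f(z)=h(z)\overline{g(z)}=H'(z)^{\lambda_1}\overline{G'(z)^{\lambda_2}}$ be a nonvanishing logharmonic mapping in the unit disk $\mathbb{D}$ with $H,G\in\mathcal{S}_1$ and some $\lambda_1,\lambda_2>0$, where $h=(H')^{\lambda_1}$ and $g=(G')^{\lambda_2}$. Then for $|z|=r<1$: (i) $\left[\dfrac{1-r}{(1+r)^3}\right]^{\lambda_1}\le |h(z)|\le \left[\dfrac{1+r}{(1-r)^3}\right]^{\lambda_1}$ and $\left[\dfrac{1-r}{(1+r)^3}\right]^{\lambda_2}\le |g(z)|\le \left[\dfrac{1+r}{(1-r)^3}\right]^{\lambda_2}$; (ii) $\left[\dfrac{1-r}{(1+r)^3}\right]^{\lambda_1+\lambda_2}\le |f(z)|\le \left[\dfrac{1+r}{(1-r)^3}\right]^{\lambda_1+\lambda_2}$; (iii) $\sup_{z\in\mathbb{D}}(1-|z|^2)\left|\dfrac{f_z(z)}{f(z)}\right|\le 6\lambda_1$. All the estimates are sharp for $\lambda_1>\lambda_2$ (i.e. for any given $\lambda_1>\lambda_2>0$, none of the bounds can be improved within the class of such mappings $f$).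
   Context: $\mathbb{D}=\{z\in\mathbb{C}:|z|<1\}$. $\mathcal{S}_1$ is the class of all univalent (injective) analytic functions $H$ in $\mathbb{D}$ with $H'(0)=1$. For such $H$ and $\lambda>0$, $(H')^{\lambda}=\exp(\lambda\log H')$ with the analytic branch of $\log H'$ in $\mathbb{D}$ vanishing at $0$. A nonvanishing logharmonic mapping in $\mathbb{D}$ is a function $f=h\overline g$ with $h,g$ nonvanishing analytic functions in $\mathbb{D}$ satisfying $g'/g=\omega\,h'/h$ for some analytic function $\omega:\mathbb{D}\to\mathbb{D}$ (the dilatation of $f$). $f_z$ denotes the Wirtinger derivative $\partial f/\partial z$. *)

(* Defs.v *)
From Stdlib Require Import Reals.
From Coquelicot Require Import Coquelicot.

Open Scope R_scope.

Definition in_disk (z : C) : Prop := Cmod z < 1.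

(* Functions on the disk are total functions C -> C whose values outside the
   disk are irrelevant; every condition below is imposed on the disk only. *)
Definition analytic_on_disk (F : C -> C) : Prop :=
  forall z : C, in_disk z -> ex_derive (K := C_AbsRing) (V := C_NormedModule) F z.

Definition S1 (H : C -> C) : Prop :=
  analytic_on_disk H /\
  (forall z w : C, in_disk z -> in_disk w -> H z = H w -> z = w) /\
  C_derive H 0%C = 1%C.

Definition Cexp (z : C) : C := (exp (Re z) * cos (Im z), exp (Re z) * sin (Im z)).

Definition is_log_branch (F L : C -> C) : Prop :=
  analytic_on_disk L /\ L 0%C = 0%C /\
  forall z : C, in_disk z -> Cexp (L z) = F z.

(* On the disk, P is F ^ lam = exp (lam * log F), where log F is the (unique)
   analytic branch vanishing at 0. *)
Definition is_power (F : C -> C) (lam : R) (P : C -> C) : Prop :=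
  exists L : C -> C, is_log_branch F L /\
    forall z : C, in_disk z -> P z = Cexp (RtoC lam * L z)%C.

Definition nonvanishing_logharmonic (f h g : C -> C) : Prop :=
  analytic_on_disk h /\ analytic_on_disk g /\
  (forall z : C, in_disk z -> h z <> 0%C /\ g z <> 0%C) /\
  (forall z : C, in_disk z -> f z = (h z * Cconj (g z))%C) /\
  exists omega : C -> C,
    analytic_on_disk omega /\
    (forall z : C, in_disk z -> in_disk (omega z)) /\
    (forall z : C, in_disk z ->
       (C_derive g z / g z)%C = (omega z * (C_derive h z / h z))%C).

Definition dx (f : C -> C) (z : C) : C :=
  (Derive (fun t : R => Re (f (t, Im z))) (Re z),
   Derive (fun t : R => Im (f (t, Im z))) (Re z)).

Definition dy (f : C -> C) (z : C) : C :=
  (Derive (fun t : R => Re (f (Re z, t))) (Im z),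
   Derive (fun t : R => Im (f (Re z, t))) (Im z)).

Definition wirtinger_dz (f : C -> C) (z : C) : C :=
  ((dx f z - Ci * dy f z) / RtoC 2)%C.

Definition preschwarzian_norm (f : C -> C) : Rbar :=
  Lub_Rbar (fun x : R => exists z : C, in_disk z /\
    x = (1 - Cmod z ^ 2) * Cmod (wirtinger_dz f z / f z)%C).

Definition mapping_class (lam1 lam2 : R) (H G f h g : C -> C) : Prop :=
  S1 H /\ S1 G /\
  is_power (C_derive H) lam1 h /\ is_power (C_derive G) lam2 g /\
  nonvanishing_logharmonic f h g.

Definition lower_bound (r lam : R) : R := Rpower ((1 - r) / (1 + r) ^ 3) lam.

Definition upper_bound (r lam : R) : R := Rpower ((1 + r) / (1 - r) ^ 3) lam.

(* The values at points of modulus r, over the whole class with exponents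
   lam1, lam2, of a real quantity Q f h g z attached to f = h * conj g. *)
Definition class_values (lam1 lam2 r : R)
    (Q : (C -> C) -> (C -> C) -> (C -> C) -> C -> R) (x : R) : Prop :=
  exists (H G f h g : C -> C) (z : C),
    mapping_class lam1 lam2 H G f h g /\ Cmod z = r /\ x = Q f h g z.

(* Main.v *)
(* Put L = log H'.  Everything follows from Koebe's estimate |(1 - |a|^2) L'(a) - 2 conj a| <= 4, which is
   Bieberbach's inequality |a_2| <= 2 for the Koebe transform of H at a; integrating it along a radius bounds
   Re L, hence |H'|, and the triangle inequality bounds (1 - |a|^2) |L'(a)| by 6.

   Bieberbach's inequality is obtained without the area theorem.  For a charge of total mass zero in the plane,
   the kernel log (|u - v|^2 + s) is negative semidefinite.  Apply this to the charge cos t dt transported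
   to F (r e^(it)), where F is the odd square root transform of the normalised univalent function.
   Write |F z - F w| = |Q (z, w)| |z - w|: by injectivity Q does not vanish, so log |Q| is harmonic in each variable
   and its double Fourier coefficient is a Taylor coefficient, while |z - w| contributes an explicit constant.
   With s tending to 0 this gives r^2 Re (a_2 / 2) <= 1.

   Equality holds for H = G = z / (1 - z)^2, whose dilatation is the constant lam2 / lam1. *)
Require Import Defs.
From Stdlib Require Import Reals Factorial ClassicalEpsilon Lra Lia.
From Coquelicot Require Import Coquelicot.
Open Scope R_scope.

(** * Complex differentiability and continuity *)

(** The area theorem would require the area inside an image curve or a Laurent expansion; the energy
    argument only requires integrals over circles, which Cauchy's formula evaluates. The kernel
    inherits its sign from the Gaussian: [exp (- T d^2)] is a positive form, integrating
    [exp (- T (d^2 + s))] over [T > 0] gives [1 / (d^2 + s)], and integrating that in [s] gives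
    [ln (d^2 + s)] up to a constant, which a charge of total mass zero does not see. The shift [s]
    removes the singularity on the diagonal but destroys harmonicity. Harmonicity is recovered in
    two moves: [|Q|^2 |z - w|^2 + s] is replaced by [|Q|^2 (|z - w|^2 + s)], and
    [s = r^2 (1 - rho)^2 / rho] makes the bracket a constant times the squared modulus of a
    nonvanishing holomorphic function. The first move costs at most a constant times a Poisson
    kernel of total mass O(1 - rho). For fixed [w] the first coefficient of [log Q (., w)] at 0 is
    [1 / w - 1 / F w]. Since [F w = w + (a_2 / 2) w^3 + ...], this equals [(a_2 / 2) w + ...], which
    is how [a_2 / 2] enters. The condition [lam2 < lam1] in the sharpness part is exactly what puts
    the constant dilatation of the extremal mapping in the disk. *)

Notation cder F z l := (is_derive (K := C_AbsRing) (V := C_NormedModule) F (z : C) (l : C)).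
Notation rcder c t v := (is_derive (K := R_AbsRing) (V := C_R_NormedModule) c t (v : C)).

(** [is_derive] speaks of filters and of a module norm, whereas the remainders below are estimated
    by hand with [Cmod]; the translation is made once here. *)
Lemma cder_eps (F : C -> C) (z l : C) :
  cder F z l <->
  forall eps : R, 0 < eps -> exists d : R, 0 < d /\
    forall w : C, Cmod (w - z)%C < d ->
      Cmod (F w - F z - l * (w - z))%C <= eps * Cmod (w - z)%C.
Proof.
  split.
  - intros [_ D] eps He.
    destruct (D z (fun P HP => HP) (mkposreal eps He)) as [d Hd].
    exists d. split. apply d.
    intros w Hw. specialize (Hd w Hw).
    replace (l * (w - z))%C with ((w - z) * l)%C by ring.
    exact Hd.
  - intros D. split. apply is_linear_scal_l.
    intros x Hx eps.
    apply (is_filter_lim_locally_unique (K:=C_AbsRing) (V:=AbsRing_NormedModule C_AbsRing)) in Hx.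
    subst x.
    destruct (D eps (cond_pos eps)) as [d [Hd Hw]].
    exists (mkposreal d Hd). intros w Bw. specialize (Hw w Bw).
    replace (l * (w - z))%C with ((w - z) * l)%C in Hw by ring.
    exact Hw.
Qed.

Lemma rcder_eps (c : R -> C) (t : R) (v : C) :
  rcder c t v <->
  forall eps : R, 0 < eps -> exists d : R, 0 < d /\
    forall s : R, Rabs (s - t) < d ->
      Cmod (c s - c t - v * RtoC (s - t))%C <= eps * Rabs (s - t).
Proof.
  assert (E : forall s, (v * RtoC (s - t))%C = scal (V := C_R_NormedModule) (minus s t) v).
  { intros s. unfold scal, minus, plus, opp. cbn. unfold prod_scal, scal, mult. cbn. unfold Cmult, mult. cbn.
    f_equal; ring. }
  assert (N : forall x : C, Cmod x = norm (V := C_R_NormedModule) x).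
  { intros x. unfold Cmod. rewrite <- (pow2_abs (fst x)), <- (pow2_abs (snd x)). reflexivity. }
  split.
  - intros [_ D] eps He.
    destruct (D t (fun P HP => HP) (mkposreal eps He)) as [d Hd].
    exists d. split. apply d.
    intros s Hs. specialize (Hd s Hs). rewrite E, N. exact Hd.
  - intros D. split. apply is_linear_scal_l.
    intros x Hx eps.
    apply (is_filter_lim_locally_unique (K:=R_AbsRing) (V:=R_NormedModule)) in Hx.
    subst x.
    destruct (D eps (cond_pos eps)) as [d [Hd Hw]].
    exists (mkposreal d Hd). intros s Bw. specialize (Hw s Bw). rewrite E, N in Hw. exact Hw.
Qed.

Lemma continuous_pairC {U : UniformSpace} (f : U -> C) (x : U) :
  continuous (fun y => fst (f y)) x -> continuous (fun y => snd (f y)) x ->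
  continuous f x.
Proof.
  intros A B.
  apply continuous_ext with (fun y => (fst (f y), snd (f y))).
  intros y; destruct (f y); reflexivity.
  apply (continuous_comp_2 (fun y => fst (f y)) (fun y => snd (f y)) (fun a b : R => (a, b) : C)); auto.
  apply continuous_ext with (fun p : R * R => p). intros [a b]; reflexivity.
  apply continuous_id.
Qed.

Lemma continuous_fstC {U : UniformSpace} (f : U -> C) (x : U) :
  continuous f x -> continuous (fun y => fst (f y)) x.
Proof. intros A. apply (continuous_comp f (fun p : C => fst p)); auto. apply (continuous_fst (U:=R_UniformSpace) (V:=R_UniformSpace)). Qed.

Lemma continuous_sndC {U : UniformSpace} (f : U -> C) (x : U) :
  continuous f x -> continuous (fun y => snd (f y)) x.
Proof. intros A. apply (continuous_comp f (fun p : C => snd p)); auto. apply (continuous_snd (U:=R_UniformSpace) (V:=R_UniformSpace)). Qed.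

Lemma continuous_Cplus {U : UniformSpace} (f g : U -> C) (x : U) :
  continuous f x -> continuous g x -> continuous (fun y => f y + g y)%C x.
Proof.
  intros A B. apply continuous_pairC; cbn.
  apply (continuous_plus (K:=R_AbsRing) (V:=R_NormedModule)); now apply continuous_fstC.
  apply (continuous_plus (K:=R_AbsRing) (V:=R_NormedModule)); now apply continuous_sndC.
Qed.

Lemma continuous_Copp {U : UniformSpace} (f : U -> C) (x : U) :
  continuous f x -> continuous (fun y => - f y)%C x.
Proof.
  intros A. apply continuous_pairC; cbn.
  apply (continuous_opp (K:=R_AbsRing) (V:=R_NormedModule)); now apply continuous_fstC.
  apply (continuous_opp (K:=R_AbsRing) (V:=R_NormedModule)); now apply continuous_sndC.
Qed.

Lemma continuous_Cminus {U : UniformSpace} (f g : U -> C) (x : U) :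
  continuous f x -> continuous g x -> continuous (fun y => f y - g y)%C x.
Proof. intros A B. apply continuous_Cplus; auto. now apply continuous_Copp. Qed.

Lemma continuous_Rmult {U : UniformSpace} (f g : U -> R) (x : U) :
  continuous f x -> continuous g x -> continuous (fun y => f y * g y) x.
Proof. intros; now apply (continuous_mult (K:=R_AbsRing)). Qed.
Lemma continuous_Rplus {U : UniformSpace} (f g : U -> R) (x : U) :
  continuous f x -> continuous g x -> continuous (fun y => f y + g y) x.
Proof. intros; now apply (continuous_plus (K:=R_AbsRing) (V:=R_NormedModule)). Qed.
Lemma continuous_Ropp {U : UniformSpace} (f : U -> R) (x : U) :
  continuous f x -> continuous (fun y => - f y) x.
Proof. intros; now apply (continuous_opp (K:=R_AbsRing) (V:=R_NormedModule)). Qed.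
Lemma continuous_Rminus {U : UniformSpace} (f g : U -> R) (x : U) :
  continuous f x -> continuous g x -> continuous (fun y => f y - g y) x.
Proof. intros; apply continuous_Rplus; auto. now apply continuous_Ropp. Qed.
Lemma continuous_Rsqr {U : UniformSpace} (f : U -> R) (x : U) :
  continuous f x -> continuous (fun y => f y ^ 2) x.
Proof. intros; apply continuous_ext with (fun y => f y * f y). intros y. unfold pow. now rewrite Rmult_1_r. now apply continuous_Rmult. Qed.

Lemma continuous_Rcomp {U : UniformSpace} (f : U -> R) (g : R -> R) (x : U) :
  continuous f x -> continuity_pt g (f x) -> continuous (fun y => g (f y)) x.
Proof. intros A B. apply (continuous_comp f g); auto. now apply continuity_pt_filterlim. Qed.

Lemma continuous_Cmult {U : UniformSpace} (f g : U -> C) (x : U) :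
  continuous f x -> continuous g x -> continuous (fun y => f y * g y)%C x.
Proof.
  intros A B.
  pose proof (continuous_fstC _ _ A). pose proof (continuous_fstC _ _ B).
  pose proof (continuous_sndC _ _ A). pose proof (continuous_sndC _ _ B).
  apply continuous_pairC; cbn.
  apply continuous_Rminus; now apply continuous_Rmult.
  apply continuous_Rplus; now apply continuous_Rmult.
Qed.

Lemma sum_sqr_pos (z : C) : z <> 0%C -> 0 < fst z ^ 2 + snd z ^ 2.
Proof.
  intros H. destruct (Rle_lt_or_eq_dec 0 (fst z ^ 2 + snd z ^ 2)) as [h|h]; auto.
  nra. exfalso. apply H. destruct z as [a b]; cbn in *. apply injective_projections; cbn; nra.
Qed.

Lemma continuous_Cinv {U : UniformSpace} (f : U -> C) (x : U) :
  continuous f x -> f x <> 0%C -> continuous (fun y => / f y)%C x.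
Proof.
  intros A N.
  pose proof (continuous_fstC _ _ A). pose proof (continuous_sndC _ _ A).
  assert (continuous (fun y => / (fst (f y) ^ 2 + snd (f y) ^ 2)) x).
  { apply (continuous_comp (fun y => fst (f y) ^ 2 + snd (f y) ^ 2) Rinv).
    apply continuous_Rplus; now apply continuous_Rsqr.
    apply continuous_Rinv. apply Rgt_not_eq. now apply sum_sqr_pos. }
  apply continuous_pairC; cbn.
  - apply continuous_Rmult; auto.
  - apply continuous_Rmult; auto. now apply continuous_Ropp.
Qed.

Lemma continuous_Cdiv {U : UniformSpace} (f g : U -> C) (x : U) :
  continuous f x -> continuous g x -> g x <> 0%C -> continuous (fun y => f y / g y)%C x.
Proof. intros. apply continuous_Cmult; auto. now apply continuous_Cinv. Qed.

Lemma continuous_RtoC {U : UniformSpace} (f : U -> R) (x : U) :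
  continuous f x -> continuous (fun y => RtoC (f y)) x.
Proof. intros. apply continuous_pairC; cbn; auto. apply continuous_const. Qed.

Lemma continuous_Cmod {U : UniformSpace} (f : U -> C) (x : U) :
  continuous f x -> continuous (fun y => Cmod (f y)) x.
Proof.
  intros A. unfold Cmod.
  apply (continuous_comp (fun y => fst (f y) ^ 2 + snd (f y) ^ 2) sqrt).
  apply continuous_Rplus; apply continuous_Rsqr. now apply continuous_fstC. now apply continuous_sndC.
  apply continuous_sqrt.
Qed.

Lemma continuous_Cexp {U : UniformSpace} (f : U -> C) (x : U) :
  continuous f x -> continuous (fun y => Cexp (f y)) x.
Proof.
  intros A.
  pose proof (continuous_fstC _ _ A). pose proof (continuous_sndC _ _ A).
  assert (continuous (fun y => exp (fst (f y))) x).
  { apply continuous_Rcomp; auto. apply derivable_continuous_pt, derivable_pt_exp. }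
  assert (continuous (fun y => cos (snd (f y))) x).
  { apply continuous_Rcomp; auto. apply continuity_cos. }
  assert (continuous (fun y => sin (snd (f y))) x).
  { apply continuous_Rcomp; auto. apply continuity_sin. }
  apply continuous_pairC; cbn; apply continuous_Rmult; auto.
Qed.

Lemma ball_C_of_Cmod (z w : C) (e : R) : Cmod (w - z)%C < e -> ball (M := C_UniformSpace) z e w.
Proof. intros H. apply (C_NormedModule_mixin_compat1 z w e H). Qed.

(** Balls of the product space are squares; the exact loss sqrt 2 is rounded up to 2. *)
Lemma Cmod_of_ball_C (z w : C) (e : R) (he : 0 < e) :
  ball (M := C_UniformSpace) z e w -> Cmod (w - z)%C < 2 * e.
Proof.
  intros H. pose proof (C_NormedModule_mixin_compat2 z w (mkposreal e he) H) as H'.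
  apply Rlt_le_trans with (1 := H'). apply Rmult_le_compat_r. now left.
  pose proof (sqrt_sqrt 2). pose proof (sqrt_pos 2). nra.
Qed.

Lemma continuous_eps {U : UniformSpace} (f : U -> C) (x : U) :
  continuous f x <-> forall eps : R, 0 < eps -> locally x (fun y => Cmod (f y - f x)%C < eps).
Proof.
  split.
  - intros A eps He.
    assert (h : 0 < eps / 2) by lra.
    assert (X : locally x (fun y => ball (M := C_UniformSpace) (f x) (mkposreal _ h) (f y))).
    { apply A. apply locally_ball. }
    revert X. apply filter_imp. intros y Hy. apply (Cmod_of_ball_C _ _ _ h) in Hy. lra.
  - intros A P [e He]. specialize (A e (cond_pos e)).
    unfold filtermap. revert A. apply filter_imp. intros y Hy. apply He. now apply ball_C_of_Cmod.
Qed.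

Lemma ccont_eps (F : C -> C) (z : C) :
  continuous (T := C_UniformSpace) (U := C_UniformSpace) F z <->
  forall eps : R, 0 < eps -> exists d : R, 0 < d /\
    forall w : C, Cmod (w - z)%C < d -> Cmod (F w - F z)%C < eps.
Proof.
  rewrite continuous_eps. split; intros A eps He; destruct (A eps He) as [d Hd].
  - exists d. split. apply d. intros w Hw. apply Hd. now apply ball_C_of_Cmod.
  - destruct Hd as [Hd Hw].
    assert (h : 0 < d / 2) by lra. exists (mkposreal _ h).
    intros w Bw. apply Hw. apply (Cmod_of_ball_C _ _ _ h) in Bw. lra.
Qed.

Lemma cder_continuous (F : C -> C) (z l : C) : cder F z l -> continuous (T := C_UniformSpace) (U := C_UniformSpace) F z.
Proof.
  intros D. apply ccont_eps. intros eps He.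
  destruct (proj1 (cder_eps F z l) D 1 Rlt_0_1) as [d [Hd Hw]].
  pose proof (Cmod_ge_0 l) as Hl.
  assert (0 < eps / (2 + Cmod l)) by (apply Rdiv_lt_0_compat; lra).
  exists (Rmin d (eps / (2 + Cmod l))). split. apply Rmin_glb_lt; auto.
  intros w Hw'. assert (W1 : Cmod (w - z) < d) by (eapply Rlt_le_trans; [exact Hw'| apply Rmin_l]).
  assert (W2 : Cmod (w - z) < eps / (2 + Cmod l)) by (eapply Rlt_le_trans; [exact Hw'| apply Rmin_r]).
  specialize (Hw w W1).
  replace (F w - F z)%C with ((F w - F z - l * (w - z)) + l * (w - z))%C by ring.
  eapply Rle_lt_trans. apply Cmod_triangle. rewrite Cmod_mult.
  pose proof (Cmod_ge_0 (w - z)).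
  apply Rle_lt_trans with ((1 + Cmod l) * Cmod (w - z)). lra.
  apply (Rmult_lt_compat_l (2 + Cmod l)) in W2; [|lra].
  replace ((2 + Cmod l) * (eps / (2 + Cmod l))) with eps in W2 by (field; lra). nra.
Qed.

(** A chain rule across two scalar fields, complex outside and real inside. It carries complex
    differentiability over to circles, rays and homotopies, where all integrals live. *)
Lemma cder_comp_curve (F : C -> C) (c : R -> C) (t : R) (l v : C) :
  cder F (c t) l -> rcder c t v -> rcder (fun s => F (c s)) t (l * v)%C.
Proof.
  intros DF Dc. apply rcder_eps. intros eps He.
  rewrite cder_eps in DF. rewrite rcder_eps in Dc.
  pose proof (Cmod_ge_0 l) as Hl. pose proof (Cmod_ge_0 v) as Hv.
  set (e1 := eps / (2 * (1 + Cmod v))). set (e2 := Rmin 1 (eps / (2 * (1 + Cmod l)))).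
  assert (He1 : 0 < e1) by (apply Rdiv_lt_0_compat; lra).
  assert (He2 : 0 < e2) by (apply Rmin_glb_lt; [lra|apply Rdiv_lt_0_compat; lra]).
  destruct (DF e1 He1) as [d1 [Hd1 H1]]. destruct (Dc e2 He2) as [d2 [Hd2 H2]].
  exists (Rmin d2 (d1 / (1 + Cmod v))). split. apply Rmin_glb_lt; auto. apply Rdiv_lt_0_compat; lra.
  intros s Hs.
  assert (S2 : Rabs (s - t) < d2) by (eapply Rlt_le_trans; [exact Hs|apply Rmin_l]).
  assert (S1 : Rabs (s - t) < d1 / (1 + Cmod v)) by (eapply Rlt_le_trans; [exact Hs|apply Rmin_r]).
  specialize (H2 s S2). pose proof (Rabs_pos (s - t)) as Hp.
  assert (B : Cmod (c s - c t) <= (1 + Cmod v) * Rabs (s - t)).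
  { replace (c s - c t)%C with ((c s - c t - v * RtoC (s - t)) + v * RtoC (s - t))%C by ring.
    eapply Rle_trans. apply Cmod_triangle. rewrite Cmod_mult, Cmod_R.
    assert (e2 <= 1) by apply Rmin_l. nra. }
  assert (S3 : Cmod (c s - c t) < d1).
  { apply Rle_lt_trans with (1 := B). apply (Rmult_lt_compat_l (1 + Cmod v)) in S1; [|lra].
    replace ((1 + Cmod v) * (d1 / (1 + Cmod v))) with d1 in S1 by (field; lra). exact S1. }
  specialize (H1 _ S3).
  replace (F (c s) - F (c t) - l * v * RtoC (s - t))%C with
    ((F (c s) - F (c t) - l * (c s - c t)) + l * (c s - c t - v * RtoC (s - t)))%C by ring.
  eapply Rle_trans. apply Cmod_triangle. rewrite Cmod_mult.
  assert (T1 : Cmod (F (c s) - F (c t) - l * (c s - c t)) <= eps / 2 * Rabs (s - t)).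
  { eapply Rle_trans. exact H1. apply Rle_trans with (e1 * ((1 + Cmod v) * Rabs (s - t))).
    apply Rmult_le_compat_l; lra. right. unfold e1. field. lra. }
  assert (T2 : Cmod l * Cmod (c s - c t - v * RtoC (s - t)) <= eps / 2 * Rabs (s - t)).
  { apply Rle_trans with (Cmod l * (e2 * Rabs (s - t))). apply Rmult_le_compat_l; auto.
    assert (e2 <= eps / (2 * (1 + Cmod l))) by apply Rmin_r.
    assert (Cmod l * e2 <= eps / 2).
    { apply Rle_trans with ((1 + Cmod l) * (eps / (2 * (1 + Cmod l)))).
      apply Rmult_le_compat; lra. right; field; lra. }
    nra. }
  lra.
Qed.

(** The criterion behind the derivatives obtained from an explicit remainder: the inverse, the
    Cauchy integrals and the radial primitive. *)
Lemma cder_of_quadratic (F : C -> C) (z l : C) (K d : R) : 0 < d ->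
  (forall w : C, Cmod (w - z)%C < d ->
     Cmod (F w - F z - l * (w - z))%C <= K * (Cmod (w - z)%C * Cmod (w - z)%C)) ->
  cder F z l.
Proof.
  intros Hd H. apply cder_eps. intros eps He.
  pose proof (Rabs_pos K) as HK.
  assert (0 < eps / (1 + Rabs K)) by (apply Rdiv_lt_0_compat; lra).
  exists (Rmin d (eps / (1 + Rabs K))). split. apply Rmin_glb_lt; auto.
  intros w Hw.
  assert (W1 : Cmod (w - z) < d) by (eapply Rlt_le_trans; [exact Hw| apply Rmin_l]).
  assert (W2 : Cmod (w - z) < eps / (1 + Rabs K)) by (eapply Rlt_le_trans; [exact Hw| apply Rmin_r]).
  eapply Rle_trans. apply H; auto.
  pose proof (Cmod_ge_0 (w - z)). pose proof (Rle_abs K).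
  apply (Rmult_lt_compat_l (1 + Rabs K)) in W2; [|lra].
  replace ((1 + Rabs K) * (eps / (1 + Rabs K))) with eps in W2 by (field; lra).
  rewrite <- Rmult_assoc. apply Rmult_le_compat_r; auto. nra.
Qed.

Lemma cder_ext_loc (F G : C -> C) (z l : C) (d : R) : 0 < d ->
  (forall w, Cmod (w - z)%C < d -> F w = G w) -> cder F z l -> cder G z l.
Proof.
  intros Hd E D. apply cder_eps. intros eps He.
  destruct (proj1 (cder_eps F z l) D eps He) as [d' [Hd' H]].
  exists (Rmin d d'). split. apply Rmin_glb_lt; auto.
  intros w Hw. rewrite <- (E w), <- (E z).
  apply H. eapply Rlt_le_trans; [exact Hw|apply Rmin_r].
  all: try (eapply Rlt_le_trans; [exact Hw|apply Rmin_l]).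
  all: replace (z - z)%C with (RtoC 0) by ring; now rewrite Cmod_0.
Qed.

Lemma cder_eq (F : C -> C) (z l m : C) : cder F z l -> l = m -> cder F z m.
Proof. now intros A <-. Qed.

Lemma cder_const (c z : C) : cder (fun _ => c) z 0%C.
Proof. apply (is_derive_const (K := C_AbsRing) (V := C_NormedModule)). Qed.

Lemma cder_id (z : C) : cder (fun w => w) z 1%C.
Proof. apply cder_eps. intros eps He. exists 1. split. lra. intros w _. cbv beta.
  replace (w - z - 1 * (w - z))%C with (RtoC 0) by ring. rewrite Cmod_0. pose proof (Cmod_ge_0 (w - z)); nra. Qed.

Lemma cder_plus (F G : C -> C) (z l m : C) :
  cder F z l -> cder G z m -> cder (fun w => F w + G w)%C z (l + m)%C.
Proof. intros A B. apply (is_derive_plus (K := C_AbsRing) (V := C_NormedModule) _ _ _ _ _ A B). Qed.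

Lemma cder_opp (F : C -> C) (z l : C) : cder F z l -> cder (fun w => - F w)%C z (- l)%C.
Proof. intros A. apply (is_derive_opp (K := C_AbsRing) (V := C_NormedModule) _ _ _ A). Qed.

Lemma cder_minus (F G : C -> C) (z l m : C) :
  cder F z l -> cder G z m -> cder (fun w => F w - G w)%C z (l - m)%C.
Proof. intros A B. apply cder_plus; auto. now apply cder_opp. Qed.

(** [C] is a normed module over itself in two ways, and the general product and chain rules refer to
    the second. The little-o clause is the same for both, so only the linearity clause is proved
    again. *)
Lemma cder_AbsRing (F : C -> C) (z l : C) :
  cder F z l <-> is_derive (K := C_AbsRing) (V := AbsRing_NormedModule C_AbsRing) F z l.
Proof. split; intros [_ B]; (split; [apply is_linear_scal_l|exact B]). Qed.

Lemma cder_mult (F G : C -> C) (z l m : C) :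
  cder F z l -> cder G z m -> cder (fun w => F w * G w)%C z (l * G z + F z * m)%C.
Proof.
  intros A B. rewrite cder_AbsRing in A, B. rewrite cder_AbsRing.
  exact (is_derive_mult (K := C_AbsRing) F G z l m A B Cmult_comm).
Qed.

Lemma cder_comp (F G : C -> C) (z l m : C) :
  cder F (G z) l -> cder G z m -> cder (fun w => F (G w)) z (l * m)%C.
Proof.
  intros A B. rewrite Cmult_comm.
  apply (is_derive_comp (K := C_AbsRing) (V := C_NormedModule) F G z l m A). now apply cder_AbsRing.
Qed.

Lemma cder_Cinv (z : C) : z <> 0%C -> cder Cinv z (- / (z * z))%C.
Proof.
  intros Hz. pose proof (proj1 (Cmod_gt_0 z) Hz) as Hp.
  apply cder_of_quadratic with (K := 2 / (Cmod z * Cmod z * Cmod z)) (d := Cmod z / 2). lra.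
  intros w Hw.
  assert (W : Cmod z / 2 < Cmod w).
  { pose proof (Cmod_triangle (z - w) w) as T. replace (z - w + w)%C with z in T by ring.
    replace (z - w)%C with (- (w - z))%C in T by ring. rewrite Cmod_opp in T. lra. }
  assert (w <> 0%C) by (apply Cmod_gt_0; lra).
  replace (/ w - / z - - / (z * z) * (w - z))%C with (((w - z) * (w - z)) * / (w * (z * z)))%C by (field; auto).
  rewrite !Cmod_mult, Cmod_inv, !Cmod_mult. 2: now repeat apply Cmult_neq_0.
  rewrite Rmult_comm. apply Rmult_le_compat_r. pose proof (Cmod_ge_0 (w - z)); nra.
  unfold Rdiv. replace (2 * / (Cmod z * Cmod z * Cmod z)) with (/ ((Cmod z / 2) * (Cmod z * Cmod z))) by (field; lra).
  apply Rinv_le_contravar. apply Rmult_lt_0_compat; nra. apply Rmult_le_compat_r; nra.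
Qed.

(** * The complex exponential *)

Lemma Cexp_plus (z w : C) : Cexp (z + w)%C = (Cexp z * Cexp w)%C.
Proof.
  destruct z as [a b], w as [c d]. unfold Cexp, Cmult, Cplus. cbn.
  rewrite exp_plus, cos_plus, sin_plus. f_equal; ring.
Qed.

Lemma Cexp_0 : Cexp 0%C = 1%C.
Proof. unfold Cexp. cbn. rewrite exp_0, cos_0, sin_0. unfold RtoC. f_equal; ring. Qed.

Lemma Cmod_Cexp (z : C) : Cmod (Cexp z) = exp (fst z).
Proof.
  unfold Cmod, Cexp, Re, Im; cbn [fst snd].
  replace ((exp (fst z) * cos (snd z)) ^ 2 + (exp (fst z) * sin (snd z)) ^ 2) with (Rsqr (exp (fst z)) * (Rsqr (sin (snd z)) + Rsqr (cos (snd z)))) by (unfold Rsqr; ring).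
  rewrite sin2_cos2, Rmult_1_r. apply sqrt_Rsqr. left; apply exp_pos.
Qed.

Lemma Cexp_neq_0 (z : C) : Cexp z <> 0%C.
Proof. apply Cmod_gt_0. rewrite Cmod_Cexp. apply exp_pos. Qed.

Lemma Cexp_opp (z : C) : Cexp (- z)%C = (/ Cexp z)%C.
Proof.
  assert (E : (Cexp z * Cexp (- z))%C = 1%C) by (rewrite <- Cexp_plus, <- Cexp_0; f_equal; ring).
  replace (Cexp (- z)) with (Cexp z * Cexp (- z) * / Cexp z)%C by (field; apply Cexp_neq_0).
  rewrite E. ring.
Qed.

Lemma fst_le_Cmod (z : C) : Rabs (fst z) <= Cmod z.
Proof. eapply Rle_trans; [apply Rmax_l|apply Rmax_Cmod]. Qed.
Lemma snd_le_Cmod (z : C) : Rabs (snd z) <= Cmod z.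
Proof. eapply Rle_trans; [apply Rmax_r|apply Rmax_Cmod]. Qed.
Lemma Cmod_le_sum (z : C) : Cmod z <= Rabs (fst z) + Rabs (snd z).
Proof.
  replace z with (RtoC (fst z) + Ci * RtoC (snd z))%C at 1.
  eapply Rle_trans. apply Cmod_triangle. rewrite Cmod_mult, Cmod_Ci, !Cmod_R. lra.
  destruct z as [a b]. unfold Ci, RtoC, Cplus, Cmult. cbn. f_equal; ring.
Qed.

Lemma derive_eps (f : R -> R) (x l : R) : is_derive f x l ->
  forall eps, 0 < eps -> exists d, 0 < d /\ forall y, Rabs (y - x) < d -> Rabs (f y - f x - l * (y - x)) <= eps * Rabs (y - x).
Proof.
  intros [_ D] eps He. destruct (D x (fun P HP => HP) (mkposreal eps He)) as [d Hd].
  exists d. split. apply d. intros y Hy. specialize (Hd y Hy).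
  rewrite (Rmult_comm l). exact Hd.
Qed.

Lemma cder_Cexp_0 : cder Cexp 0%C 1%C.
Proof.
  apply cder_eps. intros eps He.
  assert (De : is_derive exp 0 1) by (rewrite <- exp_0; apply is_derive_exp).
  assert (Dc : is_derive cos 0 0) by (replace 0 with (- sin 0) at 2 by (rewrite sin_0; ring); apply is_derive_cos).
  assert (Ds : is_derive sin 0 1) by (rewrite <- cos_0; apply is_derive_sin).
  (* The 8 is 3 + 5, the number of error terms [e * m] in [E1] and [E2]. The 1/2 gives [2 * m <= 1],
     because the radius [d] is also kept below [e]. *)
  set (e := Rmin (1/2) (eps / 8)).
  assert (he : 0 < e) by (apply Rmin_glb_lt; lra).
  assert (he1 : e <= 1/2) by apply Rmin_l. assert (he2 : e <= eps / 8) by apply Rmin_r.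
  destruct (derive_eps _ _ _ De e he) as [d1 [Hd1 H1]].
  destruct (derive_eps _ _ _ Dc e he) as [d2 [Hd2 H2]].
  destruct (derive_eps _ _ _ Ds e he) as [d3 [Hd3 H3]].
  set (d := Rmin (Rmin d1 d2) (Rmin d3 e)).
  assert (A1 : d <= d1) by (eapply Rle_trans; [apply Rmin_l|apply Rmin_l]).
  assert (A2 : d <= d2) by (eapply Rle_trans; [apply Rmin_l|apply Rmin_r]).
  assert (A3 : d <= d3) by (eapply Rle_trans; [apply Rmin_r|apply Rmin_l]).
  assert (A4 : d <= e) by (eapply Rle_trans; [apply Rmin_r|apply Rmin_r]).
  assert (Ad : 0 < d) by (apply Rmin_glb_lt; apply Rmin_glb_lt; assumption).
  exists d. split; auto. intros w Hw.
  assert (W0 : (w - 0)%C = w) by ring. rewrite W0 in *. clear W0.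
  pose proof (fst_le_Cmod w) as R1. pose proof (snd_le_Cmod w) as R2.
  specialize (H1 (fst w)). specialize (H2 (snd w)). specialize (H3 (snd w)).
  rewrite !Rminus_0_r in *. rewrite exp_0 in H1. rewrite cos_0 in H2. rewrite sin_0 in H3.
  specialize (H1 ltac:(lra)). specialize (H2 ltac:(lra)). specialize (H3 ltac:(lra)).
  rewrite Cexp_0. destruct w as [x y]. cbn [fst snd] in *.
  set (m := Cmod (x, y)) in *. assert (0 <= m) by apply Cmod_ge_0.
  eapply Rle_trans. apply Cmod_le_sum. unfold Cexp, Re, Im, Cminus, Cplus, Copp, Cmult, RtoC; cbn [fst snd].
  assert (B1 : Rabs (exp x - 1) <= 2 * m).
  { replace (exp x - 1) with ((exp x - 1 - 1 * x) + x) by ring.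
    eapply Rle_trans. apply Rabs_triang. pose proof (Rabs_pos x). nra. }
  assert (B2 : Rabs (cos y - 1) <= e * m).
  { replace (cos y - 1) with (cos y - 1 - 0 * y) by ring. eapply Rle_trans. exact H2. apply Rmult_le_compat_l; lra. }
  assert (B3 : Rabs (sin y - y) <= e * m).
  { replace (sin y - y) with (sin y - 0 - 1 * y) by ring. eapply Rle_trans. exact H3. apply Rmult_le_compat_l; lra. }
  assert (B4 : Rabs (exp x - 1 - x) <= e * m).
  { replace (exp x - 1 - x) with (exp x - 1 - 1 * x) by ring. eapply Rle_trans. exact H1. apply Rmult_le_compat_l; lra. }
  assert (B5 : Rabs (sin y) <= 2 * m).
  { replace (sin y) with ((sin y - y) + y) by ring. eapply Rle_trans. apply Rabs_triang. nra. }
  assert (E1 : Rabs (exp x * cos y + - (1) + - (1 * x - 0 * y)) <= 3 * (e * m)).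
  { replace (exp x * cos y + - (1) + - (1 * x - 0 * y)) with ((exp x - 1 - x) + (cos y - 1) + (exp x - 1) * (cos y - 1)) by ring.
    eapply Rle_trans. apply Rabs_triang. eapply Rle_trans. apply Rplus_le_compat_r, Rabs_triang.
    rewrite Rabs_mult. assert (Rabs (exp x - 1) * Rabs (cos y - 1) <= 1 * (e * m)).
    apply Rmult_le_compat; try apply Rabs_pos; lra. lra. }
  assert (E2 : Rabs (exp x * sin y + - 0 + - (1 * y + 0 * x)) <= 5 * (e * m)).
  { replace (exp x * sin y + - 0 + - (1 * y + 0 * x)) with ((sin y - y) + (exp x - 1) * sin y) by ring.
    eapply Rle_trans. apply Rabs_triang. rewrite Rabs_mult.
    assert (Rabs (exp x - 1) * Rabs (sin y) <= (2 * m) * (2 * m)). apply Rmult_le_compat; try apply Rabs_pos; lra.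
    assert (m * m <= e * m) by (apply Rmult_le_compat_r; lra). lra. }
  assert (8 * (e * m) <= eps * m) by nra.
  eapply Rle_trans. apply Rplus_le_compat; [exact E1|exact E2]. lra.
Qed.

Lemma cder_Cexp (z : C) : cder Cexp z (Cexp z).
Proof.
  apply cder_ext_loc with (fun w => Cexp z * Cexp (w - z))%C 1. lra.
  intros w _. rewrite <- Cexp_plus. f_equal. ring.
  eapply cder_eq.
  apply cder_mult. apply cder_const.
  apply (cder_comp Cexp (fun w => w - z)%C z 1 (1 - 0)).
  replace (z - z)%C with (RtoC 0) by ring. apply cder_Cexp_0.
  apply cder_minus. apply cder_id. apply cder_const. cbv beta. ring.
Qed.

(* Continuity of F' is required so that Cauchy's formula needs no Goursat argument; it comes for free when F' = exp L. *)
Definition hol (F F' : C -> C) : Prop :=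
  forall z : C, Cmod z < 1 -> cder F z (F' z) /\ continuous (T := C_UniformSpace) (U := C_UniformSpace) F' z.

Lemma disk_open (z : C) (R0 : R) : Cmod z < R0 -> 0 < R0 - Cmod z /\ forall w, Cmod (w - z)%C < R0 - Cmod z -> Cmod w < R0.
Proof.
  intros H. split. lra. intros w Hw. pose proof (Cmod_triangle (w - z) z) as T.
  replace (w - z + z)%C with w in T by ring. lra.
Qed.

Lemma ccont_ext_loc (F G : C -> C) (z : C) (d : R) : 0 < d ->
  (forall w, Cmod (w - z)%C < d -> F w = G w) -> continuous (T := C_UniformSpace) (U := C_UniformSpace) F z ->
  continuous (T := C_UniformSpace) (U := C_UniformSpace) G z.
Proof.
  intros Hd E A. apply ccont_eps. intros eps He.
  destruct (proj1 (ccont_eps F z) A eps He) as [d' [Hd' H]].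
  exists (Rmin d d'). split. apply Rmin_glb_lt; auto.
  intros w Hw. rewrite <- (E w), <- (E z).
  apply H. eapply Rlt_le_trans; [exact Hw|apply Rmin_r].
  all: try (eapply Rlt_le_trans; [exact Hw|apply Rmin_l]).
  all: replace (z - z)%C with (RtoC 0) by ring; now rewrite Cmod_0.
Qed.

Lemma hol_ext (F G F' G' : C -> C) :
  (forall z, Cmod z < 1 -> F z = G z) -> (forall z, Cmod z < 1 -> F' z = G' z) -> hol F F' -> hol G G'.
Proof.
  intros E E' H z Hz. destruct (H z Hz) as [A B]. destruct (disk_open z 1 Hz) as [Hd Hw]. split.
  - rewrite <- E' by auto. apply cder_ext_loc with F (1 - Cmod z); auto.
  - apply ccont_ext_loc with F' (1 - Cmod z); auto.
Qed.

Lemma hol_continuous (F F' : C -> C) (z : C) : hol F F' -> Cmod z < 1 -> continuous (T := C_UniformSpace) (U := C_UniformSpace) F z.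
Proof. intros H Hz. destruct (H z Hz) as [A _]. eapply cder_continuous; eauto. Qed.

Lemma hol_const (c : C) : hol (fun _ => c) (fun _ => 0%C).
Proof. intros z _. split. apply cder_const. apply continuous_const. Qed.

Lemma hol_id : hol (fun z => z) (fun _ => 1%C).
Proof. intros z _. split. apply cder_id. apply continuous_const. Qed.

Lemma hol_plus (F F' G G' : C -> C) : hol F F' -> hol G G' -> hol (fun z => F z + G z)%C (fun z => F' z + G' z)%C.
Proof.
  intros HF HG z Hz. destruct (HF z Hz), (HG z Hz). split. now apply cder_plus. now apply continuous_Cplus.
Qed.

Lemma hol_minus (F F' G G' : C -> C) : hol F F' -> hol G G' -> hol (fun z => F z - G z)%C (fun z => F' z - G' z)%C.
Proof.
  intros HF HG z Hz. destruct (HF z Hz), (HG z Hz). split. now apply cder_minus. now apply continuous_Cminus.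
Qed.

Lemma hol_mult (F F' G G' : C -> C) : hol F F' -> hol G G' -> hol (fun z => F z * G z)%C (fun z => F' z * G z + F z * G' z)%C.
Proof.
  intros HF HG z Hz. destruct (HF z Hz), (HG z Hz). split. now apply cder_mult.
  apply continuous_Cplus; apply continuous_Cmult; auto; eapply hol_continuous; eauto.
Qed.

Lemma hol_comp (F F' G G' : C -> C) : (forall z, Cmod z < 1 -> Cmod (G z) < 1) -> hol F F' -> hol G G' ->
  hol (fun z => F (G z)) (fun z => F' (G z) * G' z)%C.
Proof.
  intros HD HF HG z Hz. destruct (HF (G z) (HD z Hz)), (HG z Hz). split. now apply cder_comp.
  apply continuous_Cmult; auto.
  apply (continuous_comp (U:=C_UniformSpace) (V:=C_UniformSpace) (W:=C_UniformSpace) G F'); auto. eapply hol_continuous; eauto.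
Qed.

Lemma hol_inv (F F' : C -> C) : (forall z, Cmod z < 1 -> F z <> 0%C) -> hol F F' ->
  hol (fun z => / F z)%C (fun z => - F' z / (F z * F z))%C.
Proof.
  intros HN HF z Hz. destruct (HF z Hz) as [A B]. specialize (HN z Hz).
  pose proof (hol_continuous _ _ _ HF Hz). split.
  - apply cder_eq with (- / (F z * F z) * F' z)%C.
    apply (cder_comp Cinv F); [exact (cder_Cinv _ HN)|exact A]. unfold Cdiv. ring.
  - apply continuous_Cdiv. now apply continuous_Copp. now apply continuous_Cmult. now apply Cmult_neq_0.
Qed.

Lemma hol_exp (F F' : C -> C) : hol F F' -> hol (fun z => Cexp (F z)) (fun z => Cexp (F z) * F' z)%C.
Proof.
  intros HF z Hz. destruct (HF z Hz) as [A B]. split.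
  - apply (cder_comp Cexp F); [apply cder_Cexp|exact A].
  - apply continuous_Cmult; auto. apply continuous_Cexp. eapply hol_continuous; eauto.
Qed.

(** * Curve integrals and Cauchy's formula *)

Notation CRInt f a b := (RInt (V := C_R_CompleteNormedModule) f a b : C).
Notation ex_CRInt := (ex_RInt (V := C_R_NormedModule)).
Notation ccont f x := (continuous (T := R_UniformSpace) (U := C_UniformSpace) f (x : R)).

Lemma norm_C_R (x : C) : norm (V := C_R_NormedModule) x = Cmod x.
Proof. unfold Cmod. rewrite <- (pow2_abs (fst x)), <- (pow2_abs (snd x)). reflexivity. Qed.

Lemma ex_CRInt_cont (f : R -> C) (a b : R) : (forall t, ccont f t) -> ex_CRInt f a b.
Proof. intros H. apply (ex_RInt_continuous (V := C_R_CompleteNormedModule)). intros t _. exact (H t). Qed.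

Lemma CRInt_pair (f : R -> C) (a b : R) : ex_CRInt f a b ->
  CRInt f a b = (RInt (fun t => fst (f t)) a b, RInt (fun t => snd (f t)) a b).
Proof.
  intros H. pose proof (RInt_correct (V := C_R_CompleteNormedModule) _ _ _ H) as I.
  apply injective_projections; cbn [fst snd]; symmetry; apply is_RInt_unique.
  now apply (is_RInt_fct_extend_fst (U := R_NormedModule) (V := R_NormedModule)) in I.
  now apply (is_RInt_fct_extend_snd (U := R_NormedModule) (V := R_NormedModule)) in I.
Qed.

Lemma ex_CRInt_fst (f : R -> C) (a b : R) : ex_CRInt f a b -> ex_RInt (fun t => fst (f t)) a b.
Proof. intros [l H]. exists (fst l). now apply (is_RInt_fct_extend_fst (U := R_NormedModule) (V := R_NormedModule)) in H. Qed.
Lemma ex_CRInt_snd (f : R -> C) (a b : R) : ex_CRInt f a b -> ex_RInt (fun t => snd (f t)) a b.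
Proof. intros [l H]. exists (snd l). now apply (is_RInt_fct_extend_snd (U := R_NormedModule) (V := R_NormedModule)) in H. Qed.

Lemma CRInt_ext (f g : R -> C) (a b : R) : (forall t, f t = g t) -> CRInt f a b = CRInt g a b.
Proof. intros H. apply (RInt_ext (V := C_R_CompleteNormedModule)). intros; apply H. Qed.

Lemma CRInt_const (c : C) (a b : R) : CRInt (fun _ => c) a b = (RtoC (b - a) * c)%C.
Proof.
  rewrite (RInt_const (V := C_R_CompleteNormedModule)). destruct c as [x y].
  unfold scal; cbn. unfold prod_scal, scal; cbn. unfold mult; cbn. unfold Cmult; cbn. f_equal; ring.
Qed.

Lemma CRInt_plus (f g : R -> C) (a b : R) : ex_CRInt f a b -> ex_CRInt g a b ->
  CRInt (fun t => f t + g t)%C a b = (CRInt f a b + CRInt g a b)%C.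
Proof. intros F G. exact (RInt_plus (V := C_R_CompleteNormedModule) f g a b F G). Qed.

Lemma CRInt_minus (f g : R -> C) (a b : R) : ex_CRInt f a b -> ex_CRInt g a b ->
  CRInt (fun t => f t - g t)%C a b = (CRInt f a b - CRInt g a b)%C.
Proof. intros F G. exact (RInt_minus (V := C_R_CompleteNormedModule) f g a b F G). Qed.

Lemma is_CRInt_mult_l (c : C) (f : R -> C) (a b : R) (l : C) :
  is_RInt (V := C_R_NormedModule) f a b l ->
  is_RInt (V := C_R_NormedModule) (fun t => c * f t)%C a b (c * l)%C.
Proof.
  intros H.
  pose proof (is_RInt_fct_extend_fst (U := R_NormedModule) (V := R_NormedModule) _ _ _ _ H) as H1.
  pose proof (is_RInt_fct_extend_snd (U := R_NormedModule) (V := R_NormedModule) _ _ _ _ H) as H2.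
  apply (is_RInt_fct_extend_pair (U := R_NormedModule) (V := R_NormedModule)); cbn.
  apply (is_RInt_minus (V := R_NormedModule)); apply (is_RInt_scal (V := R_NormedModule)); assumption.
  apply (is_RInt_plus (V := R_NormedModule)); apply (is_RInt_scal (V := R_NormedModule)); assumption.
Qed.

Lemma ex_CRInt_mult_l (c : C) (f : R -> C) (a b : R) : ex_CRInt f a b -> ex_CRInt (fun t => c * f t)%C a b.
Proof. intros [l H]. exists (c * l)%C. now apply is_CRInt_mult_l. Qed.

Lemma CRInt_mult_l (c : C) (f : R -> C) (a b : R) : ex_CRInt f a b ->
  CRInt (fun t => c * f t)%C a b = (c * CRInt f a b)%C.
Proof.
  intros H. apply (is_RInt_unique (V := C_R_CompleteNormedModule)). apply is_CRInt_mult_l.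
  now apply (RInt_correct (V := C_R_CompleteNormedModule)).
Qed.

Lemma CRInt_lin2 (f k : R -> C) (c : C) (a b : R) : ex_CRInt f a b -> ex_CRInt k a b ->
  (CRInt f a b + c * CRInt k a b)%C = CRInt (fun t => f t + c * k t)%C a b.
Proof.
  intros Hf Hk. rewrite (CRInt_plus f (fun t => c * k t)%C), CRInt_mult_l; auto. now apply ex_CRInt_mult_l.
Qed.

Lemma CRInt_lin3 (f g k : R -> C) (c : C) (a b : R) : ex_CRInt f a b -> ex_CRInt g a b -> ex_CRInt k a b ->
  (CRInt f a b - CRInt g a b - c * CRInt k a b)%C = CRInt (fun t => f t - g t - c * k t)%C a b.
Proof.
  intros Hf Hg Hk.
  rewrite (CRInt_minus (fun t => f t - g t)%C (fun t => c * k t)%C), (CRInt_minus f g), CRInt_mult_l; auto.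
  now apply (ex_RInt_minus (V := C_R_NormedModule) f g). now apply ex_CRInt_mult_l.
Qed.

Lemma Cmod_CRInt_le (f : R -> C) (g : R -> R) (a b : R) : a <= b ->
  (forall t, a <= t <= b -> Cmod (f t) <= g t) -> ex_CRInt f a b -> ex_RInt g a b ->
  Cmod (CRInt f a b) <= RInt g a b.
Proof.
  intros Hab H F G. rewrite <- norm_C_R.
  apply (norm_RInt_le (V := C_R_NormedModule) f g a b); auto.
  intros t Ht. rewrite norm_C_R. auto.
  now apply (RInt_correct (V := C_R_CompleteNormedModule)).
  now apply (RInt_correct (V := R_CompleteNormedModule)).
Qed.

Lemma Cmod_CRInt_le_const (f : R -> C) (M a b : R) : a <= b ->
  (forall t, a <= t <= b -> Cmod (f t) <= M) -> ex_CRInt f a b ->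
  Cmod (CRInt f a b) <= (b - a) * M.
Proof.
  intros Hab H F.
  replace ((b - a) * M) with (RInt (fun _ => M) a b).
  apply Cmod_CRInt_le; auto. apply ex_RInt_const.
  rewrite RInt_const. reflexivity.
Qed.

Lemma CRInt_derive_le (f f' : R -> C) (a b : R) : a <= b ->
  (forall t, a <= t <= b -> rcder f t (f' t)) -> (forall t, a <= t <= b -> ccont f' t) ->
  CRInt f' a b = (f b - f a)%C.
Proof.
  intros Hab D Ct. apply (is_RInt_unique (V := C_R_CompleteNormedModule)).
  apply (is_RInt_derive (V := C_R_CompleteNormedModule) f f');
  rewrite Rmin_left, Rmax_right by auto; auto.
Qed.

Lemma CRInt_derive (f f' : R -> C) (a b : R) :
  (forall t, rcder f t (f' t)) -> (forall t, ccont f' t) -> CRInt f' a b = (f b - f a)%C.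
Proof.
  intros D Ct. apply (is_RInt_unique (V := C_R_CompleteNormedModule)).
  apply (is_RInt_derive (V := C_R_CompleteNormedModule) f f'); auto.
Qed.

Lemma ex_CRInt_cont_le (f : R -> C) (a b : R) : a <= b -> (forall t, a <= t <= b -> ccont f t) -> ex_CRInt f a b.
Proof.
  intros Hab H. apply (ex_RInt_continuous (V := C_R_CompleteNormedModule)).
  rewrite Rmin_left, Rmax_right by auto. intros t Ht. exact (H t Ht).
Qed.

Lemma rcder_fst (c : R -> C) (t : R) (v : C) : rcder c t v -> is_derive (fun s => fst (c s)) t (fst v).
Proof.
  intros D. split. apply is_linear_scal_l. intros x Hx eps.
  apply (is_filter_lim_locally_unique (K:=R_AbsRing) (V:=R_NormedModule)) in Hx. subst x.
  destruct (proj1 (rcder_eps c t v) D eps (cond_pos eps)) as [d [Hd H]].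
  exists (mkposreal d Hd). intros s Bs. specialize (H s Bs).
  eapply Rle_trans; [|exact H]. eapply Rle_trans; [|apply fst_le_Cmod].
  right. cbn. unfold norm, minus, plus, opp, scal; cbn. unfold abs, mult; cbn. f_equal. ring.
Qed.

Lemma rcder_snd (c : R -> C) (t : R) (v : C) : rcder c t v -> is_derive (fun s => snd (c s)) t (snd v).
Proof.
  intros D. split. apply is_linear_scal_l. intros x Hx eps.
  apply (is_filter_lim_locally_unique (K:=R_AbsRing) (V:=R_NormedModule)) in Hx. subst x.
  destruct (proj1 (rcder_eps c t v) D eps (cond_pos eps)) as [d [Hd H]].
  exists (mkposreal d Hd). intros s Bs. specialize (H s Bs).
  eapply Rle_trans; [|exact H]. eapply Rle_trans; [|apply snd_le_Cmod].
  right. cbn. unfold norm, minus, plus, opp, scal; cbn. unfold abs, mult; cbn. f_equal. ring.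
Qed.

Lemma rcder_pair (c : R -> C) (t : R) (u v : R) :
  is_derive (fun s => fst (c s)) t u -> is_derive (fun s => snd (c s)) t v -> rcder c t (u, v).
Proof.
  intros A B. apply rcder_eps. intros eps He. assert (he : 0 < eps / 2) by lra.
  destruct (derive_eps _ _ _ A _ he) as [d1 [Hd1 H1]]. destruct (derive_eps _ _ _ B _ he) as [d2 [Hd2 H2]].
  exists (Rmin d1 d2). split. now apply Rmin_glb_lt.
  intros s Hs.
  assert (S1 : Rabs (s - t) < d1) by (eapply Rlt_le_trans; [exact Hs|apply Rmin_l]).
  assert (S2 : Rabs (s - t) < d2) by (eapply Rlt_le_trans; [exact Hs|apply Rmin_r]).
  specialize (H1 s S1). specialize (H2 s S2).
  eapply Rle_trans. apply Cmod_le_sum. cbn.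
  replace (fst (c s) + - fst (c t) + - (u * (s - t) - v * 0)) with (fst (c s) - fst (c t) - u * (s - t)) by ring.
  replace (snd (c s) + - snd (c t) + - (u * 0 + v * (s - t))) with (snd (c s) - snd (c t) - v * (s - t)) by ring.
  lra.
Qed.

Lemma continuity_2d_pt_of_continuous (k : R -> R -> R) (x y : R) :
  continuous (fun p : R * R => k (fst p) (snd p)) (x, y) -> continuity_2d_pt k x y.
Proof. intros H. apply continuity_2d_pt_filterlim. exact H. Qed.

Lemma is_derive_RInt_param_C1 (k k' : R -> R -> R) (a b t0 d : R) : 0 < d ->
  (forall t th, Rabs (t - t0) < d -> is_derive (fun s => k s th) t (k' t th)) ->
  (forall th, continuous (fun p : R * R => k' (fst p) (snd p)) (t0, th)) ->
  (forall t, Rabs (t - t0) < d -> ex_RInt (k t) a b) ->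
  is_derive (fun t => RInt (k t) a b) t0 (RInt (k' t0) a b).
Proof.
  intros Hd D Ct I.
  rewrite <- (RInt_ext (fun th => Derive (fun s => k s th) t0)).
  2:{ intros th _. apply is_derive_unique. apply D. rewrite Rminus_diag, Rabs_R0; lra. }
  apply is_derive_RInt_param.
  - exists (mkposreal d Hd). intros t Ht th _. eexists. apply D. exact Ht.
  - intros th _. apply continuity_2d_pt_ext_loc with k'.
    + exists (mkposreal d Hd). intros u v Hu _. symmetry. apply is_derive_unique. apply D. exact Hu.
    + apply continuity_2d_pt_of_continuous. apply Ct.
  - exists (mkposreal d Hd). intros t Ht. apply I. exact Ht.
Qed.

Lemma rcder_CRInt_param (k k' : R -> R -> C) (a b t0 d : R) : 0 < d ->
  (forall t th, Rabs (t - t0) < d -> rcder (fun s => k s th) t (k' t th)) ->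
  (forall th, continuous (T := prod_UniformSpace R_UniformSpace R_UniformSpace) (U := C_UniformSpace)
      (fun p : R * R => k' (fst p) (snd p)) (t0, th)) ->
  (forall t, Rabs (t - t0) < d -> ex_CRInt (k t) a b) ->
  ex_CRInt (k' t0) a b ->
  rcder (fun t => CRInt (k t) a b) t0 (CRInt (k' t0) a b).
Proof.
  intros Hd D Ct I I0.
  rewrite (CRInt_pair (k' t0)) by auto.
  assert (L : forall t, Rabs (t - t0) < d -> CRInt (k t) a b = (RInt (fun th => fst (k t th)) a b, RInt (fun th => snd (k t th)) a b)).
  { intros t Ht. apply CRInt_pair. auto. }
  apply rcder_pair.
  - apply (is_derive_ext_loc (fun t => RInt (fun th => fst (k t th)) a b)).
    + exists (mkposreal d Hd). intros t Ht. rewrite L; auto.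
    + apply (is_derive_RInt_param_C1 (fun t th => fst (k t th)) (fun t th => fst (k' t th)) a b t0 d); auto.
      intros t th Ht. apply (rcder_fst (fun s => k s th)). auto.
      intros th. apply continuous_fstC. apply Ct.
      intros t Ht. apply ex_CRInt_fst. auto.
  - apply (is_derive_ext_loc (fun t => RInt (fun th => snd (k t th)) a b)).
    + exists (mkposreal d Hd). intros t Ht. rewrite L; auto.
    + apply (is_derive_RInt_param_C1 (fun t th => snd (k t th)) (fun t th => snd (k' t th)) a b t0 d); auto.
      intros t th Ht. apply (rcder_snd (fun s => k s th)). auto.
      intros th. apply continuous_sndC. apply Ct.
      intros t Ht. apply ex_CRInt_snd. auto.
Qed.

Lemma rcder_zero_const (c : R -> C) (a b : R) : a < b ->
  (forall t, a <= t <= b -> rcder c t 0%C) -> c a = c b.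
Proof.
  intros Hab H. apply (eq_is_derive (V := C_R_NormedModule) c a b); auto.
Qed.

(** * The unit circle *)

Definition cis (t : R) : C := (cos t, sin t).

Lemma Cmod_cis (t : R) : Cmod (cis t) = 1.
Proof.
  unfold Cmod, cis; cbn [fst snd].
  replace (cos t ^ 2 + sin t ^ 2) with (Rsqr (sin t) + Rsqr (cos t)) by (unfold Rsqr; ring).
  rewrite sin2_cos2. apply sqrt_1.
Qed.

Lemma rcder_cis (t : R) : rcder cis t (Ci * cis t)%C.
Proof.
  replace (Ci * cis t)%C with ((- sin t, cos t) : C).
  apply rcder_pair; cbn. apply is_derive_cos. apply is_derive_sin.
  unfold Ci, cis, Cmult; cbn. f_equal; ring.
Qed.

Lemma continuous_cis {U : UniformSpace} (f : U -> R) (x : U) :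
  continuous f x -> continuous (fun y => cis (f y)) x.
Proof.
  intros A. apply continuous_pairC; cbn; apply continuous_Rcomp; auto. apply continuity_cos. apply continuity_sin.
Qed.

Lemma rcder_eq (c : R -> C) (t : R) (u v : C) : rcder c t u -> u = v -> rcder c t v.
Proof. now intros H <-. Qed.

Lemma rcder_ext (c d : R -> C) (t : R) (v : C) : (forall s, c s = d s) -> rcder c t v -> rcder d t v.
Proof. intros E. apply (is_derive_ext (V := C_R_NormedModule)). exact E. Qed.

Lemma rcder_RtoC (t : R) : rcder RtoC t 1%C.
Proof. apply rcder_pair; cbn. apply (is_derive_id (K := R_AbsRing)). apply (is_derive_const (K := R_AbsRing) (V := R_NormedModule)). Qed.

Lemma rcder_affine (a b : C) (c : R -> C) (t : R) (v : C) : rcder c t v ->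
  rcder (fun s => a + b * c s)%C t (b * v)%C.
Proof.
  intros H. apply (cder_comp_curve (fun w => a + b * w)%C); auto.
  eapply cder_eq. apply cder_plus. apply cder_const. apply cder_mult. apply cder_const. apply cder_id.
  cbv beta. ring.
Qed.

Lemma rcder_mult_r (c : R -> C) (w v : C) (t : R) : rcder c t v ->
  rcder (fun s => c s * w)%C t (v * w)%C.
Proof.
  intros H. eapply rcder_eq. apply (cder_comp_curve (fun u => u * w)%C); eauto.
  apply cder_mult. apply cder_id. apply cder_const. cbv beta. ring.
Qed.

Lemma cis_2PI : cis (2 * PI) = cis 0.
Proof. unfold cis. now rewrite cos_2PI, sin_2PI, cos_0, sin_0. Qed.

Lemma Ci_neq_0 : Ci <> 0%C.
Proof. apply Cmod_gt_0. rewrite Cmod_Ci. lra. Qed.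

Lemma RtoC_neq_0 (t : R) : t <> 0 -> RtoC t <> 0%C.
Proof. intros H E. apply H. now injection E. Qed.

Notation CI f := (CRInt f 0 (2 * PI)).
Notation RRcont f p := (continuous (T := prod_UniformSpace R_UniformSpace R_UniformSpace) (U := C_UniformSpace) f (p : R * R)).

(** Follows the syntax of the function. What may stay open is the nonvanishing of denominators and
    the continuity of functions about which no hypothesis is at hand. *)
Ltac cont :=
  lazymatch goal with
  | H : ?P |- ?P => exact H
  | |- continuous (fun _ => ?c) _ => apply continuous_const
  | |- continuous (fun x => x) _ => apply continuous_id
  | |- continuous (fun x => fst x) _ => apply (continuous_fst (U := R_UniformSpace) (V := R_UniformSpace))
  | |- continuous (fun x => snd x) _ => apply (continuous_snd (U := R_UniformSpace) (V := R_UniformSpace))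
  | |- continuous (fun x => Cplus _ _) _ => apply continuous_Cplus; cont
  | |- continuous (fun x => Cminus _ _) _ => apply continuous_Cminus; cont
  | |- continuous (fun x => Copp _) _ => apply continuous_Copp; cont
  | |- continuous (fun x => Cmult _ _) _ => apply continuous_Cmult; cont
  | |- continuous (fun x => Cdiv _ _) _ => apply continuous_Cdiv; cont
  | |- continuous (fun x => Cinv _) _ => apply continuous_Cinv; cont
  | |- continuous (fun x => RtoC _) _ => apply continuous_RtoC; cont
  | |- continuous (fun x => cis _) _ => apply continuous_cis; cont
  | |- continuous (fun x => Cexp _) _ => apply continuous_Cexp; cont
  | |- continuous (fun x => Cmod _) _ => apply continuous_Cmod; cont
  | |- continuous (fun x => Rmult _ _) _ => apply continuous_Rmult; cont
  | |- continuous (fun x => Rplus _ _) _ => apply continuous_Rplus; cont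
  | |- continuous (fun x => Rminus _ _) _ => apply continuous_Rminus; cont
  | |- continuous (fun x => Ropp _) _ => apply continuous_Ropp; cont
  | |- continuous (fun x => pow _ 2) _ => apply continuous_Rsqr; cont
  | |- continuous (fun x => cos _) _ => apply continuous_Rcomp; [cont|apply continuity_cos]
  | |- continuous (fun x => sin _) _ => apply continuous_Rcomp; [cont|apply continuity_sin]
  | |- continuous cis _ => apply (continuous_cis (fun x => x)), continuous_id
  | |- continuous RtoC _ => apply (continuous_RtoC (fun x => x)), continuous_id
  | |- continuous Cexp _ => apply (continuous_Cexp (fun x => x)), continuous_id
  | |- continuous Cmod _ => apply (continuous_Cmod (fun x => x)), continuous_id
  | |- continuous cos _ => apply (continuous_Rcomp (fun x => x) cos); [apply continuous_id|apply continuity_cos]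
  | |- continuous sin _ => apply (continuous_Rcomp (fun x => x) sin); [apply continuous_id|apply continuity_sin]
  | |- continuous fst _ => apply (continuous_fst (U := R_UniformSpace) (V := R_UniformSpace))
  | |- continuous snd _ => apply (continuous_snd (U := R_UniformSpace) (V := R_UniformSpace))
  | |- continuous ?f _ => first [ solve [auto] | progress (unfold f); cont | idtac ]
  | _ => auto
  end.

Lemma circle_neq (r : R) (z : C) (th : R) : 0 < r -> Cmod z < r -> (RtoC r * cis th - z)%C <> 0%C.
Proof.
  intros Hr Hz E. assert (z = (RtoC r * cis th)%C).
  { replace z with (RtoC r * cis th - (RtoC r * cis th - z))%C by ring. rewrite E. ring. }
  subst z. rewrite Cmod_mult, Cmod_cis, Cmod_R, Rabs_pos_eq in Hz; lra.
Qed.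

(** The circle is contracted to [z] along [z + (zeta - z) t]. The derivative in [t] of the integrand
    is [F' (z + (zeta - z) t) * zeta], which for [t <> 0] is the derivative in the angle of
    [F (z + (zeta - z) t) / (Ci t)]. Its integral over a full turn is therefore 0, and the values at
    [t = 1] and [t = 0] are the two sides. *)
Lemma cauchy_aux (F F' : C -> C) (r : R) (z : C) : hol F F' -> 0 < r < 1 -> Cmod z < r ->
  CI (fun th => F (RtoC r * cis th) * (RtoC r * cis th / (RtoC r * cis th - z)))%C =
  (F z * CI (fun th => RtoC r * cis th / (RtoC r * cis th - z)))%C.
Proof.
  intros HF Hr Hz.
  set (zeta := fun th => (RtoC r * cis th)%C).
  assert (Nz : forall th, (zeta th - z)%C <> 0%C) by (intros th; apply circle_neq; lra).
  assert (Cz : forall th, ccont zeta th). { intros th; unfold zeta; cont. }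
  assert (Mz : forall th, Cmod (zeta th) = r).
  { intros th. unfold zeta. rewrite Cmod_mult, Cmod_cis, Cmod_R, Rabs_pos_eq; lra. }
  set (k := fun (t th : R) => (F (z + (zeta th - z) * RtoC t) * (zeta th / (zeta th - z)))%C).
  set (k' := fun (t th : R) => (F' (z + (zeta th - z) * RtoC t) * zeta th)%C).
  (* Differentiating in [t] at 0 and 1 needs room outside the unit interval. By convexity the point
     for [t0] has modulus at most [r], and a change of [t] by less than [(1 - r) / 3] moves it by
     less than [1 - r], since [|zeta - z| <= 2 r]. *)
  assert (In : forall t0 t th, 0 <= t0 <= 1 -> Rabs (t - t0) < (1 - r) / 3 -> Cmod (z + (zeta th - z) * RtoC t) < 1).
  { intros t0 t th Ht0 Ht.
    replace (z + (zeta th - z) * RtoC t)%C with ((RtoC (1 - t0) * z + RtoC t0 * zeta th) + (zeta th - z) * RtoC (t - t0))%C.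
    2:{ rewrite !RtoC_minus. ring. }
    pose proof (Cmod_ge_0 z).
    eapply Rle_lt_trans. apply Cmod_triangle. rewrite Cmod_mult, Cmod_R.
    assert (A : Cmod (zeta th - z) <= 2 * r).
    { eapply Rle_trans. apply Cmod_triangle. rewrite Cmod_opp, Mz. lra. }
    assert (B : Cmod (RtoC (1 - t0) * z + RtoC t0 * zeta th) <= r).
    { eapply Rle_trans. apply Cmod_triangle. rewrite !Cmod_mult, !Cmod_R, Mz, !Rabs_pos_eq by lra. nra. }
    pose proof (Rabs_pos (t - t0)). pose proof (Cmod_ge_0 (zeta th - z)). nra. }
  assert (D : forall t th, Cmod (z + (zeta th - z) * RtoC t) < 1 -> rcder (fun s => k s th) t (k' t th)).
  { intros t th H. unfold k, k'. eapply rcder_eq.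
    apply (rcder_mult_r (fun s => F (z + (zeta th - z) * RtoC s)%C)).
    apply (cder_comp_curve F). apply HF. exact H. apply rcder_affine, rcder_RtoC.
    field. apply Nz. }
  assert (E : CI (k 0) = CI (k 1)).
  { apply (rcder_zero_const (fun t => CI (k t)) 0 1). lra.
    intros t Ht.
    assert (In' : forall th, Cmod (z + (zeta th - z) * RtoC t) < 1).
    { intros th. apply (In t); auto. rewrite Rminus_diag, Rabs_R0. lra. }
    assert (Cs : forall th, RRcont (fun p => z + (zeta (snd p) - z) * RtoC (fst p))%C (t, th)).
    { intros th. unfold zeta. cont. }
    assert (Ck' : forall th, RRcont (fun p => k' (fst p) (snd p)) (t, th)).
    { intros th. unfold k'. apply continuous_Cmult.
      - apply (continuous_comp (fun p => z + (zeta (snd p) - z) * RtoC (fst p))%C F').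
        apply Cs. cbn. apply HF. apply In'.
      - unfold zeta. cont. }
    assert (Ck1 : forall th, ccont (k' t) th).
    { intros th. apply continuous_Cmult; [|apply Cz].
      apply (continuous_comp (fun th => z + (zeta th - z) * RtoC t)%C F'). unfold zeta; cont. apply HF, In'. }
    eapply rcder_eq.
    apply (rcder_CRInt_param k k' 0 (2 * PI) t ((1 - r) / 3)).
    - lra.
    - intros s th Hs. apply D. apply (In t); auto.
    - exact Ck'.
    - intros s Hs. apply ex_CRInt_cont. intros th. unfold k.
      apply continuous_Cmult; [|apply continuous_Cdiv; auto; apply continuous_Cminus; auto; apply continuous_const].
      apply (continuous_comp (fun th => z + (zeta th - z) * RtoC s)%C F). unfold zeta; cont.
      apply (hol_continuous F F'); auto. now apply (In t).
    - apply ex_CRInt_cont. auto.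
    (* At [t = 0] the antiderivative would divide by 0, but there the integrand is [F' z * zeta],
       whose integral vanishes because [cis] is periodic. *)
    - destruct (Req_dec t 0) as [->|Nt].
      + rewrite (CRInt_ext _ (fun th => F' z * zeta th)%C).
        2:{ intros th. unfold k'. f_equal. f_equal. ring. }
        rewrite CRInt_mult_l by (apply ex_CRInt_cont; auto).
        rewrite (CRInt_derive (fun th => RtoC 0 + (RtoC r / Ci) * cis th)%C); auto.
        2:{ intros th. eapply rcder_eq. apply rcder_affine, rcder_cis. unfold zeta. field. apply Ci_neq_0. }
        rewrite cis_2PI. ring.
      + rewrite (CRInt_derive (fun th => F (z + (zeta th - z) * RtoC t) * / (Ci * RtoC t))%C); auto.
        2:{ intros th. eapply rcder_eq. apply (rcder_mult_r (fun th => F (z + (zeta th - z) * RtoC t)%C)).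
            apply (cder_comp_curve F). apply HF, In'.
            apply (rcder_ext (fun s => (z - z * RtoC t) + (RtoC r * RtoC t) * cis s)%C).
            intros s. unfold zeta. ring.
            apply rcder_affine, rcder_cis.
            unfold k', zeta. field. split. now apply RtoC_neq_0. apply Ci_neq_0. }
        unfold zeta. rewrite cis_2PI. ring. }
  rewrite (CRInt_ext _ (k 1)).
  2:{ intros th. unfold k. f_equal. f_equal. unfold zeta. ring. }
  rewrite <- E. unfold k.
  rewrite (CRInt_ext _ (fun th => F z * (zeta th / (zeta th - z)))%C).
  2:{ intros th. f_equal. f_equal. ring. }
  rewrite CRInt_mult_l; auto. apply ex_CRInt_cont. intros th.
  apply continuous_Cdiv; auto; apply continuous_Cminus; auto; apply continuous_const.
Qed.

(** The pole is moved from [z] to 0 along [t z]. The derivative in [t] of the integrand is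
    [z zeta / (zeta - t z)^2], the derivative in the angle of [Ci z / (zeta - t z)], so the integral
    does not change; at [t = 0] the integrand is 1. *)
Lemma cauchy_kernel_integral (r : R) (z : C) : 0 < r < 1 -> Cmod z < r ->
  CI (fun th => RtoC r * cis th / (RtoC r * cis th - z))%C = RtoC (2 * PI).
Proof.
  intros Hr Hz.
  set (zeta := fun th => (RtoC r * cis th)%C).
  assert (Mz : forall t, 0 <= t <= 1 -> forall t', Rabs (t' - t) < (r - Cmod z) -> Cmod (RtoC t' * z) < r).
  { intros t Ht t' Ht'. rewrite Cmod_mult, Cmod_R. pose proof (Cmod_ge_0 z).
    assert (Rabs t' <= t + (r - Cmod z)). { apply Rabs_def2 in Ht'. apply Rabs_le. lra. }
    pose proof (Rabs_pos t').
    destruct (Rle_dec (t + (r - Cmod z)) 1); nra. }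
  set (k := fun t th => (zeta th / (zeta th - RtoC t * z))%C).
  set (k' := fun t th => (z * (zeta th / ((zeta th - RtoC t * z) * (zeta th - RtoC t * z))))%C).
  assert (N : forall t, Cmod (RtoC t * z) < r -> forall th, (zeta th - RtoC t * z)%C <> 0%C).
  { intros t Ht th. apply circle_neq; lra. }
  assert (E : CI (k 0) = CI (k 1)).
  { apply (rcder_zero_const (fun t => CI (k t)) 0 1). lra.
    intros t Ht.
    assert (M0 : Cmod (RtoC t * z) < r). { apply (Mz t); auto. rewrite Rminus_diag, Rabs_R0; lra. }
    assert (C1 : forall th, ccont (k' t) th).
    { intros th. unfold k'. apply continuous_Cmult. cont. apply continuous_Cdiv. unfold zeta; cont. unfold zeta; cont.
      apply Cmult_neq_0; now apply N. }
    eapply rcder_eq.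
    apply (rcder_CRInt_param k k' 0 (2 * PI) t (r - Cmod z)).
    - lra.
    - intros s th Hs. unfold k, k'. specialize (Mz _ Ht _ Hs).
      apply (rcder_ext (fun s => zeta th * / (zeta th + (- z) * RtoC s))%C).
      { intros u. unfold Cdiv. f_equal. f_equal. ring. }
      eapply rcder_eq. apply (cder_comp_curve (fun w => zeta th * / (zeta th + (- z) * w))%C RtoC s).
      apply cder_mult. apply cder_const.
      apply (cder_comp Cinv (fun w => zeta th + - z * w)%C). apply cder_Cinv.
      replace (zeta th + - z * RtoC s)%C with (zeta th - RtoC s * z)%C by ring. now apply N.
      apply cder_plus. apply cder_const. apply cder_mult. apply cder_const. apply cder_id.
      apply rcder_RtoC. cbv beta. specialize (N _ Mz th).
      replace (zeta th + - z * RtoC s)%C with (zeta th - RtoC s * z)%C by ring. field. auto.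
    - intros th. unfold k'. apply continuous_Cmult. cont. apply continuous_Cdiv. unfold zeta; cont. unfold zeta; cont.
      cbn [fst snd]. apply Cmult_neq_0; now apply N.
    - intros s Hs. apply ex_CRInt_cont. intros th. unfold k. apply continuous_Cdiv; unfold zeta; cont.
      apply N. now apply (Mz t).
    - apply ex_CRInt_cont. auto.
    - unfold k'. rewrite CRInt_mult_l.
      2:{ apply ex_CRInt_cont. intros th. apply continuous_Cdiv; unfold zeta; cont. apply Cmult_neq_0; now apply N. }
      rewrite (CRInt_derive (fun th => (/ (zeta th - RtoC t * z)) * (Ci))%C).
      + unfold zeta. rewrite cis_2PI. ring.
      + intros th. eapply rcder_eq. apply (rcder_mult_r (fun th => / (zeta th - RtoC t * z))%C).
        apply (cder_comp_curve Cinv (fun th => zeta th - RtoC t * z)%C). apply cder_Cinv. now apply N.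
        apply (rcder_ext (fun s => - (RtoC t * z) + (RtoC r) * cis s)%C).
        intros s. unfold zeta. ring.
        apply rcder_affine, rcder_cis. cbv beta. specialize (N _ M0 th).
        unfold Cdiv. set (w := (/ ((zeta th - RtoC t * z) * (zeta th - RtoC t * z)))%C).
        replace (- w * (RtoC r * (Ci * cis th)) * Ci)%C with ((- (Ci * Ci)) * (RtoC r * cis th) * w)%C by ring.
        replace (- (Ci * Ci))%C with (RtoC 1). unfold zeta. ring.
        unfold Ci, RtoC, Cmult, Copp; cbn. f_equal; ring.
      + intros th. apply continuous_Cdiv; unfold zeta; cont. apply Cmult_neq_0; now apply N. }
  rewrite (CRInt_ext _ (k 1)).
  2:{ intros th. unfold k, zeta. f_equal. f_equal. f_equal. ring. }
  rewrite <- E. rewrite (CRInt_ext _ (fun _ => RtoC 1)).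
  2:{ intros th. unfold k. replace (zeta th - RtoC 0 * z)%C with (zeta th) by ring.
      change ((zeta th / zeta th)%C = RtoC 1). field. replace (zeta th) with (zeta th - RtoC 0)%C by ring.
      apply circle_neq. lra. rewrite Cmod_0; lra. }
  rewrite CRInt_const, Rminus_0_r. ring.
Qed.

Lemma cauchy_formula (F F' : C -> C) (r : R) (z : C) : hol F F' -> 0 < r < 1 -> Cmod z < r ->
  CI (fun th => F (RtoC r * cis th) * (RtoC r * cis th / (RtoC r * cis th - z)))%C =
  (RtoC (2 * PI) * F z)%C.
Proof.
  intros HF Hr Hz. rewrite (cauchy_aux F F'); auto. rewrite cauchy_kernel_integral; auto. ring.
Qed.

(** * Regularity and divided differences *)

Lemma bounded_curve (f : R -> C) : (forall t, ccont f t) ->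
  exists M, 0 < M /\ forall t, 0 <= t <= 2 * PI -> Cmod (f t) <= M.
Proof.
  intros H.
  destruct (continuity_ab_maj (fun t => Cmod (f t)) 0 (2 * PI)) as [x [Hx _]].
  pose proof PI_RGT_0; lra.
  intros t _. apply continuity_pt_filterlim. apply (continuous_Cmod f). apply H.
  exists (Cmod (f x) + 1). pose proof (Cmod_ge_0 (f x)). split. lra.
  intros t Ht. specialize (Hx t Ht). lra.
Qed.

Definition cauchy_kernel (r : R) (z : C) (th : R) : C := (/ (RtoC r * cis th - z))%C.

Lemma cauchy_kernel_bound (r s : R) (z : C) (th : R) : 0 < r -> s < r -> Cmod z <= s -> Cmod (cauchy_kernel r z th) <= / (r - s).
Proof.
  intros Hr Hs Hz. unfold cauchy_kernel. rewrite Cmod_inv by (apply circle_neq; lra).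
  apply Rinv_le_contravar. lra.
  pose proof (Cmod_triangle (RtoC r * cis th - z) z) as T.
  replace (RtoC r * cis th - z + z)%C with (RtoC r * cis th)%C in T by ring.
  rewrite Cmod_mult, Cmod_cis, Cmod_R, Rabs_pos_eq in T; lra.
Qed.

Lemma cauchy_kernel_cont (r : R) (z : C) (th : R) : 0 < r -> Cmod z < r -> ccont (cauchy_kernel r z) th.
Proof. intros Hr Hz. unfold cauchy_kernel. cont. now apply circle_neq. Qed.

(** The resolvent identity. Each use extracts one factor [w - z]: once for Lipschitz bounds, twice
    for quadratic remainders. *)
Lemma cauchy_kernel_diff (r : R) (z w : C) (th : R) : 0 < r -> Cmod z < r -> Cmod w < r ->
  (cauchy_kernel r w th - cauchy_kernel r z th)%C = ((w - z) * (cauchy_kernel r w th * cauchy_kernel r z th))%C.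
Proof.
  intros Hr Hz Hw. unfold cauchy_kernel. field. split; apply circle_neq; auto.
Qed.

Lemma CI_lin3 (f g k : R -> C) (c : C) : (forall t, ccont f t) -> (forall t, ccont g t) -> (forall t, ccont k t) ->
  (CI f - CI g - c * CI k)%C = CI (fun t => f t - g t - c * k t)%C.
Proof. intros; apply CRInt_lin3; now apply ex_CRInt_cont. Qed.

Lemma CI_bound (f : R -> C) (M : R) : (forall t, ccont f t) -> (forall t, 0 <= t <= 2 * PI -> Cmod (f t) <= M) ->
  Cmod (CI f) <= 2 * PI * M.
Proof.
  intros Hf H. replace (2 * PI * M) with ((2 * PI - 0) * M) by ring.
  apply Cmod_CRInt_le_const; auto. pose proof PI_RGT_0; lra. now apply ex_CRInt_cont.
Qed.

(** For a continuous density, the Cauchy integral, its derivative, and half of its second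
    derivative. *)
Definition cauchy_int1 (r : R) (phi : R -> C) (z : C) : C := CI (fun th => phi th * cauchy_kernel r z th)%C.
Definition cauchy_int2 (r : R) (phi : R -> C) (z : C) : C := CI (fun th => phi th * (cauchy_kernel r z th * cauchy_kernel r z th))%C.
Definition cauchy_int3 (r : R) (phi : R -> C) (z : C) : C := CI (fun th => phi th * (cauchy_kernel r z th * (cauchy_kernel r z th * cauchy_kernel r z th)))%C.

Lemma prod3_le (a M x c B : R) : 0 <= a <= M -> 0 <= x -> 0 <= c <= B -> a * (x * c) <= M * B * x.
Proof.
  intros Ha Hx Hc. replace (M * B * x) with (M * (x * B)) by ring.
  apply Rmult_le_compat; try lra. apply Rmult_le_pos; lra. apply Rmult_le_compat_l; lra.
Qed.

(** The constant does not depend on the two points, which is more than differentiability: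
    [hol_primitive] integrates this remainder along a segment and needs the uniformity. *)
Lemma cauchy_int1_quad (r s : R) (phi : R -> C) : 0 < r -> s < r -> (forall t, ccont phi t) ->
  exists K, forall z w, Cmod z <= s -> Cmod w <= s ->
    Cmod (cauchy_int1 r phi w - cauchy_int1 r phi z - cauchy_int2 r phi z * (w - z))%C <= K * (Cmod (w - z)%C * Cmod (w - z)%C).
Proof.
  intros Hr Hs Hp. destruct (bounded_curve phi Hp) as [M [HM HB]].
  set (b := / (r - s)). assert (Hb : 0 < b) by (apply Rinv_0_lt_compat; lra).
  exists (2 * PI * (M * (b * b * b))). intros z w Hz Hw.
  assert (Ck : forall v, Cmod v <= s -> forall t, ccont (cauchy_kernel r v) t) by (intros; apply cauchy_kernel_cont; lra).
  rewrite (Cmult_comm (cauchy_int2 r phi z)). unfold cauchy_int1, cauchy_int2. rewrite CI_lin3.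
  2,3,4: intros t; cont.
  rewrite (CRInt_ext _ (fun t => phi t * (((w - z) * (w - z)) * (cauchy_kernel r w t * cauchy_kernel r z t * cauchy_kernel r z t)))%C).
  2:{ intros t. replace (phi t * cauchy_kernel r w t - phi t * cauchy_kernel r z t)%C with (phi t * (cauchy_kernel r w t - cauchy_kernel r z t))%C by ring.
      rewrite cauchy_kernel_diff by lra.
      replace (phi t * ((w - z) * (cauchy_kernel r w t * cauchy_kernel r z t)) - (w - z) * (phi t * (cauchy_kernel r z t * cauchy_kernel r z t)))%C
       with (phi t * ((w - z) * cauchy_kernel r z t * (cauchy_kernel r w t - cauchy_kernel r z t)))%C by ring.
      rewrite cauchy_kernel_diff by lra. ring. }
  rewrite Rmult_assoc. apply CI_bound.
  - intros t. cont.
  - intros t Ht. rewrite !Cmod_mult.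
    pose proof (cauchy_kernel_bound r s z t Hr Hs Hz). pose proof (cauchy_kernel_bound r s w t Hr Hs Hw). fold b in H, H0.
    pose proof (Cmod_ge_0 (cauchy_kernel r z t)). pose proof (Cmod_ge_0 (cauchy_kernel r w t)). pose proof (Cmod_ge_0 (w - z)).
    pose proof (Cmod_ge_0 (phi t)). specialize (HB t Ht).
    apply prod3_le; auto. now apply Rmult_le_pos.
    assert (0 <= Cmod (cauchy_kernel r w t) * Cmod (cauchy_kernel r z t) <= b * b) by (split; [now apply Rmult_le_pos|apply Rmult_le_compat; auto]).
    split. apply Rmult_le_pos; lra. apply Rmult_le_compat; lra.
Qed.

Lemma cauchy_int2_quad (r s : R) (phi : R -> C) : 0 < r -> s < r -> (forall t, ccont phi t) ->
  exists K, forall z w, Cmod z <= s -> Cmod w <= s ->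
    Cmod (cauchy_int2 r phi w - cauchy_int2 r phi z - (2 * cauchy_int3 r phi z) * (w - z))%C <= K * (Cmod (w - z)%C * Cmod (w - z)%C).
Proof.
  intros Hr Hs Hp. destruct (bounded_curve phi Hp) as [M [HM HB]].
  set (b := / (r - s)). assert (Hb : 0 < b) by (apply Rinv_0_lt_compat; lra).
  exists (2 * PI * (M * (b * b * (3 * b * b)))). intros z w Hz Hw.
  assert (Ck : forall v, Cmod v <= s -> forall t, ccont (cauchy_kernel r v) t) by (intros; apply cauchy_kernel_cont; lra).
  replace (2 * cauchy_int3 r phi z * (w - z))%C with ((2 * (w - z)) * cauchy_int3 r phi z)%C by ring. unfold cauchy_int3, cauchy_int2. rewrite CI_lin3.
  2,3,4: intros t; cont.
  rewrite (CRInt_ext _ (fun t => phi t * (((w - z) * (w - z)) * ((cauchy_kernel r z t * cauchy_kernel r w t) * ((cauchy_kernel r w t + 2 * cauchy_kernel r z t) * cauchy_kernel r z t))))%C).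
  (* With [v - u = h v u], one substitution turns [v^2 - u^2 - 2 h u^3] into
     [h u (v - u) (v + 2 u)], and a second one produces the factor [h^2]. The bound [3 * b] is that
     of [v + 2 u]. *)
  2:{ intros t. pose proof (cauchy_kernel_diff r z w t Hr ltac:(lra) ltac:(lra)) as E.
      set (u := cauchy_kernel r z t) in *. set (v := cauchy_kernel r w t) in *. set (h := (w - z)%C) in *.
      assert (E' : v = (u + h * (v * u))%C) by (rewrite <- E; ring).
      replace (phi t * (v * v) - phi t * (u * u) - 2 * h * (phi t * (u * (u * u))))%C with
       (phi t * ((v - u) * (v + u) - 2 * h * (u * (u * u))))%C by ring. rewrite E.
      replace (phi t * (h * (v * u) * (v + u) - 2 * h * (u * (u * u))))%C with (phi t * (h * u * ((v - u) * (v + 2 * u))))%C by ring.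
      rewrite E. ring. }
  rewrite Rmult_assoc. apply CI_bound.
  - intros t. cont.
  - intros t Ht. rewrite !Cmod_mult.
    pose proof (cauchy_kernel_bound r s z t Hr Hs Hz). pose proof (cauchy_kernel_bound r s w t Hr Hs Hw). fold b in H, H0.
    pose proof (Cmod_ge_0 (cauchy_kernel r z t)). pose proof (Cmod_ge_0 (cauchy_kernel r w t)). pose proof (Cmod_ge_0 (w - z)).
    pose proof (Cmod_ge_0 (phi t)). specialize (HB t Ht).
    assert (Cmod (cauchy_kernel r w t + 2 * cauchy_kernel r z t) <= 3 * b).
    { eapply Rle_trans. apply Cmod_triangle. rewrite Cmod_mult, Cmod_R, Rabs_pos_eq; lra. }
    pose proof (Cmod_ge_0 (cauchy_kernel r w t + 2 * cauchy_kernel r z t)).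
    apply prod3_le; auto. now apply Rmult_le_pos.
    assert (0 <= Cmod (cauchy_kernel r z t) * Cmod (cauchy_kernel r w t) <= b * b) by (split; [now apply Rmult_le_pos|apply Rmult_le_compat; auto]).
    assert (0 <= Cmod (cauchy_kernel r w t + 2 * cauchy_kernel r z t) * Cmod (cauchy_kernel r z t) <= 3 * b * b) by (split; [now apply Rmult_le_pos|apply Rmult_le_compat; auto]).
    split. apply Rmult_le_pos; lra. apply Rmult_le_compat; lra.
Qed.

Lemma cauchy_int3_lipschitz (r s : R) (phi : R -> C) : 0 < r -> s < r -> (forall t, ccont phi t) ->
  exists K, 0 < K /\ forall z w, Cmod z <= s -> Cmod w <= s ->
    Cmod (cauchy_int3 r phi w - cauchy_int3 r phi z)%C <= K * Cmod (w - z)%C.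
Proof.
  intros Hr Hs Hp. destruct (bounded_curve phi Hp) as [M [HM HB]].
  set (b := / (r - s)). assert (Hb : 0 < b) by (apply Rinv_0_lt_compat; lra).
  exists (2 * PI * (M * (b * b * (3 * (b * b))))). split.
  { pose proof PI_RGT_0. assert (0 < b * b) by (apply Rmult_lt_0_compat; lra).
    apply Rmult_lt_0_compat. lra. apply Rmult_lt_0_compat; auto. apply Rmult_lt_0_compat; lra. }
  intros z w Hz Hw.
  assert (Ck : forall v, Cmod v <= s -> forall t, ccont (cauchy_kernel r v) t) by (intros; apply cauchy_kernel_cont; lra).
  unfold cauchy_int3. rewrite <- CRInt_minus.
  2,3: apply ex_CRInt_cont; intros t; cont.
  rewrite (CRInt_ext _ (fun t => phi t * ((w - z) * ((cauchy_kernel r w t * cauchy_kernel r z t) * (cauchy_kernel r w t * cauchy_kernel r w t + cauchy_kernel r w t * cauchy_kernel r z t + cauchy_kernel r z t * cauchy_kernel r z t))))%C).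
  2:{ intros t. pose proof (cauchy_kernel_diff r z w t Hr ltac:(lra) ltac:(lra)) as E.
      set (u := cauchy_kernel r z t) in *. set (v := cauchy_kernel r w t) in *. set (h := (w - z)%C) in *.
      replace (phi t * (v * (v * v)) - phi t * (u * (u * u)))%C with (phi t * ((v - u) * (v * v + v * u + u * u)))%C by ring.
      rewrite E. ring. }
  rewrite Rmult_assoc. apply CI_bound.
  - intros t. cont.
  - intros t Ht. rewrite (Cmod_mult (phi t)), (Cmod_mult (w - z)), (Cmod_mult (cauchy_kernel r w t * cauchy_kernel r z t)), (Cmod_mult (cauchy_kernel r w t) (cauchy_kernel r z t)).
    pose proof (cauchy_kernel_bound r s z t Hr Hs Hz). pose proof (cauchy_kernel_bound r s w t Hr Hs Hw). fold b in H, H0.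
    pose proof (Cmod_ge_0 (cauchy_kernel r z t)). pose proof (Cmod_ge_0 (cauchy_kernel r w t)). pose proof (Cmod_ge_0 (w - z)).
    pose proof (Cmod_ge_0 (phi t)). specialize (HB t Ht).
    assert (Cmod (cauchy_kernel r w t * cauchy_kernel r w t + cauchy_kernel r w t * cauchy_kernel r z t + cauchy_kernel r z t * cauchy_kernel r z t) <= 3 * (b * b)).
    { eapply Rle_trans. apply Cmod_triangle. eapply Rle_trans. apply Rplus_le_compat_r, Cmod_triangle.
      rewrite !Cmod_mult. assert (forall x y, 0 <= x <= b -> 0 <= y <= b -> x * y <= b * b) by (intros; apply Rmult_le_compat; lra).
      pose proof (H5 _ _ (conj H1 H) (conj H1 H)). pose proof (H5 _ _ (conj H2 H0) (conj H1 H)). pose proof (H5 _ _ (conj H2 H0) (conj H2 H0)). lra. }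
    pose proof (Cmod_ge_0 (cauchy_kernel r w t * cauchy_kernel r w t + cauchy_kernel r w t * cauchy_kernel r z t + cauchy_kernel r z t * cauchy_kernel r z t)).
    apply prod3_le; auto.
    assert (0 <= Cmod (cauchy_kernel r w t) * Cmod (cauchy_kernel r z t) <= b * b) by (split; [now apply Rmult_le_pos|apply Rmult_le_compat; auto]).
    split. apply Rmult_le_pos; lra. apply Rmult_le_compat; lra.
Qed.

Lemma half_gap_disk (r : R) (z : C) : Cmod z < r ->
  0 < (r - Cmod z) / 2 /\ (r + Cmod z) / 2 < r /\ Cmod z <= (r + Cmod z) / 2 /\
  forall w, Cmod (w - z)%C < (r - Cmod z) / 2 -> Cmod w <= (r + Cmod z) / 2.
Proof.
  intros H. repeat split; try lra. intros w Hw. pose proof (Cmod_triangle (w - z) z) as T.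
  replace (w - z + z)%C with w in T by ring. lra.
Qed.

Lemma cder_cauchy_int1 (r : R) (phi : R -> C) (z : C) : 0 < r -> (forall t, ccont phi t) -> Cmod z < r ->
  cder (cauchy_int1 r phi) z (cauchy_int2 r phi z).
Proof.
  intros Hr Hp Hz. destruct (half_gap_disk r z Hz) as [A [B [D E]]].
  destruct (cauchy_int1_quad r _ phi Hr B Hp) as [K HK].
  apply (cder_of_quadratic _ _ _ K _ A). intros w Hw. apply HK; auto.
Qed.

Lemma cder_cauchy_int2 (r : R) (phi : R -> C) (z : C) : 0 < r -> (forall t, ccont phi t) -> Cmod z < r ->
  cder (cauchy_int2 r phi) z (2 * cauchy_int3 r phi z)%C.
Proof.
  intros Hr Hp Hz. destruct (half_gap_disk r z Hz) as [A [B [D E]]].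
  destruct (cauchy_int2_quad r _ phi Hr B Hp) as [K HK].
  apply (cder_of_quadratic _ _ _ K _ A). intros w Hw. apply HK; auto.
Qed.

Lemma continuous_cauchy_int3 (r : R) (phi : R -> C) (z : C) : 0 < r -> (forall t, ccont phi t) -> Cmod z < r ->
  continuous (T := C_UniformSpace) (U := C_UniformSpace) (cauchy_int3 r phi) z.
Proof.
  intros Hr Hp Hz. destruct (half_gap_disk r z Hz) as [A [B [D E]]].
  destruct (cauchy_int3_lipschitz r _ phi Hr B Hp) as [K [K0 HK]].
  apply ccont_eps. intros eps He. exists (Rmin ((r - Cmod z) / 2) (eps / K)).
  split. apply Rmin_glb_lt; auto. now apply Rdiv_lt_0_compat.
  intros w Hw. assert (W1 : Cmod (w - z) < (r - Cmod z) / 2) by (eapply Rlt_le_trans; [exact Hw|apply Rmin_l]).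
  assert (W2 : Cmod (w - z) < eps / K) by (eapply Rlt_le_trans; [exact Hw|apply Rmin_r]).
  eapply Rle_lt_trans. apply HK; auto. apply (Rmult_lt_compat_l K) in W2; auto.
  replace (K * (eps / K)) with eps in W2 by (field; lra). exact W2.
Qed.

(** On the circle [d zeta = i zeta d theta], so [zeta F (zeta) / (2 PI)] is the density for which
    [cauchy_int1] is Cauchy's formula. *)
Definition boundary_density (F : C -> C) (r : R) (th : R) : C := (F (RtoC r * cis th) * (RtoC r * cis th) * / RtoC (2 * PI))%C.

Lemma Cmod_circ (r th : R) : 0 <= r -> Cmod (RtoC r * cis th)%C = r.
Proof. intros H. rewrite Cmod_mult, Cmod_cis, Cmod_R, Rabs_pos_eq; lra. Qed.

Lemma boundary_density_continuous (F F' : C -> C) (r th : R) : hol F F' -> 0 < r < 1 -> ccont (boundary_density F r) th.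
Proof.
  intros HF Hr. unfold boundary_density. cont.
  apply (continuous_comp (U := R_UniformSpace) (V := C_UniformSpace) (W := C_UniformSpace) (fun th => RtoC r * cis th)%C F). cont.
  apply (hol_continuous F F'); auto. rewrite Cmod_circ; lra.
Qed.

Lemma twoPI_neq : RtoC (2 * PI) <> 0%C.
Proof. apply RtoC_neq_0. pose proof PI_RGT_0; lra. Qed.

Lemma cauchy_int1_eq (F F' : C -> C) (r : R) (z : C) : hol F F' -> 0 < r < 1 -> Cmod z < r ->
  F z = cauchy_int1 r (boundary_density F r) z.
Proof.
  intros HF Hr Hz. pose proof (cauchy_formula F F' r z HF Hr Hz) as E.
  unfold cauchy_int1, boundary_density. rewrite (CRInt_ext _ (fun th => / RtoC (2 * PI) * (F (RtoC r * cis th) * (RtoC r * cis th / (RtoC r * cis th - z))))%C).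
  2:{ intros th. unfold cauchy_kernel, Cdiv. ring. }
  rewrite CRInt_mult_l, E. field. apply twoPI_neq.
  apply ex_CRInt_cont. intros th. cont.
  apply (continuous_comp (U := R_UniformSpace) (V := C_UniformSpace) (W := C_UniformSpace) (fun th => RtoC r * cis th)%C F). cont.
  apply (hol_continuous F F'); auto. rewrite Cmod_circ; lra.
  apply circle_neq; lra.
Qed.

Lemma cauchy_int2_eq (F F' : C -> C) (r : R) (z : C) : hol F F' -> 0 < r < 1 -> Cmod z < r ->
  F' z = cauchy_int2 r (boundary_density F r) z.
Proof.
  intros HF Hr Hz. rewrite <- (is_C_derive_unique F z (F' z)) by (apply HF; lra).
  apply is_C_derive_unique. destruct (disk_open z r Hz) as [A B].
  apply (cder_ext_loc (cauchy_int1 r (boundary_density F r)) F z _ (r - Cmod z)); auto.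
  intros w Hw. symmetry. apply (cauchy_int1_eq F F'); auto.
  apply cder_cauchy_int1; auto. lra. intros t. apply (boundary_density_continuous F F'); auto.
Qed.

(** [F'] coincides with [cauchy_int2] on a smaller disk, and the latter has the continuous
    derivative [2 * cauchy_int3]. Hence one continuous derivative yields the next. *)
Lemma hol_deriv (F F' : C -> C) : hol F F' -> hol F' (C_derive F').
Proof.
  intros HF.
  assert (D : forall r z, 0 < r < 1 -> Cmod z < r -> cder F' z (2 * cauchy_int3 r (boundary_density F r) z)%C).
  { intros r z Hr Hz. destruct (disk_open z r Hz) as [A B].
    apply (cder_ext_loc (cauchy_int2 r (boundary_density F r)) F' z _ (r - Cmod z)); auto.
    intros w Hw. symmetry. apply (cauchy_int2_eq F F'); auto.
    apply cder_cauchy_int2; auto. lra. intros t. apply (boundary_density_continuous F F'); auto. }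
  intros z Hz. set (r := (1 + Cmod z) / 2). pose proof (Cmod_ge_0 z).
  assert (Hr : 0 < r < 1) by (unfold r; lra). assert (Hzr : Cmod z < r) by (unfold r; lra).
  split.
  - rewrite (is_C_derive_unique F' z _ (D r z Hr Hzr)). auto.
  - destruct (disk_open z r Hzr) as [A B].
    apply (ccont_ext_loc (fun z => 2 * cauchy_int3 r (boundary_density F r) z)%C _ z (r - Cmod z)); auto.
    intros w Hw. symmetry. apply is_C_derive_unique. auto.
    apply continuous_Cmult. apply continuous_const. apply continuous_cauchy_int3; auto. lra. intros t. apply (boundary_density_continuous F F'); auto.
Qed.

Lemma hol_quad (F F' : C -> C) (s : R) : hol F F' -> s < 1 -> exists K, 0 <= K /\
  forall z w, Cmod z <= s -> Cmod w <= s ->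
    Cmod (F w - F z - F' z * (w - z))%C <= K * (Cmod (w - z)%C * Cmod (w - z)%C).
Proof.
  (* The maximum with 1/2 keeps the radius positive, as [s] may be negative. *)
  intros HF Hs. set (r := Rmax ((1 + s) / 2) (1 / 2)).
  assert (Hr : 0 < r < 1). { split. apply Rlt_le_trans with (1/2); [lra|apply Rmax_r]. apply Rmax_lub_lt; lra. }
  assert (Hsr : s < r). { apply Rlt_le_trans with ((1+s)/2); [lra|apply Rmax_l]. }
  destruct (cauchy_int1_quad r s (boundary_density F r) (proj1 Hr) Hsr) as [K HK].
  intros t. apply (boundary_density_continuous F F'); auto.
  exists (Rabs K). split. apply Rabs_pos. intros z w Hz Hw.
  rewrite !(cauchy_int1_eq F F' r), (cauchy_int2_eq F F' r) by (auto; lra).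
  eapply Rle_trans. apply HK; auto. apply Rmult_le_compat_r.
  pose proof (Cmod_ge_0 (w - z)). nra. apply Rle_abs.
Qed.

(** The [Q] of the overview, completed by [F'] on the diagonal. Equality of the two points is
    decided through the real number [Cmod (z - w)]. *)
Definition diff_quot (F F' : C -> C) (z w : C) : C :=
  if Req_EM_T (Cmod (z - w)%C) 0 then F' w else ((F z - F w) / (z - w))%C.

Lemma diff_quot_spec (F F' : C -> C) (z w : C) : (F z - F w = diff_quot F F' z w * (z - w))%C.
Proof.
  unfold diff_quot. destruct (Req_EM_T (Cmod (z - w)) 0) as [e|n].
  - apply Cmod_eq_0 in e. rewrite e. replace z with (w + (z - w))%C by ring. rewrite e.
    replace (w + 0)%C with w by ring. ring.
  - field. intros e. apply n. rewrite e. apply Cmod_0.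
Qed.

Lemma diff_quot_diag (F F' : C -> C) (z : C) : diff_quot F F' z z = F' z.
Proof. unfold diff_quot. destruct (Req_EM_T (Cmod (z - z)) 0) as [e|n]; auto. exfalso; apply n.
  replace (z - z)%C with (RtoC 0) by ring. apply Cmod_0. Qed.

(** The kernel [k_z k_w] represents the quotient off the diagonal by the resolvent identity and the
    derivative on it. A single integral thus covers both cases, and the singularity at [z = w] needs
    no separate removal. *)
Lemma diff_quot_cauchy_int (F F' : C -> C) (r : R) (z w : C) : hol F F' -> 0 < r < 1 -> Cmod z < r -> Cmod w < r ->
  diff_quot F F' z w = cauchy_int1 r (fun th => boundary_density F r th * cauchy_kernel r w th)%C z.
Proof.
  intros HF Hr Hz Hw.
  assert (Cb : forall t, ccont (boundary_density F r) t) by (intros t; apply (boundary_density_continuous F F'); auto).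
  assert (Ck : forall v, Cmod v < r -> forall t, ccont (cauchy_kernel r v) t) by (intros; apply cauchy_kernel_cont; lra).
  unfold diff_quot. destruct (Req_EM_T (Cmod (z - w)) 0) as [e|n].
  - assert (z = w). { apply Cmod_eq_0 in e. replace z with (w + (z - w))%C by ring. rewrite e. ring. }
    subst z. rewrite (cauchy_int2_eq F F' r) by auto. unfold cauchy_int1, cauchy_int2. apply CRInt_ext. intros t. ring.
  - rewrite (cauchy_int1_eq F F' r z), (cauchy_int1_eq F F' r w) by auto.
    unfold cauchy_int1. rewrite <- CRInt_minus. 2,3: apply ex_CRInt_cont; intros t; apply continuous_Cmult; auto.
    rewrite (CRInt_ext _ (fun th => (z - w) * (boundary_density F r th * cauchy_kernel r w th * cauchy_kernel r z th))%C).
    2:{ intros t. replace (boundary_density F r t * cauchy_kernel r z t - boundary_density F r t * cauchy_kernel r w t)%C with (boundary_density F r t * (cauchy_kernel r z t - cauchy_kernel r w t))%C by ring.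
        rewrite cauchy_kernel_diff by (auto; lra). ring. }
    rewrite CRInt_mult_l. field. intros e. apply n. rewrite e. apply Cmod_0.
    apply ex_CRInt_cont; intros t. cont.
Qed.

Lemma hol_diff_quot (F F' : C -> C) (a : C) : hol F F' -> Cmod a < 1 ->
  hol (fun z => diff_quot F F' z a) (C_derive (fun z => diff_quot F F' z a)).
Proof.
  intros HF Ha.
  assert (X : exists q', hol (fun z => diff_quot F F' z a) q').
  { exists (C_derive (fun z => diff_quot F F' z a)). intros z Hz.
    set (r := (1 + Rmax (Cmod z) (Cmod a)) / 2).
    pose proof (Cmod_ge_0 z). pose proof (Rmax_l (Cmod z) (Cmod a)). pose proof (Rmax_r (Cmod z) (Cmod a)).
    assert (Rmax (Cmod z) (Cmod a) < 1) by (apply Rmax_lub_lt; auto).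
    assert (Hr : 0 < r < 1) by (unfold r; lra). assert (Hzr : Cmod z < r) by (unfold r; lra).
    assert (Har : Cmod a < r) by (unfold r; lra).
    set (phi := fun th => (boundary_density F r th * cauchy_kernel r a th)%C).
    assert (Cp : forall t, ccont phi t).
    { intros t. apply continuous_Cmult. apply (boundary_density_continuous F F'); auto. apply cauchy_kernel_cont; lra. }
    assert (D : forall w, Cmod w < r -> cder (fun z => diff_quot F F' z a) w (cauchy_int2 r phi w)).
    { intros w Hw. destruct (disk_open w r Hw) as [A B].
      apply (cder_ext_loc (cauchy_int1 r phi) _ w _ (r - Cmod w)); auto.
      intros v Hv. symmetry. apply diff_quot_cauchy_int; auto. apply cder_cauchy_int1; auto. lra. }
    split.
    - assert (E : C_derive (fun z => diff_quot F F' z a) z = cauchy_int2 r phi z) by (apply is_C_derive_unique; auto).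
      rewrite E. auto.
    - destruct (disk_open z r Hzr) as [A B].
      apply (ccont_ext_loc (cauchy_int2 r phi) _ z (r - Cmod z)); auto.
      intros w Hw. symmetry. apply is_C_derive_unique. auto.
      eapply cder_continuous. apply cder_cauchy_int2; auto. lra. }
  destruct X as [q' X]. apply hol_ext with (3 := X); auto.
  intros z Hz. symmetry. apply is_C_derive_unique. apply X; auto.
Qed.

(** Joint regularity in both variables, diagonal included. It makes the modulus of the quotient
    continuous on the torus of pairs of angles, where it has to be bounded below. *)
Lemma diff_quot_lip (F F' : C -> C) (s : R) : hol F F' -> s < 1 -> exists K, 0 <= K /\
  forall z w z0 w0, Cmod z <= s -> Cmod w <= s -> Cmod z0 <= s -> Cmod w0 <= s ->
    Cmod (diff_quot F F' z w - diff_quot F F' z0 w0)%C <= K * (Cmod (z - z0)%C + Cmod (w - w0)%C).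
Proof.
  intros HF Hs. set (r := Rmax ((1 + s) / 2) (1 / 2)).
  assert (Hr : 0 < r < 1). { split. apply Rlt_le_trans with (1/2); [lra|apply Rmax_r]. apply Rmax_lub_lt; lra. }
  assert (Hsr : s < r). { apply Rlt_le_trans with ((1+s)/2); [lra|apply Rmax_l]. }
  assert (Cb : forall t, ccont (boundary_density F r) t) by (intros t; apply (boundary_density_continuous F F'); auto).
  assert (Ck : forall v, Cmod v <= s -> forall t, ccont (cauchy_kernel r v) t) by (intros; apply cauchy_kernel_cont; lra).
  destruct (bounded_curve _ Cb) as [M [HM HB]].
  set (b := / (r - s)). assert (Hb : 0 < b) by (apply Rinv_0_lt_compat; lra).
  pose proof PI_RGT_0.
  exists (2 * PI * (M * (b * (b * b)))). split.
  { assert (0 < b * b) by (apply Rmult_lt_0_compat; lra).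
    apply Rmult_le_pos. lra. apply Rmult_le_pos. lra. apply Rmult_le_pos; lra. }
  intros z w z0 w0 Hz Hw Hz0 Hw0. rewrite !(diff_quot_cauchy_int F F' r) by (auto; lra).
  unfold cauchy_int1. rewrite <- CRInt_minus. 2,3: apply ex_CRInt_cont; intros t; cont.
  rewrite (CRInt_ext _ (fun t => boundary_density F r t * (cauchy_kernel r w t * ((z - z0) * (cauchy_kernel r z t * cauchy_kernel r z0 t)) + cauchy_kernel r z0 t * ((w - w0) * (cauchy_kernel r w t * cauchy_kernel r w0 t))))%C).
  2:{ intros t. rewrite <- !cauchy_kernel_diff by lra. ring. }
  rewrite Rmult_assoc. apply CI_bound.
  - intros t. cont.
  - intros t Ht. rewrite Cmod_mult. specialize (HB t Ht).
    assert (K : forall v, Cmod v <= s -> 0 <= Cmod (cauchy_kernel r v t) <= b).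
    { intros v Hv. split. apply Cmod_ge_0. apply cauchy_kernel_bound; lra. }
    pose proof (K z Hz). pose proof (K w Hw). pose proof (K z0 Hz0). pose proof (K w0 Hw0).
    pose proof (Cmod_ge_0 (boundary_density F r t)). pose proof (Cmod_ge_0 (z - z0)). pose proof (Cmod_ge_0 (w - w0)).
    replace (M * (b * (b * b)) * (Cmod (z - z0) + Cmod (w - w0))) with (M * (b * (b * b) * (Cmod (z - z0) + Cmod (w - w0)))) by ring.
    apply Rmult_le_compat; auto. apply Cmod_ge_0.
    eapply Rle_trans. apply Cmod_triangle. rewrite !Cmod_mult.
    assert (P : forall x y u h, 0 <= x <= b -> 0 <= y <= b -> 0 <= u <= b -> 0 <= h -> x * (h * (y * u)) <= b * (b * b) * h).
    { intros. replace (x * (h * (y * u))) with ((x * (y * u)) * h) by ring. apply Rmult_le_compat_r; auto.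
      apply Rmult_le_compat; try lra. apply Rmult_le_pos; lra. apply Rmult_le_compat; lra. }
    rewrite Rmult_plus_distr_l. apply Rplus_le_compat; apply P; auto.
Qed.

(** * Logarithms and Fourier coefficients *)

Lemma Cmod_RtoC_mult_le (t : R) (z : C) : 0 <= t <= 1 -> Cmod (RtoC t * z)%C <= Cmod z.
Proof.
  intros Ht. rewrite Cmod_mult, Cmod_R, Rabs_pos_eq by lra. pose proof (Cmod_ge_0 z). nra.
Qed.

Lemma rcder_scale (z : C) (t : R) : rcder (fun s => RtoC s * z)%C t z.
Proof.
  eapply rcder_eq. apply rcder_mult_r. apply rcder_RtoC. ring.
Qed.

(** The primitive is the integral along the radius, [z * I z]. [J] is the derivative of [I], so the
    derivative of the primitive is [I + z J], and it remains to recognise [s] in this sum. *)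
Lemma hol_primitive (s s' : C -> C) : hol s s' -> exists S, hol S s /\ S 0%C = 0%C.
Proof.
  intros Hs.
  set (I := fun z => CRInt (fun t => s (RtoC t * z)%C) 0 1).
  set (J := fun z => CRInt (fun t => RtoC t * s' (RtoC t * z))%C 0 1).
  assert (C1 : forall z, Cmod z < 1 -> forall t, 0 <= t <= 1 -> ccont (fun t => s (RtoC t * z)%C) t).
  { intros z Hz t Ht. apply (continuous_comp (U := R_UniformSpace) (V := C_UniformSpace) (W := C_UniformSpace) (fun t => RtoC t * z)%C s). cont.
    apply (hol_continuous s s'); auto. eapply Rle_lt_trans. apply Cmod_RtoC_mult_le; auto. auto. }
  assert (C2 : forall z, Cmod z < 1 -> forall t, 0 <= t <= 1 -> ccont (fun t => RtoC t * s' (RtoC t * z))%C t).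
  { intros z Hz t Ht. apply continuous_Cmult. cont.
    apply (continuous_comp (U := R_UniformSpace) (V := C_UniformSpace) (W := C_UniformSpace) (fun t => RtoC t * z)%C s'). cont.
    apply Hs. eapply Rle_lt_trans. apply Cmod_RtoC_mult_le; auto. auto. }
  (* The integrand of [I z + z * J z] is the derivative of [t * s (t z)]. *)
  assert (IJ : forall z, Cmod z < 1 -> s z = (I z + z * J z)%C).
  { intros z Hz. unfold I, J. rewrite CRInt_lin2 by (apply ex_CRInt_cont_le; [lra|auto]).
    rewrite (CRInt_derive_le (fun t => RtoC t * s (RtoC t * z))%C).
    - replace (RtoC 1 * z)%C with z by ring. ring.
    - lra.
    - intros t Ht. assert (Hz' : Cmod (RtoC t * z) < 1). { eapply Rle_lt_trans. apply Cmod_RtoC_mult_le; auto. auto. }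
      eapply rcder_eq.
      apply (cder_comp_curve (fun w => w * s (w * z))%C RtoC). apply cder_mult. apply cder_id.
      apply (cder_comp s (fun w => w * z)%C). apply Hs; auto. apply cder_mult. apply cder_id. apply cder_const.
      apply rcder_RtoC. cbv beta. ring.
    - intros t Ht. apply continuous_Cplus; auto. apply continuous_Cmult; auto. apply continuous_const. }
  exists (fun z => z * I z)%C. split; [|ring].
  intros z Hz. split; [|now apply (hol_continuous s s')].
  destruct (half_gap_disk 1 z Hz) as [A [B [D E]]].
  destruct (hol_quad s s' _ Hs B) as [K [K0 HK]].
  apply (cder_of_quadratic _ _ _ (K + Cmod (J z)) _ A).
  intros w Hw. assert (Hw1 : Cmod w < 1) by (specialize (E w Hw); lra).
  assert (Q : Cmod (I w - I z - (w - z) * J z) <= K * (Cmod (w - z) * Cmod (w - z))).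
  { unfold I, J. rewrite CRInt_lin3 by (apply ex_CRInt_cont_le; [lra|auto]).
    replace (K * (Cmod (w - z) * Cmod (w - z))) with ((1 - 0) * (K * (Cmod (w - z) * Cmod (w - z)))) by ring.
    apply Cmod_CRInt_le_const. lra.
    - intros t Ht. replace (s (RtoC t * w) - s (RtoC t * z) - (w - z) * (RtoC t * s' (RtoC t * z)))%C with
        (s (RtoC t * w) - s (RtoC t * z) - s' (RtoC t * z) * (RtoC t * w - RtoC t * z))%C by ring.
      eapply Rle_trans. apply HK.
      eapply Rle_trans. apply Cmod_RtoC_mult_le; auto. auto.
      eapply Rle_trans. apply Cmod_RtoC_mult_le; auto. auto.
      replace (RtoC t * w - RtoC t * z)%C with (RtoC t * (w - z))%C by ring.
      apply Rmult_le_compat_l; auto. apply Rmult_le_compat; try apply Cmod_ge_0; now apply Cmod_RtoC_mult_le.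
    - apply ex_CRInt_cont_le. lra. intros t Ht. apply continuous_Cminus. apply continuous_Cminus; auto.
      apply continuous_Cmult; auto. apply continuous_const. }
  rewrite (IJ z Hz).
  replace (w * I w - z * I z - (I z + z * J z) * (w - z))%C with
    (w * (I w - I z - (w - z) * J z) + J z * ((w - z) * (w - z)))%C by ring.
  eapply Rle_trans. apply Cmod_triangle. rewrite !Cmod_mult.
  pose proof (Cmod_ge_0 (I w - I z - (w - z) * J z)). pose proof (Cmod_ge_0 w). nra.
Qed.

Lemma hol_zero_const (G G' : C -> C) (z : C) : hol G G' -> (forall w, Cmod w < 1 -> G' w = 0%C) -> Cmod z < 1 -> G z = G 0%C.
Proof.
  intros HG E Hz.
  assert (X : G (RtoC 0 * z)%C = G (RtoC 1 * z)%C).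
  { apply (rcder_zero_const (fun t => G (RtoC t * z)%C) 0 1). lra. intros t Ht.
    assert (Hz' : Cmod (RtoC t * z) < 1). { eapply Rle_lt_trans. apply Cmod_RtoC_mult_le; auto. auto. }
    eapply rcder_eq. apply (cder_comp_curve G (fun t => RtoC t * z)%C). apply HG; auto. apply rcder_scale.
    rewrite E by auto. ring. }
  replace (RtoC 0 * z)%C with (RtoC 0) in X by ring. replace (RtoC 1 * z)%C with z in X by ring. auto.
Qed.

(** [l] is a primitive of [q' / q], and [q * exp (- l)] has derivative 0. The factor [q 0] stays
    outside the exponential, so that no logarithm of a complex number has to be chosen. *)
Lemma log_branch (q q' : C -> C) : hol q q' -> (forall z, Cmod z < 1 -> q z <> 0%C) ->
  exists l, hol l (fun z => q' z / q z)%C /\ l 0%C = 0%C /\ forall z, Cmod z < 1 -> q z = (q 0%C * Cexp (l z))%C.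
Proof.
  intros Hq N.
  destruct (hol_primitive (fun z => q' z / q z)%C (fun z => C_derive q' z * / q z + q' z * (- q' z / (q z * q z)))%C) as [l [Hl l0]].
  { apply hol_mult. now apply (hol_deriv q). apply hol_inv; auto. }
  exists l. split; [exact Hl|split; [exact l0|]]. intros z Hz.
  assert (X : (q z * Cexp (RtoC 0 - l z))%C = (q 0 * Cexp (RtoC 0 - l 0))%C).
  { apply (hol_zero_const (fun z => q z * Cexp (RtoC 0 - l z))%C (fun z => q' z * Cexp (RtoC 0 - l z) + q z * (Cexp (RtoC 0 - l z) * (RtoC 0 - q' z / q z)))%C); auto.
    apply hol_mult; auto. apply (hol_exp (fun z => RtoC 0 - l z)%C (fun z => RtoC 0 - q' z / q z)%C).
    apply (hol_minus (fun _ => RtoC 0) (fun _ => RtoC 0)); auto. apply hol_const.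
    intros w Hw. field. auto. }
  rewrite l0 in X. replace (RtoC 0 - RtoC 0)%C with (RtoC 0) in X by ring. rewrite Cexp_0 in X.
  replace (RtoC 0 - l z)%C with (- l z)%C in X by ring. rewrite Cexp_opp in X.
  replace (q 0%C) with (q 0%C * RtoC 1)%C by ring. rewrite <- X. field. apply Cexp_neq_0.
Qed.

Lemma hol_circ_cont (F F' : C -> C) (r th : R) : hol F F' -> 0 <= r < 1 -> ccont (fun t => F (RtoC r * cis t)%C) th.
Proof.
  intros HF Hr. apply (continuous_comp (U := R_UniformSpace) (V := C_UniformSpace) (W := C_UniformSpace) (fun th => RtoC r * cis th)%C F). cont.
  apply (hol_continuous F F'); auto. rewrite Cmod_circ; lra.
Qed.

Lemma circ_neq_0 (r th : R) : 0 < r -> (RtoC r * cis th)%C <> 0%C.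
Proof. intros H. apply Cmod_gt_0. rewrite Cmod_circ; lra. Qed.

Lemma mean_value (F F' : C -> C) (r : R) : hol F F' -> 0 < r < 1 ->
  CI (fun th => F (RtoC r * cis th)%C) = (RtoC (2 * PI) * F 0%C)%C.
Proof.
  intros HF Hr. rewrite <- (cauchy_formula F F' r); auto. 2: rewrite Cmod_0; lra.
  apply CRInt_ext. intros t. replace (RtoC r * cis t - 0)%C with (RtoC r * cis t)%C by ring.
  assert (N := circ_neq_0 r t (proj1 Hr)). set (u := (RtoC r * cis t)%C) in *. field. auto.
Qed.

Lemma cis_neq_0 (t : R) : cis t <> 0%C.
Proof. apply Cmod_gt_0. rewrite Cmod_cis; lra. Qed.

Lemma cos_cis (t : R) : RtoC (cos t) = ((cis t + / cis t) / 2)%C.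
Proof.
  set (u := (cos t, - sin t) : C).
  assert (M : (cis t * u)%C = 1%C).
  { unfold u, cis, Cmult, RtoC; cbn. f_equal. rewrite <- (sin2_cos2 t). unfold Rsqr; ring. ring. }
  assert (E : (/ cis t)%C = u).
  { replace (/ cis t)%C with (/ cis t * (cis t * u))%C by (rewrite M; ring).
    rewrite Cmult_assoc, Cinv_l by apply cis_neq_0. ring. }
  rewrite E. replace (cis t + u)%C with (RtoC 2 * RtoC (cos t))%C.
  field. unfold u, cis, Cplus, Cmult, RtoC; cbn. f_equal; ring.
Qed.

(** Write the cosine as half the sum of [cis] and its inverse. The first term gives the mean of
    [z F z], which is 0; the second gives Cauchy's formula for [F' 0], hence [2 PI r F' 0] before
    halving. *)
Lemma fourier_C (F F' : C -> C) (r : R) : hol F F' -> 0 < r < 1 ->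
  CI (fun th => RtoC (cos th) * F (RtoC r * cis th))%C = (RtoC (PI * r) * F' 0%C)%C.
Proof.
  intros HF Hr.
  assert (Cc : forall th, ccont (fun t => F (RtoC r * cis t)%C) th) by (intros; apply (hol_circ_cont F F'); auto; lra).
  assert (A : CI (fun th => RtoC r * cis th * F (RtoC r * cis th))%C = 0%C).
  { rewrite (mean_value (fun z => z * F z)%C (fun z => 1 * F z + z * F' z)%C r); auto. ring.
    apply hol_mult; auto. apply hol_id. }
  assert (B : CI (fun th => / cis th * F (RtoC r * cis th))%C = (RtoC (2 * PI * r) * F' 0)%C).
  { rewrite (cauchy_int2_eq F F' r) by (auto; rewrite Cmod_0; lra). unfold cauchy_int2.
    rewrite <- CRInt_mult_l.
    - apply CRInt_ext. intros t. unfold boundary_density, cauchy_kernel. replace (RtoC r * cis t - 0)%C with (RtoC r * cis t)%C by ring.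
      pose proof (cis_neq_0 t). assert (RtoC r <> 0%C) by (apply RtoC_neq_0; lra).
      rewrite RtoC_mult. set (c := F (RtoC r * cis t)%C). field. repeat split; auto. apply twoPI_neq.
    - apply ex_CRInt_cont. intros t. apply continuous_Cmult. apply (boundary_density_continuous F F'); auto.
      apply continuous_Cmult; apply cauchy_kernel_cont; try lra; rewrite Cmod_0; lra. }
  rewrite (CRInt_ext _ (fun th => / (2 * RtoC r) * (RtoC r * cis th * F (RtoC r * cis th)) + / 2 * (/ cis th * F (RtoC r * cis th)))%C).
  2:{ intros t. rewrite cos_cis. assert (RtoC r <> 0%C) by (apply RtoC_neq_0; lra).
      set (c := F (RtoC r * cis t)%C). field. split; auto. apply cis_neq_0. }
  assert (C1 : forall t, ccont (fun th => RtoC r * cis th * F (RtoC r * cis th))%C t).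
  { intros t. apply continuous_Cmult; auto. cont. }
  assert (C2 : forall t, ccont (fun th => / cis th * F (RtoC r * cis th))%C t).
  { intros t. apply continuous_Cmult; auto. cont. apply cis_neq_0. }
  rewrite <- (CRInt_lin2 (fun th => / (2 * RtoC r) * (RtoC r * cis th * F (RtoC r * cis th)))%C (fun th => / cis th * F (RtoC r * cis th))%C).
  rewrite (CRInt_mult_l _ (fun th => RtoC r * cis th * F (RtoC r * cis th))%C), A, B.
  replace (PI * r) with (/ 2 * (2 * PI * r)) by field. rewrite (RtoC_mult (/ 2)), RtoC_inv by lra. ring.
  all: apply ex_CRInt_cont; intros t; cont; apply cis_neq_0.
Qed.

Lemma fst_CRInt (f : R -> C) (a b : R) : ex_CRInt f a b -> fst (CRInt f a b) = RInt (fun t => fst (f t)) a b.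
Proof. intros H. rewrite CRInt_pair; auto. Qed.

Lemma fourier_re (F F' : C -> C) (r : R) : hol F F' -> 0 < r < 1 ->
  RInt (fun th => cos th * fst (F (RtoC r * cis th)%C)) 0 (2 * PI) = PI * r * fst (F' 0%C).
Proof.
  intros HF Hr. pose proof (f_equal fst (fourier_C F F' r HF Hr)) as E.
  rewrite fst_CRInt in E.
  rewrite (RInt_ext _ (fun t => fst (RtoC (cos t) * F (RtoC r * cis t))%C)).
  rewrite E. cbn. ring. intros t _. cbn. ring.
  apply ex_CRInt_cont. intros t. apply continuous_Cmult. cont. apply (hol_circ_cont F F'); auto; lra.
Qed.

Lemma mean_re (F F' : C -> C) (r : R) : hol F F' -> 0 < r < 1 ->
  RInt (fun th => fst (F (RtoC r * cis th)%C)) 0 (2 * PI) = 2 * PI * fst (F 0%C).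
Proof.
  intros HF Hr. pose proof (f_equal fst (mean_value F F' r HF Hr)) as E.
  rewrite fst_CRInt in E. rewrite E. cbn. ring.
  apply ex_CRInt_cont. intros t. apply (hol_circ_cont F F'); auto; lra.
Qed.

Lemma RInt_cos_2PI : RInt cos 0 (2 * PI) = 0.
Proof.
  apply is_RInt_unique. replace 0 with (sin (2 * PI) - sin 0) at 2 by (rewrite sin_2PI, sin_0; ring).
  apply (is_RInt_derive sin cos). intros; apply is_derive_sin.
  intros x _. apply continuity_pt_filterlim. apply continuity_cos.
Qed.

Lemma ex_RInt_contR (f : R -> R) (a b : R) : (forall t, continuous f t) -> ex_RInt f a b.
Proof. intros H. apply (ex_RInt_continuous (V := R_CompleteNormedModule)). auto. Qed.

(** [ln |q|] is [ln |q 0|] plus the real part of the holomorphic logarithm. The cosine annihilates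
    the constant, and the logarithm has derivative [q' 0 / q 0] at 0. *)
Lemma fourier_log (q q' : C -> C) (r : R) : hol q q' -> (forall z, Cmod z < 1 -> q z <> 0%C) -> 0 < r < 1 ->
  RInt (fun th => cos th * ln (Cmod (q (RtoC r * cis th)%C))) 0 (2 * PI) = PI * r * fst (q' 0 / q 0)%C.
Proof.
  intros Hq N Hr. destruct (log_branch q q' Hq N) as [l [Hl [l0 E]]].
  rewrite <- (fourier_re l _ r Hl Hr).
  rewrite (RInt_ext _ (fun th => plus (scal (ln (Cmod (q 0%C))) (cos th)) (cos th * fst (l (RtoC r * cis th)%C)))).
  2:{ intros t _. rewrite E by (rewrite Cmod_circ; lra). rewrite Cmod_mult, Cmod_Cexp, ln_mult, ln_exp.
      unfold plus, scal; cbn. unfold mult; cbn. ring. apply Cmod_gt_0. apply N. rewrite Cmod_0; lra. apply exp_pos. }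
  rewrite (RInt_plus (V := R_CompleteNormedModule)), (RInt_scal (V := R_CompleteNormedModule)), RInt_cos_2PI.
  unfold plus, scal; cbn. unfold mult; cbn. ring.
  - apply ex_RInt_contR. intros t. cont.
  - apply ex_RInt_contR. intros t. apply (continuous_scal_r (K := R_AbsRing) (V := R_NormedModule)). cont.
  - apply ex_RInt_contR. intros t. apply continuous_Rmult. cont. apply continuous_fstC. apply (hol_circ_cont l _ r t Hl). lra.
Qed.

(** * Logarithmic energy of a neutral charge *)

Lemma derive_nonneg_le (f f' : R -> R) (a b : R) : a <= b ->
  (forall x, a <= x <= b -> is_derive f x (f' x)) -> (forall x, a <= x <= b -> 0 <= f' x) -> f a <= f b.
Proof.
  intros Hab D P.
  destruct (MVT_gen f a b f') as [c [Hc E]]; rewrite ?Rmin_left, ?Rmax_right in * by auto.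
  - intros x Hx. apply D. lra.
  - intros x Hx. apply continuity_pt_filterlim. apply (ex_derive_continuous (K := R_AbsRing) (V := R_NormedModule)). eexists. apply D; auto.
  - specialize (P c Hc). nra.
Qed.

Definition qform (n : nat) (c : nat -> R) (K : nat -> nat -> R) : R :=
  sum_f_R0 (fun i => sum_f_R0 (fun j => c i * c j * K i j) n) n.

Lemma qform_ext n c K L : (forall i j, K i j = L i j) -> qform n c K = qform n c L.
Proof. intros H. apply sum_eq. intros i _. apply sum_eq. intros j _. now rewrite H. Qed.

(** Factors of a kernel that depend on one index only can be moved into the weights, which are
    arbitrary in the positivity results that follow. *)
Lemma qform_weights n c d a K L : (forall i j, c i * c j * K i j = a * (d i * d j * L i j)) -> qform n c K = a * qform n d L.
Proof.
  intros H. unfold qform. rewrite scal_sum. apply sum_eq. intros i _. rewrite (Rmult_comm _ a), scal_sum. apply sum_eq. intros j _.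
  rewrite H. ring.
Qed.

Lemma qform_plus n c d e K L M : (forall i j, c i * c j * K i j = d i * d j * L i j + e i * e j * M i j) ->
  qform n c K = qform n d L + qform n e M.
Proof.
  intros H. unfold qform. rewrite <- sum_plus. apply sum_eq. intros i _. rewrite <- sum_plus. apply sum_eq. intros j _. apply H.
Qed.

Lemma qform_const n c a : qform n c (fun _ _ => a) = a * (sum_f_R0 c n) ^ 2.
Proof.
  unfold qform. transitivity (sum_f_R0 (fun i => c i * (a * sum_f_R0 c n)) n).
  - apply sum_eq. intros i _. replace (c i * (a * sum_f_R0 c n)) with ((c i * a) * sum_f_R0 c n) by ring.
    rewrite scal_sum. apply sum_eq. intros j _. ring.
  - rewrite <- (scal_sum c). ring.
Qed.

Lemma sum_lim (n : nat) (u : nat -> nat -> R) (l : nat -> R) : (forall i, is_lim_seq (fun m => u m i) (l i)) ->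
  is_lim_seq (fun m => sum_f_R0 (u m) n) (sum_f_R0 l n).
Proof.
  intros H. induction n as [|n IH]; cbn. apply H. now apply is_lim_seq_plus'.
Qed.

Lemma qform_lim n c (K : nat -> nat -> nat -> R) (L : nat -> nat -> R) : (forall i j, is_lim_seq (fun m => K m i j) (L i j)) ->
  is_lim_seq (fun m => qform n c (K m)) (qform n c L).
Proof.
  intros H. apply sum_lim. intros i. apply sum_lim. intros j.
  apply (is_lim_seq_scal_l _ (c i * c j) (L i j)). apply H.
Qed.

Lemma sum_derive (n : nat) (u : nat -> R -> R) (l : nat -> R) (x : R) : (forall i, is_derive (u i) x (l i)) ->
  is_derive (fun y => sum_f_R0 (fun i => u i y) n) x (sum_f_R0 l n).
Proof.
  intros H. induction n as [|n IH]; cbn. apply H.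
  apply (is_derive_plus (K := R_AbsRing) (V := R_NormedModule)); auto.
Qed.

Lemma qform_derive n c (K : nat -> nat -> R -> R) L x : (forall i j, is_derive (K i j) x (L i j)) ->
  is_derive (fun y => qform n c (fun i j => K i j y)) x (qform n c L).
Proof.
  intros H. apply (sum_derive n (fun i y => sum_f_R0 (fun j => c i * c j * K i j y) n)). intros i.
  apply (sum_derive n (fun j y => c i * c j * K i j y)). intros j.
  apply (is_derive_scal (K i j)). apply H.
Qed.

(** A Schur product argument in the plane: one more factor [x_i x_j + y_i y_j] splits the form into
    two forms of lower degree with weights [c_i x_i] and [c_i y_i]. This is why [c] is quantified
    after the exponent. *)
Lemma qform_dot_pow n (x y : nat -> R) (k : nat) : forall c, 0 <= qform n c (fun i j => (x i * x j + y i * y j) ^ k).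
Proof.
  induction k as [|k IH]; intros c; cbn [pow].
  - rewrite qform_const. nra.
  - rewrite (qform_plus n c (fun i => c i * x i) (fun i => c i * y i) _ (fun i j => (x i * x j + y i * y j) ^ k) (fun i j => (x i * x j + y i * y j) ^ k)).
    apply Rplus_le_le_0_compat; apply IH. intros i j. ring.
Qed.

(** The partial sums of the exponential series combine powers of the Gram kernel with nonnegative
    coefficients, and positivity passes to the limit. *)
Lemma qform_exp_dot n (x y : nat -> R) (c : nat -> R) (a : R) : 0 <= a ->
  0 <= qform n c (fun i j => exp (a * (x i * x j + y i * y j))).
Proof.
  intros Ha.
  set (E := fun m t => sum_f_R0 (fun k => / INR (Factorial.fact k) * t ^ k) m).
  apply (is_lim_seq_le (fun _ => 0) (fun m => qform n c (fun i j => E m (a * (x i * x j + y i * y j)))) 0 (qform n c (fun i j => exp (a * (x i * x j + y i * y j))))).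
  - intros m. assert (T : forall k, 0 <= qform n c (fun i j => / INR (Factorial.fact k) * (a * (x i * x j + y i * y j)) ^ k)).
    { intros k. rewrite (qform_weights n c c (/ INR (Factorial.fact k) * a ^ k) _ (fun i j => (x i * x j + y i * y j) ^ k)).
      apply Rmult_le_pos. apply Rmult_le_pos. left. apply Rinv_0_lt_compat. apply INR_fact_lt_0. now apply pow_le.
      apply qform_dot_pow. intros i j. rewrite Rpow_mult_distr. ring. }
    induction m as [|m IH]. apply (T 0%nat).
    rewrite (qform_plus n c c c _ (fun i j => E m (a * (x i * x j + y i * y j))) (fun i j => / INR (Factorial.fact (S m)) * (a * (x i * x j + y i * y j)) ^ (S m))).
    apply Rplus_le_le_0_compat; auto.
    intros i j. unfold E. rewrite tech5. ring.
  - apply is_lim_seq_const.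
  - apply (qform_lim n c (fun m i j => E m (a * (x i * x j + y i * y j)))). intros i j.
    apply is_lim_seq_Reals. unfold exp. destruct (exist_exp (a * (x i * x j + y i * y j))) as [l Hl]. exact Hl.
Qed.

Definition dist2 (x y : nat -> R) (i j : nat) : R := (x i - x j) ^ 2 + (y i - y j) ^ 2.

Lemma dist2_pos x y i j : 0 <= dist2 x y i j.
Proof. apply Rplus_le_le_0_compat; apply pow2_ge_0. Qed.

(** Expand [|p - q|^2 = |p|^2 + |q|^2 - 2 <p, q>]: the squares go into the weights, [s] into a
    constant factor, and the exponential of the scalar product remains. *)
Lemma qform_gauss n x y c T s : 0 <= T ->
  0 <= qform n c (fun i j => exp (- T * (dist2 x y i j + s))).
Proof.
  intros HT.
  rewrite (qform_weights n c (fun i => c i * exp (- T * (x i ^ 2 + y i ^ 2))) (exp (- T * s)) _ (fun i j => exp (2 * T * (x i * x j + y i * y j)))).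
  apply Rmult_le_pos. left; apply exp_pos. apply qform_exp_dot. lra.
  intros i j.
  replace (- T * (dist2 x y i j + s)) with (- T * s + (- T * (x i ^ 2 + y i ^ 2)) + (- T * (x j ^ 2 + y j ^ 2)) + (2 * T * (x i * x j + y i * y j))).
  rewrite !exp_plus. ring. unfold dist2. ring.
Qed.

Lemma exp_neg_lim (a : R) : 0 < a -> is_lim_seq (fun m => exp (- INR m * a)) 0.
Proof.
  intros Ha. apply is_lim_seq_ext with (fun m => exp (- a) ^ m).
  - intros m. induction m as [|m IH]. cbn. now rewrite Ropp_0, Rmult_0_l, exp_0.
    rewrite <- tech_pow_Rmult, IH, S_INR, <- exp_plus. f_equal. ring.
  - apply is_lim_seq_geom. rewrite Rabs_pos_eq. rewrite <- exp_0. apply exp_increasing; lra. left; apply exp_pos.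
Qed.

(** [1 / q] is the integral of [exp (- T q)] over [T > 0]. Instead of an improper integral, [P] uses
    the antiderivative [(1 - exp (- T q)) / q]: its form starts at 0, has the nonnegative Gaussian
    form as derivative, and tends to the claim. *)
Lemma qform_inv n x y c s : 0 < s -> 0 <= qform n c (fun i j => / (dist2 x y i j + s)).
Proof.
  intros Hs.
  set (P := fun T => qform n c (fun i j => (1 - exp (- T * (dist2 x y i j + s))) / (dist2 x y i j + s))).
  assert (Q : forall i j, 0 < dist2 x y i j + s) by (intros; pose proof (dist2_pos x y i j); lra).
  assert (P0 : P 0 = 0).
  { unfold P. rewrite (qform_ext _ _ _ (fun _ _ => 0)). rewrite qform_const. ring.
    intros i j. rewrite Ropp_0, Rmult_0_l, exp_0. unfold Rdiv. ring. }
  assert (PT : forall m, 0 <= P (INR m)).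
  { intros m. rewrite <- P0. apply (derive_nonneg_le P (fun T => qform n c (fun i j => exp (- T * (dist2 x y i j + s))))).
    apply pos_INR.
    - intros T HT. unfold P. apply (qform_derive n c (fun i j T => (1 - exp (- T * (dist2 x y i j + s))) / (dist2 x y i j + s))).
      intros i j. specialize (Q i j). auto_derive. lra. field. lra.
    - intros T HT. apply qform_gauss. lra. }
  apply (is_lim_seq_le (fun _ => 0) (fun m => P (INR m)) 0 (qform n c (fun i j => / (dist2 x y i j + s)))); auto.
  apply is_lim_seq_const.
  unfold P. apply (qform_lim n c (fun m i j => (1 - exp (- INR m * (dist2 x y i j + s))) / (dist2 x y i j + s))).
  intros i j. replace (/ (dist2 x y i j + s)) with ((1 - 0) * / (dist2 x y i j + s)) by ring.
  apply (is_lim_seq_scal_r _ (/ (dist2 x y i j + s)) (1 - 0)).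
  apply is_lim_seq_minus'. apply is_lim_seq_const. apply exp_neg_lim, Q.
Qed.

(* The neutral logarithmic energy increases with the smoothing parameter s and vanishes as s tends to infinity. *)
Lemma qform_log n x y c s : 0 < s -> sum_f_R0 c n = 0 -> qform n c (fun i j => ln (dist2 x y i j + s)) <= 0.
Proof.
  intros Hs Hc.
  set (P := fun s => qform n c (fun i j => ln (dist2 x y i j + s))).
  assert (Mono : forall t, s <= t -> P s <= P t).
  { intros t Ht. apply (derive_nonneg_le P (fun u => qform n c (fun i j => / (dist2 x y i j + u)))); auto.
    - intros u Hu. unfold P. apply (qform_derive n c (fun i j u => ln (dist2 x y i j + u))).
      intros i j. pose proof (dist2_pos x y i j). auto_derive. lra. field. lra.
    - intros u Hu. apply qform_inv. lra. }
  apply (is_lim_seq_le_loc (fun _ => P s) (fun m => P (INR m + 1)) (P s) 0).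
  - destruct (nfloor_ex s) as [k Hk]. lra. exists (S k). intros m Hm. apply Mono. apply le_INR in Hm. rewrite S_INR in Hm. lra.
  - apply is_lim_seq_const.
  - replace 0 with (qform n c (fun i j => 0)) by (rewrite qform_const; ring).
    (* Neutrality enters here: subtracting the constant [ln (m + 1)] from the kernel does not change
       the form, and afterwards every entry tends to [ln 1]. *)
    apply is_lim_seq_ext with (fun m => qform n c (fun i j => ln (1 + dist2 x y i j * / (INR m + 1)))).
    + intros m. pose proof (pos_INR m). unfold P.
      rewrite (qform_plus n c c c _ (fun i j => ln (dist2 x y i j + (INR m + 1))) (fun i j => - ln (INR m + 1))).
      rewrite qform_const, Hc. ring. intros i j. pose proof (dist2_pos x y i j).
      replace (1 + dist2 x y i j * / (INR m + 1)) with ((dist2 x y i j + (INR m + 1)) / (INR m + 1)) by (field; lra).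
      rewrite ln_div by lra. ring.
    + apply (qform_lim n c (fun m i j => ln (1 + dist2 x y i j * / (INR m + 1)))). intros i j.
      rewrite <- ln_1. apply is_lim_seq_continuous.
      apply derivable_continuous_pt. exists (/ 1). apply derivable_pt_lim_ln. lra.
      replace 1 with (1 + dist2 x y i j * 0) at 1 by ring.
      apply is_lim_seq_plus'. apply is_lim_seq_const.
      apply (is_lim_seq_scal_l _ (dist2 x y i j) 0).
      replace (Finite 0) with (Rbar_inv p_infty) by reflexivity.
      apply is_lim_seq_inv. 2: discriminate.
      apply is_lim_seq_ext with (fun m => INR (S m)). intros m; apply S_INR.
      apply (is_lim_seq_incr_1 INR). apply is_lim_seq_INR.
Qed.

(** * Discretisation of the charge with density cosine *)

Lemma RInt_cos (a b : R) : RInt cos a b = sin b - sin a.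
Proof.
  apply is_RInt_unique. apply (is_RInt_derive sin cos). intros; apply is_derive_sin.
  intros x _. apply continuity_pt_filterlim. apply continuity_cos.
Qed.

Lemma ex_RInt_cos_mult (f : R -> R) (a b : R) : (forall t, continuous f t) -> ex_RInt (fun t => cos t * f t) a b.
Proof. intros H. apply ex_RInt_contR. intros t. cont. Qed.

Lemma sin_diff_le (a b : R) : a <= b -> Rabs (sin b - sin a) <= b - a.
Proof.
  intros H. rewrite <- RInt_cos. replace (b - a) with ((b - a) * 1) by ring.
  apply abs_RInt_le_const; auto. apply ex_RInt_contR. intros; cont.
  intros t _. apply Rabs_le. pose proof (COS_bound t). lra.
Qed.

(** Only [f] is frozen at the left endpoint, while the cosine is integrated exactly. The error is
    therefore controlled by the oscillation of [f] alone. *)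
Lemma riemann_cos_cell (f : R -> R) (a b w : R) : a <= b -> (forall t, continuous f t) ->
  (forall t, a <= t <= b -> Rabs (f t - f a) <= w) ->
  Rabs (RInt (fun t => cos t * f t) a b - (sin b - sin a) * f a) <= (b - a) * w.
Proof.
  intros Hab Cf H.
  replace (RInt (fun t => cos t * f t) a b - (sin b - sin a) * f a) with (RInt (fun t => cos t * (f t - f a)) a b).
  - apply abs_RInt_le_const; auto. apply (ex_RInt_cos_mult (fun t => f t - f a)). intros t. cont.
    intros t Ht. rewrite Rabs_mult. specialize (H t Ht). pose proof (Rabs_pos (f t - f a)).
    assert (Rabs (cos t) <= 1) by (apply Rabs_le; pose proof (COS_bound t); lra). nra.
  - rewrite <- RInt_cos.
    rewrite (RInt_ext _ (fun t => minus (cos t * f t) (scal (f a) (cos t)))).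
    rewrite (RInt_minus (V := R_CompleteNormedModule) (fun t => cos t * f t) (fun t => scal (f a) (cos t))), (RInt_scal (V := R_CompleteNormedModule)).
    unfold minus, plus, opp, scal; cbn. unfold mult; cbn. ring.
    apply ex_RInt_contR; intros; cont. now apply ex_RInt_cos_mult.
    apply (ex_RInt_scal (V := R_CompleteNormedModule)). apply ex_RInt_contR; intros; cont.
    intros t _. unfold minus, plus, opp, scal; cbn. unfold mult; cbn. ring.
Qed.

Definition node (n i : nat) : R := INR i * (2 * PI / INR (S n)).
(* The integral of cos over a cell: with these weights the discretised charge has total mass exactly 0. *)
Definition weight (n i : nat) : R := sin (node n (S i)) - sin (node n i).

Lemma node_S n i : node n (S i) = node n i + 2 * PI / INR (S n).
Proof. unfold node. rewrite (S_INR i). ring. Qed.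

Lemma step_pos n : 0 < 2 * PI / INR (S n).
Proof. apply Rdiv_lt_0_compat. pose proof PI_RGT_0; lra. apply lt_0_INR. lia. Qed.

Lemma node_0 n : node n 0 = 0.
Proof. unfold node. cbn [INR]. ring. Qed.

Lemma node_end n : node n (S n) = 2 * PI.
Proof. unfold node. field. apply not_0_INR. lia. Qed.

Lemma node_range n i : (i <= S n)%nat -> 0 <= node n i <= 2 * PI.
Proof.
  intros H. split. unfold node. apply Rmult_le_pos. apply pos_INR. left; apply step_pos.
  rewrite <- (node_end n). unfold node. apply Rmult_le_compat_r. left; apply step_pos. now apply le_INR.
Qed.

Lemma weight_sum n : sum_f_R0 (weight n) n = 0.
Proof.
  assert (X : forall k, sum_f_R0 (weight n) k = sin (node n (S k))).
  { induction k as [|k IH]. cbn [sum_f_R0]. unfold weight. rewrite node_0, sin_0. ring.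
    rewrite tech5, IH. unfold weight. ring. }
  rewrite X, node_end. apply sin_2PI.
Qed.

Lemma weight_abs n i : Rabs (weight n i) <= 2 * PI / INR (S n).
Proof.
  unfold weight. pose proof (step_pos n). eapply Rle_trans. apply sin_diff_le; rewrite node_S; lra. rewrite node_S; lra.
Qed.

(** Each of the [n + 1] weights is at most one mesh width in absolute value, so the discretised
    charge has total variation at most [2 PI]. *)
Lemma weight_sum_bound n (u : nat -> R) (B : R) : (forall i, (i <= n)%nat -> Rabs (u i) <= B) ->
  Rabs (sum_f_R0 (fun i => weight n i * u i) n) <= 2 * PI * B.
Proof.
  intros H.
  assert (X : forall k, (k <= n)%nat -> Rabs (sum_f_R0 (fun i => weight n i * u i) k) <= node n (S k) * B).
  { assert (Y : forall k, (k <= n)%nat -> Rabs (weight n k * u k) <= 2 * PI / INR (S n) * B).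
    { intros k Hk. rewrite Rabs_mult. apply Rmult_le_compat; try apply Rabs_pos. apply weight_abs. auto. }
    induction k as [|k IH]; intros Hk.
    - cbn [sum_f_R0]. rewrite node_S, node_0, Rplus_0_l. apply Y; auto.
    - rewrite tech5, (node_S n (S k)), Rmult_plus_distr_r. eapply Rle_trans. apply Rabs_triang.
      apply Rplus_le_compat; auto. apply IH. lia. }
  rewrite <- (node_end n). apply X. lia.
Qed.

Lemma riemann_cos n (f : R -> R) (w : R) : (forall t, continuous f t) ->
  (forall x y, 0 <= x <= 2 * PI -> 0 <= y <= 2 * PI -> Rabs (x - y) <= 2 * PI / INR (S n) -> Rabs (f x - f y) <= w) ->
  Rabs (RInt (fun t => cos t * f t) 0 (2 * PI) - sum_f_R0 (fun i => weight n i * f (node n i)) n) <= 2 * PI * w.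
Proof.
  intros Cf H.
  assert (X : forall k, (k <= n)%nat -> Rabs (RInt (fun t => cos t * f t) 0 (node n (S k)) - sum_f_R0 (fun i => weight n i * f (node n i)) k) <= node n (S k) * w).
  { assert (Y : forall k, (k <= n)%nat -> Rabs (RInt (fun t => cos t * f t) (node n k) (node n (S k)) - weight n k * f (node n k)) <= 2 * PI / INR (S n) * w).
    { intros k Hk. replace (2 * PI / INR (S n)) with (node n (S k) - node n k) by (rewrite node_S; ring).
      pose proof (step_pos n). pose proof (node_range n k ltac:(lia)). pose proof (node_range n (S k) ltac:(lia)).
      apply riemann_cos_cell; auto. rewrite node_S; lra.
      intros t Ht. apply H; auto. lra. rewrite node_S in Ht. rewrite Rabs_pos_eq; lra. }
    induction k as [|k IH]; intros Hk.
    - cbn [sum_f_R0]. specialize (Y 0%nat Hk). rewrite node_0 in Y at 1. rewrite (node_S n 0), (node_0 n), Rplus_0_l in *. exact Y.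
    - rewrite tech5, (node_S n (S k)), Rmult_plus_distr_r, <- (node_S n (S k)).
      assert (Ch : RInt (fun t => cos t * f t) 0 (node n (S k)) + RInt (fun t => cos t * f t) (node n (S k)) (node n (S (S k))) = RInt (fun t => cos t * f t) 0 (node n (S (S k)))).
      { apply (RInt_Chasles (V := R_CompleteNormedModule)); now apply ex_RInt_cos_mult. }
      rewrite <- Ch.
      replace (RInt (fun t => cos t * f t) 0 (node n (S k)) + RInt (fun t => cos t * f t) (node n (S k)) (node n (S (S k))) - (sum_f_R0 (fun i => weight n i * f (node n i)) k + weight n (S k) * f (node n (S k)))) with
       ((RInt (fun t => cos t * f t) 0 (node n (S k)) - sum_f_R0 (fun i => weight n i * f (node n i)) k) + (RInt (fun t => cos t * f t) (node n (S k)) (node n (S (S k))) - weight n (S k) * f (node n (S k)))) by ring.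
      eapply Rle_trans. apply Rabs_triang. apply Rplus_le_compat; auto. apply IH. lia. }
  specialize (X n (le_n n)). rewrite node_end in X. exact X.
Qed.

(** The energy of the charge carried by the curve [w] is nonpositive; if the inner integral is known
    up to [B], the outer one inherits the bound times the total variation [2 PI]. No double integral
    is formed: the inner and outer integrals are compared separately with sums over the same nodes,
    to which [qform_log] applies. *)
Lemma energy_ineq (w : R -> C) (s : R) (g : R -> R) (B : R) : 0 < s ->
  (forall t, ccont w t) -> (forall t, continuous g t) ->
  (forall t, 0 <= t <= 2 * PI ->
     Rabs (RInt (fun u => cos u * ln (Cmod (w t - w u)%C ^ 2 + s)) 0 (2 * PI) - g t) <= B) ->
  RInt (fun t => cos t * g t) 0 (2 * PI) <= 2 * PI * B.
Proof.
  intros Hs Cw Cg HB.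
  set (L := fun t u => ln (Cmod (w t - w u)%C ^ 2 + s)).
  assert (CL : forall t u, continuity_2d_pt L t u).
  { intros t u. apply continuity_2d_pt_of_continuous. unfold L.
    apply (continuous_Rcomp (fun p : R * R => Cmod (w (fst p) - w (snd p))%C ^ 2 + s) ln).
    apply continuous_Rplus; [|apply continuous_const]. apply continuous_Rsqr, continuous_Cmod, continuous_Cminus.
    apply (continuous_comp (U := prod_UniformSpace R_UniformSpace R_UniformSpace) (V := R_UniformSpace) (W := C_UniformSpace) fst w). cont. apply Cw.
    apply (continuous_comp (U := prod_UniformSpace R_UniformSpace R_UniformSpace) (V := R_UniformSpace) (W := C_UniformSpace) snd w). cont. apply Cw.
    apply derivable_continuous_pt. eexists. apply derivable_pt_lim_ln. cbn [fst snd]. pose proof (pow2_ge_0 (Cmod (w t - w u))). lra. }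
  assert (CL1 : forall t u, continuous (L t) u).
  { intros t u. unfold L. apply (continuous_Rcomp (fun u => Cmod (w t - w u)%C ^ 2 + s) ln). cont.
    apply derivable_continuous_pt. eexists. apply derivable_pt_lim_ln. pose proof (pow2_ge_0 (Cmod (w t - w u))). lra. }
  assert (Cg2 : forall x y, continuity_2d_pt (fun a _ => g a) x y).
  { intros x y. apply continuity_2d_pt_of_continuous. apply (continuous_comp (U := prod_UniformSpace R_UniformSpace R_UniformSpace) (V := R_UniformSpace) (W := R_UniformSpace) fst g). cont. apply Cg. }
  pose proof PI_RGT_0 as HPI.
  apply Rnot_lt_le. intros Neg.
  set (gap := RInt (fun t => cos t * g t) 0 (2 * PI) - 2 * PI * B).
  (* The two discretisations cost [2 PI e] for the outer integral and [2 PI (2 PI e)] for the inner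
     ones, together half of [gap]. *)
  set (e := gap / (2 * (2 * PI) * (1 + 2 * PI))).
  assert (He : 0 < e). { apply Rdiv_lt_0_compat. unfold gap; lra. nra. }
  destruct (uniform_continuity_2d L 0 (2 * PI) 0 (2 * PI) (fun x y _ _ => CL x y) (mkposreal e He)) as [d1 H1].
  destruct (uniform_continuity_2d (fun a _ => g a) 0 (2 * PI) 0 (2 * PI) (fun x y _ _ => Cg2 x y) (mkposreal e He)) as [d2 H2].
  assert (Hd : 0 < Rmin d1 d2). { apply Rmin_glb_lt; apply cond_pos. }
  destruct (nfloor_ex (2 * PI / Rmin d1 d2)) as [n [_ Hn]]. { left. apply Rdiv_lt_0_compat; lra. }
  assert (St : 2 * PI / INR (S n) < Rmin d1 d2).
  { rewrite S_INR. pose proof (pos_INR n). apply (Rmult_lt_compat_r (Rmin d1 d2)) in Hn; auto.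
    unfold Rdiv in Hn at 1. rewrite Rmult_assoc, Rinv_l, Rmult_1_r in Hn by lra.
    apply (Rmult_lt_reg_r (INR n + 1)). lra. unfold Rdiv. rewrite Rmult_assoc, Rinv_l, Rmult_1_r by lra. lra. }
  assert (S1 : 2 * PI / INR (S n) < d1) by (eapply Rlt_le_trans; [exact St|apply Rmin_l]).
  assert (S2 : 2 * PI / INR (S n) < d2) by (eapply Rlt_le_trans; [exact St|apply Rmin_r]).
  pose proof (qform_log n (fun i => fst (w (node n i))) (fun i => snd (w (node n i))) (weight n) s Hs (weight_sum n)) as Q.
  (* The row sums serve twice: as Riemann sums of the inner integral at a node, and as the inner
     sums of the discrete energy. *)
  set (rs := fun i => sum_f_R0 (fun j => weight n j * L (node n i) (node n j)) n).
  assert (Q' : sum_f_R0 (fun i => weight n i * rs i) n <= 0).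
  { replace (sum_f_R0 (fun i => weight n i * rs i) n) with (qform n (weight n) (fun i j => ln (dist2 (fun i => fst (w (node n i))) (fun i => snd (w (node n i))) i j + s))); auto.
    unfold qform, rs. apply sum_eq. intros i _. rewrite scal_sum. apply sum_eq. intros j _. unfold L.
    replace (dist2 (fun i => fst (w (node n i))) (fun i => snd (w (node n i))) i j) with (Cmod (w (node n i) - w (node n j)) ^ 2). ring.
    rewrite Cmod2_alt. reflexivity. }
  assert (R1 : forall i, (i <= n)%nat -> Rabs (g (node n i) - rs i) <= 2 * PI * e + B).
  { intros i Hi. pose proof (node_range n i ltac:(lia)) as Hr. specialize (HB _ Hr).
    assert (Y : Rabs (RInt (fun u => cos u * L (node n i) u) 0 (2 * PI) - rs i) <= 2 * PI * e).
    { apply (riemann_cos n (L (node n i))); auto. intros x y Hx Hy Hxy. rewrite Rabs_minus_sym. left.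
      apply (H1 (node n i) x (node n i) y); auto. rewrite Rminus_diag, Rabs_R0. apply cond_pos. rewrite Rabs_minus_sym. lra. }
    change (Rabs (RInt (fun u => cos u * L (node n i) u) 0 (2 * PI) - g (node n i)) <= B) in HB.
    rewrite Rabs_minus_sym in HB.
    replace (g (node n i) - rs i) with ((g (node n i) - RInt (fun u => cos u * L (node n i) u) 0 (2 * PI)) + (RInt (fun u => cos u * L (node n i) u) 0 (2 * PI) - rs i)) by ring.
    eapply Rle_trans. apply Rabs_triang. lra. }
  apply weight_sum_bound in R1.
  assert (R2 : Rabs (RInt (fun t => cos t * g t) 0 (2 * PI) - sum_f_R0 (fun i => weight n i * g (node n i)) n) <= 2 * PI * e).
  { apply riemann_cos; auto. intros x y Hx Hy Hxy. left. apply (H2 y 0 x 0); auto; try lra. rewrite Rminus_diag, Rabs_R0. apply cond_pos. }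
  assert (E : sum_f_R0 (fun i => weight n i * (g (node n i) - rs i)) n = sum_f_R0 (fun i => weight n i * g (node n i)) n - sum_f_R0 (fun i => weight n i * rs i) n).
  { rewrite <- minus_sum. apply sum_eq. intros; ring. }
  rewrite E in R1.
  assert (A1 := Rle_abs (sum_f_R0 (fun i => weight n i * g (node n i)) n - sum_f_R0 (fun i => weight n i * rs i) n)).
  assert (A2 := Rle_abs (RInt (fun t => cos t * g t) 0 (2 * PI) - sum_f_R0 (fun i => weight n i * g (node n i)) n)).
  assert (F : gap <= 2 * PI * e + 2 * PI * (2 * PI * e)) by (unfold gap; lra).
  assert (G : 2 * (2 * PI) * (1 + 2 * PI) * e = gap) by (unfold e; field; lra).
  nra.
Qed.

Lemma ln_le_sub_1 (t : R) : 0 < t -> ln t <= t - 1.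
Proof.
  intros Ht. pose proof (exp_ineq1_le (ln t)) as H. rewrite exp_ln in H by auto. lra.
Qed.

(** The price of pulling [G] out of [G x + s]. Applying [ln y <= y - 1] to the ratio and to its
    inverse gives [(/ G - 1) s / (x + s)] and [(G - 1) s / (G x + s)]; the bounds on [G] reduce both
    to the same multiple of [s / (x + s)]. *)
Lemma log_ratio_bound (x s G m M : R) : 0 <= x -> 0 < s -> 0 < m -> m <= G <= M ->
  Rabs (ln (G * x + s) - ln (x + s) - ln G) <= (/ m + 1 + M) * (s / (x + s)).
Proof.
  intros Hx Hs Hm HG.
  assert (A : 0 < G * x + s) by nra. assert (B : 0 < x + s) by lra. assert (G0 : 0 < G) by lra.
  assert (Hy : 0 < s / (x + s)) by (apply Rdiv_lt_0_compat; lra).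
  assert (Hm' : 0 < / m) by now apply Rinv_0_lt_compat.
  assert (HGm : / G <= / m) by (apply Rinv_le_contravar; lra).
  assert (HG' : 0 < / G) by now apply Rinv_0_lt_compat.
  assert (U : ln (G * x + s) - ln (x + s) - ln G <= / m * (s / (x + s))).
  { replace (ln (G * x + s) - ln (x + s) - ln G) with (ln ((G * x + s) / ((x + s) * G))).
    2:{ rewrite ln_div, ln_mult; try lra. apply Rmult_lt_0_compat; lra. }
    eapply Rle_trans. apply ln_le_sub_1. apply Rdiv_lt_0_compat; auto. apply Rmult_lt_0_compat; lra.
    replace ((G * x + s) / ((x + s) * G) - 1) with ((/ G - 1) * (s / (x + s))) by (field; lra).
    apply Rmult_le_compat_r; lra. }
  assert (L : ln (x + s) + ln G - ln (G * x + s) <= (1 + M) * (s / (x + s))).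
  { replace (ln (x + s) + ln G - ln (G * x + s)) with (ln (((x + s) * G) / (G * x + s))).
    2:{ rewrite ln_div, ln_mult; try lra. apply Rmult_lt_0_compat; lra. }
    eapply Rle_trans. apply ln_le_sub_1. apply Rdiv_lt_0_compat; auto. apply Rmult_lt_0_compat; lra.
    replace ((x + s) * G / (G * x + s) - 1) with ((G - 1) * (s / (G * x + s))) by (field; lra).
    apply Rle_trans with (G * (s / (G * x + s))).
    apply Rmult_le_compat_r. left; now apply Rdiv_lt_0_compat. lra.
    apply (Rmult_le_reg_r ((G * x + s) * (x + s))). now apply Rmult_lt_0_compat.
    replace (G * (s / (G * x + s)) * ((G * x + s) * (x + s))) with (s * (G * (x + s))) by (field; lra).
    replace ((1 + M) * (s / (x + s)) * ((G * x + s) * (x + s))) with (s * ((1 + M) * (G * x + s))) by (field; lra).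
    apply Rmult_le_compat_l. lra. nra. }
  assert (0 <= M) by lra. apply Rabs_le. split; nra.
Qed.

(** Around each point a radius is chosen on which [g] keeps half of its value and which is itself at
    most that half. The uniform radius supplied by compactness of the square is then directly a
    lower bound of [g]. The radii must form a function, hence the appeal to choice. *)
Lemma positive_min_2d (g : R -> R -> R) (a b : R) :
  (forall x y, continuity_2d_pt g x y) -> (forall x y, 0 < g x y) ->
  exists m, 0 < m /\ forall x y, a <= x <= b -> a <= y <= b -> m <= g x y.
Proof.
  intros Cg Pg.
  assert (X : forall p : R * R, exists d : posreal, d <= g (fst p) (snd p) / 2 /\
     forall u v, Rabs (u - fst p) < d -> Rabs (v - snd p) < d -> g (fst p) (snd p) / 2 <= g u v).
  { intros [x y]. cbn [fst snd]. specialize (Pg x y).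
    assert (h : 0 < g x y / 2) by lra.
    destruct (Cg x y (mkposreal _ h)) as [d Hd].
    assert (h' : 0 < Rmin d (g x y / 2)) by (apply Rmin_glb_lt; auto; apply cond_pos).
    exists (mkposreal _ h'). split. apply Rmin_r.
    intros u v Hu Hv. specialize (Hd u v). cbn [pos] in *.
    assert (Rabs (g u v - g x y) < g x y / 2).
    { apply Hd; eapply Rlt_le_trans; eauto; apply Rmin_l. }
    apply Rabs_def2 in H. lra. }
  set (delta := fun p => proj1_sig (constructive_indefinite_description _ (X p))).
  assert (Hd := fun p => proj2_sig (constructive_indefinite_description _ (X p))). cbv beta in Hd.
  destruct (compactness_value_2d a b a b (fun x y => delta (x, y))) as [d Hd'].
  exists d. split. apply cond_pos. intros x y Hx Hy.
  apply Rnot_lt_le. intros N. apply (Hd' x y Hx Hy).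
  intros [i [j [Hi [Hj [H1 [H2 H3]]]]]].
  destruct (Hd (i, j)) as [A B]. fold (delta (i, j)) in A, B. cbn [fst snd] in *. specialize (B x y H1 H2). lra.
Qed.

(** With [|v| = rho], [1 / |1 - v|^2] is the real part of [(1 + v) / (1 - v)] divided by
    [1 - rho^2]. That quotient is holomorphic with value 1 at the centre, so the mean value property
    gives the integral. *)
Lemma poisson_int (rho t : R) : 0 < rho < 1 ->
  RInt (fun u => / Cmod (1 - cis (- t) * (RtoC rho * cis u))%C ^ 2) 0 (2 * PI) = 2 * PI / (1 - rho ^ 2).
Proof.
  intros Hr.
  set (q := fun z => (1 - cis (- t) * z)%C).
  assert (Nq : forall z, Cmod z < 1 -> q z <> 0%C).
  { intros z Hz E. assert (E' : (cis (- t) * z)%C = 1%C) by (replace (cis (- t) * z)%C with (1 - q z)%C by (unfold q; ring); rewrite E; ring).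
    apply (f_equal Cmod) in E'. rewrite Cmod_mult, Cmod_cis, Cmod_1 in E'. lra. }
  assert (Hq : hol q (fun z => 0 - (0 * z + cis (- t) * 1))%C).
  { apply (hol_minus (fun _ => RtoC 1) (fun _ => RtoC 0) (fun z => cis (- t) * z)%C). apply hol_const.
    apply (hol_mult (fun _ => cis (- t)) (fun _ => RtoC 0)). apply hol_const. apply hol_id. }
  set (P := fun z => ((1 + cis (- t) * z) * / q z)%C).
  assert (HP : exists P', hol P P').
  { eexists. apply hol_mult. apply (hol_plus (fun _ => RtoC 1) (fun _ => RtoC 0)). apply hol_const.
    apply (hol_mult (fun _ => cis (- t)) (fun _ => RtoC 0)). apply hol_const. apply hol_id. apply (hol_inv q); auto. apply Hq. }
  destruct HP as [P' HP].
  pose proof (mean_re P P' rho HP Hr) as E.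
  assert (P0 : fst (P 0%C) = 1).
  { replace (P 0%C) with (RtoC 1). reflexivity. unfold P, q. replace (1 - cis (- t) * 0)%C with (RtoC 1) by ring. field. }
  rewrite P0 in E.
  assert (H1 : 0 < 1 - rho ^ 2) by nra.
  rewrite (RInt_ext _ (fun u => scal (/ (1 - rho ^ 2)) (fst (P (RtoC rho * cis u)%C)))).
  - rewrite (RInt_scal (V := R_CompleteNormedModule)). rewrite E. unfold scal; cbn. unfold mult; cbn. field. cbn in H1. lra.
    apply ex_RInt_contR. intros u. apply continuous_fstC. apply (hol_circ_cont P P'); auto. lra.
  - intros u _. unfold P. fold (q (RtoC rho * cis u)%C).
    assert (Hz : Cmod (RtoC rho * cis u) = rho) by (rewrite Cmod_circ; lra).
    assert (N := Nq (RtoC rho * cis u)%C ltac:(lra)).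
    set (v := (cis (- t) * (RtoC rho * cis u))%C).
    assert (Ev : q (RtoC rho * cis u)%C = (1 - v)%C) by reflexivity. rewrite Ev in *.
    assert (Hv : fst v ^ 2 + snd v ^ 2 = rho ^ 2).
    { change (Re v ^ 2 + Im v ^ 2 = rho ^ 2). rewrite <- Cmod2_alt. unfold v. now rewrite Cmod_mult, Cmod_cis, Hz, Rmult_1_l. }
    apply sum_sqr_pos in N. rewrite Cmod2_alt. destruct v as [a b]. unfold Re, Im, scal, mult in *; cbn in *. unfold mult; cbn.
    rewrite <- Hv in H1 |- *. field. split; lra.
Qed.

Lemma int_cos2 : RInt (fun t => cos t * cos t) 0 (2 * PI) = PI.
Proof.
  pose proof (fourier_re _ _ (1/2) hol_id ltac:(lra)) as E.
  rewrite (RInt_ext _ (fun t => scal (/ (1/2)) (cos t * fst (RtoC (1/2) * cis t)%C))).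
  rewrite (RInt_scal (V := R_CompleteNormedModule)), E. unfold scal; cbn. unfold mult; cbn. field.
  apply ex_RInt_contR. intros t. apply continuous_Rmult. cont. apply continuous_fstC. cont.
  intros t _. unfold scal; cbn. unfold mult; cbn. field.
Qed.

(** * Bieberbach's inequality *)

(** Both sides are [r^2 / rho] times [(1 - rho)^2 + 2 rho (1 - cos (t - u))]. This identity dictates
    the smoothing parameter. *)
Lemma circle_dist_smoothed (r rho t u : R) : 0 < rho ->
  Cmod (RtoC r * cis t - RtoC r * cis u)%C ^ 2 + r ^ 2 / rho * (1 - rho) ^ 2 =
  r ^ 2 / rho * Cmod (1 - cis (- t) * (RtoC rho * cis u))%C ^ 2.
Proof.
  intros Hr. rewrite !Cmod2_alt. unfold Re, Im, cis. cbn [fst snd Cmult Cminus Cplus Copp RtoC].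
  rewrite cos_neg, sin_neg.
  pose proof (sin2_cos2 t) as E1. pose proof (sin2_cos2 u) as E2. unfold Rsqr in *.
  set (c1 := cos t) in *. set (s1 := sin t) in *. set (c2 := cos u) in *. set (s2 := sin u) in *.
  assert (F1 : s1 * s1 = 1 - c1 * c1) by lra. assert (F2 : s2 * s2 = 1 - c2 * c2) by lra.
  transitivity (r ^ 2 / rho * (rho * (2 - 2 * (c1 * c2 + s1 * s2)) + (1 - rho) ^ 2)).
  - replace (r ^ 2 / rho * (rho * (2 - 2 * (c1 * c2 + s1 * s2)) + (1 - rho) ^ 2)) with (r ^ 2 * (2 - 2 * (c1 * c2 + s1 * s2)) + r ^ 2 / rho * (1 - rho) ^ 2) by (field; lra).
    f_equal.
    replace (2 - 2 * (c1 * c2 + s1 * s2)) with ((s1 * s1 + c1 * c1) + (s2 * s2 + c2 * c2) - 2 * (c1 * c2 + s1 * s2)) by lra. ring.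
  - f_equal.
    replace ((1 + - (c1 * (rho * c2 - 0 * s2) - - s1 * (rho * s2 + 0 * c2))) ^ 2 + (0 + - (c1 * (rho * s2 + 0 * c2) + - s1 * (rho * c2 - 0 * s2))) ^ 2)
      with (1 - 2 * rho * (c1 * c2 + s1 * s2) + rho ^ 2 * ((s1 * s1 + c1 * c1) * (s2 * s2 + c2 * c2))) by ring.
    rewrite E1, E2. ring.
Qed.

Lemma ln_sqr (x : R) : 0 < x -> ln (x ^ 2) = 2 * ln x.
Proof. intros H. replace (x ^ 2) with (x * x) by ring. rewrite ln_mult by auto. ring. Qed.

Lemma is_RInt_of_RInt (f : R -> R) (a b l : R) : (forall t, continuous f t) -> RInt f a b = l -> is_RInt f a b l.
Proof. intros H <-. apply (RInt_correct (V := R_CompleteNormedModule)). now apply ex_RInt_contR. Qed.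

Lemma is_RInt_cos_mult (f : R -> R) (a b l : R) : (forall t, continuous f t) ->
  RInt (fun t => cos t * f t) a b = l -> is_RInt (fun t => cos t * f t) a b l.
Proof. intros H. apply is_RInt_of_RInt. intros t. cont. Qed.

Section Univalent.

Variables (F F' : C -> C).
Hypothesis HF : hol F F'.
Hypothesis Inj : forall z w, Cmod z < 1 -> Cmod w < 1 -> F z = F w -> z = w.
Hypothesis NF : forall z, Cmod z < 1 -> F' z <> 0%C.

Lemma diff_quot_neq_0 z w : Cmod z < 1 -> Cmod w < 1 -> diff_quot F F' z w <> 0%C.
Proof.
  intros Hz Hw. unfold diff_quot. destruct (Req_EM_T (Cmod (z - w)) 0) as [e|n]. now apply NF.
  assert (N : (z - w)%C <> 0%C). { intros E. apply n. rewrite E. apply Cmod_0. }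
  intros E. assert (E2 : F z = F w).
  { assert (X : (F z - F w)%C = 0%C). { replace (F z - F w)%C with ((F z - F w) / (z - w) * (z - w))%C by (field; auto). rewrite E. ring. }
    replace (F z) with (F z - F w + F w)%C by ring. rewrite X. ring. }
  apply Inj in E2; auto. apply N. rewrite E2. ring.
Qed.

(** Supplies the constants of [log_ratio_bound], uniformly over pairs of points of the circle. They
    depend on [r] but not on [rho], so [rho] may later tend to 1. *)
Lemma diff_quot_circle_bounds (r : R) : 0 < r < 1 -> exists m M, 0 < m /\
  forall t u, 0 <= t <= 2 * PI -> 0 <= u <= 2 * PI ->
    m <= Cmod (diff_quot F F' (RtoC r * cis u) (RtoC r * cis t))%C ^ 2 <= M.
Proof.
  intros Hr.
  set (Q := fun t u => Cmod (diff_quot F F' (RtoC r * cis u) (RtoC r * cis t))%C ^ 2).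
  assert (Hc : forall t, Cmod (RtoC r * cis t)%C = r) by (intros; apply Cmod_circ; lra).
  assert (CQ : forall t u, continuity_2d_pt Q t u).
  { intros t u. apply continuity_2d_pt_of_continuous. unfold Q. apply continuous_Rsqr, continuous_Cmod.
    destruct (diff_quot_lip F F' r HF (proj2 Hr)) as [K [K0 HK]].
    assert (Cz : RRcont (fun p => RtoC r * cis (fst p))%C (t, u)) by cont.
    assert (Cw : RRcont (fun p => RtoC r * cis (snd p))%C (t, u)) by cont.
    apply continuous_eps. intros eps He.
    rewrite continuous_eps in Cz, Cw.
    assert (h : 0 < eps / (2 * (K + 1))) by (apply Rdiv_lt_0_compat; lra).
    generalize (filter_and _ _ (Cz _ h) (Cw _ h)). apply filter_imp. intros [t' u'] [A B]. cbn [fst snd] in *.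
    eapply Rle_lt_trans. apply HK; rewrite Hc; lra.
    apply Rle_lt_trans with (K * (2 * (eps / (2 * (K + 1))))). apply Rmult_le_compat_l; lra.
    replace (K * (2 * (eps / (2 * (K + 1))))) with (eps * (K / (K + 1))) by (field; lra).
    rewrite <- (Rmult_1_r eps) at 2. apply Rmult_lt_compat_l; auto.
    apply (Rmult_lt_reg_r (K + 1)). lra. unfold Rdiv. rewrite Rmult_assoc, Rinv_l; lra. }
  assert (PQ : forall t u, 0 < Q t u).
  { intros t u. unfold Q. apply pow_lt. apply Cmod_gt_0. apply diff_quot_neq_0; rewrite Hc; lra. }
  destruct (positive_min_2d Q 0 (2 * PI) CQ PQ) as [m [Hm Hm']].
  (* The upper bound is a positive minimum too, that of the inverse. *)
  destruct (positive_min_2d (fun t u => / Q t u) 0 (2 * PI)) as [m2 [Hm2 Hm2']].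
  intros t u. apply continuity_2d_pt_inv; auto. specialize (PQ t u). lra.
  intros t u. apply Rinv_0_lt_compat, PQ.
  exists m, (/ m2). split; auto. intros t u Ht Hu. split. now apply Hm'.
  change (Q t u <= / m2). rewrite <- (Rinv_inv (Q t u)). apply Rinv_le_contravar; auto.
Qed.

Hypothesis F0 : F 0%C = 0%C.
Hypothesis F'0 : F' 0%C = 1%C.

(* Neutral logarithmic energy of the charge cos t dt carried to the image of the circle of radius r by F:
   it splits into the energy of that charge on the circle itself and the contribution of log |diff_quot F|, which is
   harmonic in each variable, so that both are evaluated by the mean value property. *)
Lemma univalent_coef_bound (p p' : C -> C) (r : R) : hol p p' -> 0 < r < 1 ->
  (forall w, Cmod w < 1 -> w <> 0%C -> p w = ((F w - w) / (w * F w))%C) ->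
  r ^ 2 * fst (p' 0%C) <= 1.
Proof.
  intros Hp Hr Ep.
  destruct (diff_quot_circle_bounds r Hr) as [m [M [Hm HmM]]].
  assert (Hc : forall s t, 0 <= s -> Cmod (RtoC s * cis t)%C = s) by (intros; now apply Cmod_circ).
  set (C0 := / m + 1 + M).
  assert (C0pos : 0 <= C0).
  { pose proof PI_RGT_0. destruct (HmM 0 0). lra. lra. assert (0 < / m) by now apply Rinv_0_lt_compat. unfold C0; lra. }
  assert (Main : forall rho, 0 < rho < 1 -> r ^ 2 * fst (p' 0%C) <= rho + 2 * C0 * (1 - rho)).
  { intros rho Hrho. pose proof PI_RGT_0 as HPI.
    set (kappa := r ^ 2 / rho). set (s := kappa * (1 - rho) ^ 2).
    assert (Hk : 0 < kappa). { apply Rdiv_lt_0_compat; [apply pow_lt|]; lra. }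
    assert (Hs : 0 < s). { apply Rmult_lt_0_compat; auto. apply pow_lt. lra. }
    (* With this s, |z_t - z_u|^2 + s = kappa |1 - rho e^(i(u-t))|^2, the squared modulus of a function
       holomorphic in rho e^(iu); s / (|z_t - z_u|^2 + s) is a multiple of the Poisson kernel. *)
    set (g := fun t => 2 * PI * r * fst (p (RtoC r * cis t)%C) - 2 * PI * rho * cos t).
    (* [g] is twice the sum of the first coefficients of [ln |Q|] and [ln |q|], obtained below as
       [I1] and [I2]. [B] bounds the smoothing error: [C0 (1 - rho)^2] times the Poisson integral
       [2 PI / (1 - rho^2)]. *)
    set (B := C0 * (2 * PI * ((1 - rho) / (1 + rho)))).
    assert (Cp : forall t, continuous (fun t => fst (p (RtoC r * cis t)%C)) t).
    { intros t. apply continuous_fstC. apply (hol_circ_cont p p'); auto. lra. }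
    assert (X : RInt (fun t => cos t * g t) 0 (2 * PI) <= 2 * PI * B).
    { apply (energy_ineq (fun t => F (RtoC r * cis t)%C) s g B); auto.
      - intros t. apply (hol_circ_cont F F'); auto. lra.
      - intros t. unfold g. cont.
      - intros t Ht.
        set (w := (RtoC r * cis t)%C).
        set (Q := fun z => diff_quot F F' z w). set (Q' := C_derive Q).
        assert (Hw : Cmod w = r) by (apply Hc; lra).
        assert (HQ : hol Q Q') by (apply hol_diff_quot; auto; lra).
        assert (NQ : forall z, Cmod z < 1 -> Q z <> 0%C) by (intros; apply diff_quot_neq_0; auto; lra).
        set (q := fun z => (1 - cis (- t) * z)%C).
        assert (Nq : forall z, Cmod z < 1 -> q z <> 0%C).
        { intros z Hz E. assert (E' : (cis (- t) * z)%C = 1%C) by (replace (cis (- t) * z)%C with (1 - q z)%C by (unfold q; ring); rewrite E; ring).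
          apply (f_equal Cmod) in E'. rewrite Cmod_mult, Cmod_cis, Cmod_1 in E'. lra. }
        assert (Hq : hol q (fun z => 0 - (0 * z + cis (- t) * 1))%C).
        { apply (hol_minus (fun _ => RtoC 1) (fun _ => RtoC 0) (fun z => cis (- t) * z)%C). apply hol_const.
          apply (hol_mult (fun _ => cis (- t)) (fun _ => RtoC 0)). apply hol_const. apply hol_id. }
        pose proof (fourier_log Q Q' r HQ NQ Hr) as I1.
        pose proof (fourier_log q _ rho Hq Nq Hrho) as I2.
        assert (w0 : w <> 0%C) by (apply circ_neq_0; lra).
        assert (Fw : F w <> 0%C). { rewrite <- F0. intros E. apply w0. apply Inj; auto. lra. rewrite Cmod_0; lra. }
        assert (Z0 : Cmod 0 < 1) by (rewrite Cmod_0; lra).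
        assert (Q0 : (Q 0 * w)%C = F w).
        { unfold Q. pose proof (diff_quot_spec F F' 0 w) as E. rewrite F0 in E.
          replace (F w) with (- (0 - F w))%C by ring. rewrite E. ring. }
        (* The derivative of [F z - F w = Q z * (z - w)] at [z = 0], computed on both sides, using
           [F' 0 = 1]. *)
        assert (Q'0 : (Q' 0 * w)%C = (Q 0 - 1)%C).
        { assert (D1 : cder (fun z => F z - F w)%C 0 (1 - 0)%C).
          { rewrite <- F'0. apply cder_minus. apply HF; auto. apply cder_const. }
          assert (D2 : cder (fun z => F z - F w)%C 0 (Q' 0 * (0 - w) + Q 0 * (1 - 0))%C).
          { apply cder_ext_loc with (fun z => Q z * (z - w))%C 1. lra.
            intros z _. symmetry. apply diff_quot_spec.
            apply (cder_mult Q (fun z => z - w)%C). apply HQ; auto. apply cder_minus. apply cder_id. apply cder_const. }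
          apply is_C_derive_unique in D1. apply is_C_derive_unique in D2. rewrite D1 in D2.
          replace (Q' 0 * w)%C with (Q 0 - (Q' 0 * (0 - w) + Q 0 * (1 - 0)))%C by ring. rewrite <- D2. ring. }
        (* Since [Q 0 = F w / w], the quotient is [(Q 0 - 1) / (w Q 0) = 1 / w - 1 / F w]. As a
           function of [w] this is again holomorphic, which allows a second Fourier coefficient to
           be taken. *)
        assert (P1 : (Q' 0 / Q 0)%C = p w).
        { rewrite Ep by (auto; lra).
          assert (Q 0%C <> 0%C) by auto.
          replace (Q' 0%C) with (Q' 0 * w / w)%C by (field; auto). rewrite Q'0.
          rewrite <- Q0. field. auto. }
        assert (P2 : fst ((0 - (0 * 0 + cis (- t) * 1)) / q 0)%C = - cos t).
        { replace ((0 - (0 * 0 + cis (- t) * 1)) / q 0)%C with (- cis (- t))%C.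
          cbn. apply f_equal. apply cos_neg.
          unfold q. replace (1 - cis (- t) * 0)%C with (RtoC 1) by ring. field. }
        cbv beta in I2. rewrite P1 in I1. rewrite P2 in I2.
        (* The smoothed kernel minus its replacement, a constant plus two harmonic terms whose first
           coefficients are known. *)
        set (Er := fun u => ln (Cmod (F w - F (RtoC r * cis u))%C ^ 2 + s) - (ln kappa + 2 * ln (Cmod (q (RtoC rho * cis u)%C)) + 2 * ln (Cmod (Q (RtoC r * cis u)%C)))).
        set (y := fun u => (1 - rho) ^ 2 * / Cmod (q (RtoC rho * cis u)%C) ^ 2).
        assert (Ebd : forall u, 0 <= u <= 2 * PI -> Rabs (Er u) <= C0 * y u).
        { intros u Hu. set (x := Cmod (w - RtoC r * cis u)%C ^ 2).
          assert (Hx : 0 <= x) by apply pow2_ge_0.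
          assert (xs : x + s = kappa * Cmod (q (RtoC rho * cis u)%C) ^ 2).
          { unfold x, s, kappa, w, q. apply circle_dist_smoothed. lra. }
          assert (q0 : 0 < Cmod (q (RtoC rho * cis u)%C)). { apply Cmod_gt_0. apply Nq. rewrite Hc; lra. }
          assert (Qp : 0 < Cmod (Q (RtoC r * cis u)%C)). { apply Cmod_gt_0. apply NQ. rewrite Hc; lra. }
          assert (Gx : Cmod (F w - F (RtoC r * cis u))%C ^ 2 = Cmod (Q (RtoC r * cis u)%C) ^ 2 * x).
          { unfold x. rewrite <- Rpow_mult_distr, <- Cmod_mult. f_equal.
            rewrite <- (Cmod_opp (F w - F (RtoC r * cis u))%C).
            rewrite <- (Cmod_opp (Q _ * _)%C). f_equal.
            replace (- (F w - F (RtoC r * cis u)))%C with (F (RtoC r * cis u) - F w)%C by ring.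
            rewrite (diff_quot_spec F F'). fold (Q (RtoC r * cis u)%C). ring. }
          unfold Er. rewrite Gx.
          replace (ln kappa + 2 * ln (Cmod (q (RtoC rho * cis u)%C)) + 2 * ln (Cmod (Q (RtoC r * cis u)%C)))
            with (ln (x + s) + ln (Cmod (Q (RtoC r * cis u)%C) ^ 2)).
          2:{ rewrite xs, ln_mult by (auto; apply pow_lt; auto).
              rewrite !ln_sqr by auto. ring. }
          replace (y u) with (s / (x + s)).
          2:{ rewrite xs. unfold y, s. field. split; lra. }
          unfold Rminus at 1. rewrite Ropp_plus_distr, <- Rplus_assoc.
          apply (log_ratio_bound x s (Cmod (Q (RtoC r * cis u)%C) ^ 2) m M); auto.
          apply HmM; auto. }
        assert (clnC : forall f : R -> C, (forall u, ccont f u) -> (forall u, f u <> 0%C) -> forall u, continuous (fun u => ln (Cmod (f u))) u).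
        { intros f Cf Nf u. apply (continuous_Rcomp (fun u => Cmod (f u)) ln). apply continuous_Cmod, Cf.
          apply derivable_continuous_pt. eexists. apply derivable_pt_lim_ln. apply Cmod_gt_0, Nf. }
        assert (c1 : forall u, continuous (fun u => ln (Cmod (q (RtoC rho * cis u)%C))) u).
        { apply clnC. intros u. apply (hol_circ_cont q _ rho u Hq). lra. intros u. apply Nq. rewrite Hc; lra. }
        assert (c2 : forall u, continuous (fun u => ln (Cmod (Q (RtoC r * cis u)%C))) u).
        { apply clnC. intros u. apply (hol_circ_cont Q _ r u HQ). lra. intros u. apply NQ. rewrite Hc; lra. }
        assert (c3 : forall u, continuous (fun u => ln (Cmod (F w - F (RtoC r * cis u))%C ^ 2 + s)) u).
        { intros u. apply (continuous_Rcomp (fun u => Cmod (F w - F (RtoC r * cis u))%C ^ 2 + s) ln).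
          apply continuous_Rplus; [|apply continuous_const]. apply continuous_Rsqr, continuous_Cmod, continuous_Cminus. apply continuous_const.
          apply (hol_circ_cont F F'); auto; lra.
          apply derivable_continuous_pt. eexists. apply derivable_pt_lim_ln. pose proof (pow2_ge_0 (Cmod (F w - F (RtoC r * cis u))%C)). lra. }
        assert (c4 : forall u, continuous Er u). { intros u. unfold Er. cont. }
        assert (c5 : forall u, continuous y u).
        { intros u. unfold y. apply continuous_Rmult. apply continuous_const.
          apply (continuous_comp (fun u => Cmod (q (RtoC rho * cis u)%C) ^ 2) Rinv).
          apply continuous_Rsqr, continuous_Cmod. apply (hol_circ_cont q _ rho u Hq). lra.
          apply continuous_Rinv. apply pow_nonzero. apply Rgt_not_eq. apply Cmod_gt_0. apply Nq. rewrite Hc; lra. }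
        assert (Split : RInt (fun u => cos u * ln (Cmod (F w - F (RtoC r * cis u))%C ^ 2 + s)) 0 (2 * PI) - g t = RInt (fun u => cos u * Er u) 0 (2 * PI)).
        { assert (R1 := is_RInt_of_RInt cos 0 (2 * PI) _ ltac:(intros; cont) RInt_cos_2PI).
          assert (R2 := is_RInt_cos_mult _ 0 (2 * PI) _ c1 I2).
          assert (R3 := is_RInt_cos_mult _ 0 (2 * PI) _ c2 I1).
          assert (R4 := is_RInt_cos_mult Er 0 (2 * PI) _ c4 eq_refl).
          apply (is_RInt_scal (V := R_NormedModule) _ _ _ (ln kappa)) in R1.
          apply (is_RInt_scal (V := R_NormedModule) _ _ _ 2) in R2.
          apply (is_RInt_scal (V := R_NormedModule) _ _ _ 2) in R3.
          pose proof (is_RInt_plus (V := R_NormedModule) _ _ _ _ _ _ (is_RInt_plus (V := R_NormedModule) _ _ _ _ _ _ R1 R2) (is_RInt_plus (V := R_NormedModule) _ _ _ _ _ _ R3 R4)) as R5.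
          apply (is_RInt_ext (V := R_NormedModule) _ (fun u => cos u * ln (Cmod (F w - F (RtoC r * cis u))%C ^ 2 + s))) in R5.
          2:{ intros u _. unfold Er, plus, scal; cbn -[ln pow cos]. unfold mult; cbn -[ln pow cos]. ring. }
          apply (is_RInt_unique (V := R_CompleteNormedModule)) in R5. rewrite R5. unfold g, w, plus, scal; cbn -[RInt cos pow]. unfold mult; cbn -[RInt cos pow]. ring. }
        rewrite Split.
        assert (Iy : RInt (fun u => C0 * y u) 0 (2 * PI) = B).
        { unfold y. pose proof (poisson_int rho t Hrho) as Po.
          assert (Co : forall u, continuous (fun u => / Cmod (1 - cis (- t) * (RtoC rho * cis u))%C ^ 2) u).
          { intros u. apply (continuous_comp (fun u => Cmod (q (RtoC rho * cis u)%C) ^ 2) Rinv).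
            apply continuous_Rsqr, continuous_Cmod. apply (hol_circ_cont q _ rho u Hq). lra.
            apply continuous_Rinv. apply pow_nonzero. apply Rgt_not_eq. apply Cmod_gt_0. apply Nq. rewrite Hc; lra. }
          assert (R1 := is_RInt_of_RInt _ 0 (2 * PI) _ Co Po).
          apply (is_RInt_scal (V := R_NormedModule) _ _ _ (C0 * (1 - rho) ^ 2)) in R1.
          apply (is_RInt_ext (V := R_NormedModule) _ (fun u => C0 * ((1 - rho) ^ 2 * / Cmod (q (RtoC rho * cis u)%C) ^ 2))) in R1.
          2:{ intros u _. unfold scal; cbn -[pow]. unfold mult; cbn -[pow]. fold (q (RtoC rho * cis u)%C). ring. }
          apply (is_RInt_unique (V := R_CompleteNormedModule)) in R1. rewrite R1. unfold B, scal; cbn -[pow]. unfold mult; cbn -[pow]. field. split; nra. }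
        rewrite <- Iy.
        assert (Hab : 0 <= 2 * PI) by lra.
        apply (norm_RInt_le (V := R_NormedModule) (fun u => cos u * Er u) (fun u => C0 * y u) 0 (2 * PI)); auto.
        + intros u Hu. change (Rabs (cos u * Er u) <= C0 * y u). rewrite Rabs_mult. specialize (Ebd u Hu).
          assert (Rabs (cos u) <= 1) by (apply Rabs_le; pose proof (COS_bound u); lra). pose proof (Rabs_pos (Er u)). nra.
        + apply (RInt_correct (V := R_CompleteNormedModule)). now apply ex_RInt_cos_mult.
        + apply (RInt_correct (V := R_CompleteNormedModule)). apply ex_RInt_contR. intros u. cont. }
    (* The second coefficient, now in [t]: the real part of [p] contributes [PI r] times that of
       [p' 0], and the cosine in [g] contributes [PI]. *)
    assert (Y : RInt (fun t => cos t * g t) 0 (2 * PI) = 2 * PI * (PI * (r ^ 2 * fst (p' 0%C) - rho))).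
    { assert (R1 := is_RInt_cos_mult _ 0 (2 * PI) _ Cp (fourier_re p p' r Hp Hr)).
      assert (R2 := is_RInt_cos_mult cos 0 (2 * PI) _ ltac:(intros; cont) int_cos2).
      apply (is_RInt_scal (V := R_NormedModule) _ _ _ (2 * PI * r)) in R1.
      apply (is_RInt_scal (V := R_NormedModule) _ _ _ (2 * PI * rho)) in R2.
      pose proof (is_RInt_minus (V := R_NormedModule) _ _ _ _ _ _ R1 R2) as R5.
      apply (is_RInt_ext (V := R_NormedModule) _ (fun t => cos t * g t)) in R5.
      2:{ intros u _. unfold g, minus, plus, opp, scal; cbn -[PI cos]. unfold mult; cbn -[PI cos]. ring. }
      apply (is_RInt_unique (V := R_CompleteNormedModule)) in R5. rewrite R5. unfold minus, plus, opp, scal; cbn -[PI]. unfold mult; cbn -[PI]. ring. }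
    rewrite Y in X. apply Rmult_le_reg_l in X; [|lra]. unfold B in X.
    replace (C0 * (2 * PI * ((1 - rho) / (1 + rho)))) with (PI * (2 * C0 * ((1 - rho) / (1 + rho)))) in X by ring.
    apply Rmult_le_reg_l in X; [|lra].
    assert ((1 - rho) / (1 + rho) <= 1 - rho).
    { apply (Rmult_le_reg_r (1 + rho)). lra. unfold Rdiv. rewrite Rmult_assoc, Rinv_l by lra. nra. }
    nra. }
  (* Passage to the limit [rho -> 1] in [Main]: an excess [d] over 1 is contradicted at
     [rho = 1 - e], with [e] small against [d / (C0 + 1)]. *)
  apply Rnot_lt_le. intros N. set (d := r ^ 2 * fst (p' 0%C) - 1) in *.
  assert (Hd : 0 < d) by (unfold d; lra).
  set (e := Rmin (1 / 2) (d / (4 * (C0 + 1)))).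
  assert (He : 0 < e). { apply Rmin_glb_lt. lra. apply Rdiv_lt_0_compat; lra. }
  assert (He1 : e <= 1 / 2) by apply Rmin_l.
  assert (He2 : e * (4 * (C0 + 1)) <= d).
  { assert (e <= d / (4 * (C0 + 1))) by apply Rmin_r. apply (Rmult_le_compat_r (4 * (C0 + 1))) in H; [|lra].
    unfold Rdiv in H. rewrite Rmult_assoc, Rinv_l in H; lra. }
  specialize (Main (1 - e) ltac:(lra)). unfold d in *. nra.
Qed.

End Univalent.

Lemma Cmult_integral_C (a b : C) : (a * b)%C = 0%C -> a = 0%C \/ b = 0%C.
Proof.
  intros H. destruct (Req_EM_T (Cmod a) 0) as [e|n]. left; now apply Cmod_eq_0.
  right. assert (Na : a <> 0%C) by (intros E; apply n; rewrite E; apply Cmod_0).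
  replace b with (/ a * (a * b))%C by (field; auto). rewrite H. ring.
Qed.

Lemma Cexp_minus (z w : C) : Cexp (z - w)%C = (Cexp z / Cexp w)%C.
Proof. unfold Cminus, Cdiv. now rewrite Cexp_plus, Cexp_opp. Qed.

Lemma half_double_0 (a : C) : a = (- a)%C -> a = 0%C.
Proof.
  intros H. replace a with (/ 2 * (a - - a))%C by field. rewrite <- H. ring.
Qed.

Lemma hol_square : hol (fun z => z * z)%C (fun z => 1 * z + z * 1)%C.
Proof. apply hol_mult; apply hol_id. Qed.

Lemma Cmod_square_lt (z : C) : Cmod z < 1 -> Cmod (z * z)%C < 1.
Proof. intros H. rewrite Cmod_mult. pose proof (Cmod_ge_0 z). nra. Qed.

(* Bieberbach's inequality, from the odd square root z * sqrt (k (z^2)) of z^2 * k (z^2). *)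
Lemma second_coef_bound (k k' : C -> C) : hol k k' -> k 0%C = 1%C ->
  (forall z w, Cmod z < 1 -> Cmod w < 1 -> (z * k z)%C = (w * k w)%C -> z = w) ->
  (forall z, Cmod z < 1 -> (k z + z * k' z)%C <> 0%C) ->
  fst (k' 0%C) <= 2.
Proof.
  intros Hk k0 Inj Nd.
  assert (Z0 : Cmod 0 < 1) by (rewrite Cmod_0; lra).
  assert (Nk : forall z, Cmod z < 1 -> k z <> 0%C).
  { intros z Hz E. assert (z = 0%C). { apply Inj; auto. rewrite E. ring. }
    subst z. rewrite k0 in E. injection E. lra. }
  destruct (log_branch k k' Hk Nk) as [l [Hl [l0 El]]].
  set (E := fun z => Cexp (/ 2 * l z)%C).
  set (E' := fun z => (E z * (0 * l z + / 2 * (k' z / k z)))%C).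
  assert (HE : hol E E').
  { apply (hol_exp (fun z => / 2 * l z)%C). apply (hol_mult (fun _ => / 2)%C (fun _ => RtoC 0)); auto. apply hol_const. }
  assert (NE : forall z, E z <> 0%C) by (intros; apply Cexp_neq_0).
  assert (EE : forall z, Cmod z < 1 -> (E z * E z)%C = k z).
  { intros z Hz. unfold E. rewrite <- Cexp_plus, El, k0 by auto. rewrite Cmult_1_l. f_equal. field. }
  assert (E0 : E 0%C = 1%C). { unfold E. rewrite l0. rewrite <- Cexp_0. f_equal. ring. }
  set (F := fun z => (z * E (z * z))%C).
  set (F' := fun z => (1 * E (z * z) + z * (E' (z * z) * (1 * z + z * 1)))%C).
  assert (HF : hol F F').
  { apply (hol_mult (fun z => z) (fun _ => RtoC 1) (fun z => E (z * z)%C)). apply hol_id.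
    apply (hol_comp E E' (fun z => z * z)%C). apply Cmod_square_lt. auto. apply hol_square. }
  assert (InjF : forall z w, Cmod z < 1 -> Cmod w < 1 -> F z = F w -> z = w).
  { intros z w Hz Hw H.
    (* Squaring returns to the injective function at [z^2] and [w^2], which leaves [z = w] or
       [z = - w]. In the second case oddness gives [F w = - F w], so [F w = 0] and both points are
       0. *)
    assert (S : (z * z)%C = (w * w)%C).
    { apply Inj; try now apply Cmod_square_lt. rewrite <- !EE by now apply Cmod_square_lt.
      transitivity (F z * F z)%C. unfold F; ring. rewrite H. unfold F; ring. }
    assert (P : ((z - w) * (z + w))%C = 0%C). { replace ((z - w) * (z + w))%C with (z * z - w * w)%C by ring. rewrite S. ring. }
    apply Cmult_integral_C in P as [P|P].
    - replace z with (z - w + w)%C by ring. rewrite P. ring.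
    - assert (zw : z = (- w)%C). { replace z with (z + w - w)%C by ring. rewrite P. ring. }
      assert (Fw : F w = 0%C).
      { apply half_double_0. rewrite <- H at 1. rewrite zw. unfold F. replace (- w * - w)%C with (w * w)%C by ring. ring. }
      apply Cmult_integral_C in Fw as [Fw|Fw]. rewrite zw, Fw. ring. now apply NE in Fw. }
  assert (NF : forall z, Cmod z < 1 -> F' z <> 0%C).
  { intros z Hz H. apply (Nd (z * z)%C). now apply Cmod_square_lt.
    assert (Hs := Cmod_square_lt z Hz).
    replace (k (z * z) + z * z * k' (z * z))%C with (E (z * z) * F' z)%C. rewrite H; ring.
    unfold F', E'. rewrite <- (EE (z * z)%C) by auto. field. auto. }
  (* For [F w = w E (w^2)] one has [1 / w - 1 / F w = G (w^2) / w]. As [G 0 = 0], [G] is divisible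
     by its variable with quotient [m], so the function to use is [p w = w m (w^2)], and
     [p' 0 = G' 0 = k' 0 / 2]. *)
  set (G := fun z => (1 - / E z)%C). set (G' := fun z => (0 - - E' z / (E z * E z))%C).
  assert (HG : hol G G').
  { apply (hol_minus (fun _ => RtoC 1) (fun _ => RtoC 0)). apply hol_const. apply hol_inv; auto. }
  assert (G0 : G 0%C = 0%C). { unfold G. rewrite E0. field. }
  set (m := fun z => diff_quot G G' z 0).
  assert (Hm : hol m (C_derive m)) by now apply hol_diff_quot.
  assert (Gm : forall z, G z = (m z * z)%C).
  { intros z. pose proof (diff_quot_spec G G' z 0) as S. rewrite G0 in S. replace (G z) with (G z - 0)%C by ring. rewrite S. unfold m. ring. }
  set (p := fun w => (w * m (w * w))%C).
  set (p' := fun w => (1 * m (w * w) + w * (C_derive m (w * w) * (1 * w + w * 1)))%C).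
  assert (Hp : hol p p').
  { apply (hol_mult (fun z => z) (fun _ => RtoC 1) (fun z => m (z * z)%C)). apply hol_id.
    apply (hol_comp m (C_derive m) (fun z => z * z)%C). apply Cmod_square_lt. auto. apply hol_square. }
  assert (P0 : p' 0%C = (k' 0 / 2)%C).
  { unfold p'. replace (0 * 0)%C with (RtoC 0) by ring. unfold m at 1. rewrite diff_quot_diag.
    unfold G', E'. rewrite E0, k0. field. }
  assert (B : forall r, 0 < r < 1 -> r ^ 2 * fst (p' 0%C) <= 1).
  { intros r Hr. apply (univalent_coef_bound F F' HF InjF NF) with (p := p); auto.
    - unfold F. ring.
    - unfold F'. replace (0 * 0)%C with (RtoC 0) by ring. rewrite E0. ring.
    - intros w Hw w0. unfold p, F. specialize (Gm (w * w)%C). unfold G in Gm.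
      replace (w * m (w * w))%C with ((m (w * w) * (w * w)) / w)%C by (field; auto).
      rewrite <- Gm. field. auto. }
  assert (Hh : fst (p' 0%C) = fst (k' 0%C) / 2). { rewrite P0. replace (k' 0 / 2)%C with (RtoC (/ 2) * k' 0)%C. cbn. field. rewrite RtoC_inv. field. lra. }
  rewrite Hh in B. apply Rnot_lt_le. intros N.
  set (d := fst (k' 0%C) / 2) in *. assert (Hd : 1 < d) by (unfold d; lra).
  assert (hd : 0 < / d < 1). { split. apply Rinv_0_lt_compat; lra. rewrite <- Rinv_1. apply Rinv_lt_contravar; lra. }
  (* This radius is the arithmetic mean of 1 and [/ d], hence larger than their geometric mean, so
     [r^2 d > 1]. *)
  specialize (B (1 - (1 - / d) / 2) ltac:(lra)).
  assert (d * / d = 1) by (field; lra). set (e := / d) in *. nra.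
Qed.

Section KoebeTransform.

Variables (H L L' : C -> C).
Hypothesis HH : hol H (fun z => Cexp (L z)).
Hypothesis HL : hol L L'.
Hypothesis Inj : forall z w, Cmod z < 1 -> Cmod w < 1 -> H z = H w -> z = w.

(** The identity by which the Moebius map used for the Koebe transform sends the disk into
    itself. *)
Lemma moebius_gap (a z : C) :
  Cmod (1 + Cconj a * z)%C ^ 2 - Cmod (z + a)%C ^ 2 = (1 - Cmod a ^ 2) * (1 - Cmod z ^ 2).
Proof. rewrite !Cmod2_alt. destruct a as [a1 a2], z as [z1 z2]. cbn. ring. Qed.

(** The Koebe transform is composed with the rotation by [u], because the coefficient inequality
    only controls a real part; varying [u] will recover the modulus. The second coefficient of the
    transform is half of the expression on the left. *)
Lemma pre_schwarzian_re_bound (a u : C) : Cmod a < 1 -> Cmod u = 1 ->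
  fst (u * ((1 - Cmod a ^ 2)%R * L' a - 2 * Cconj a))%C <= 4.
Proof.
  intros Ha Hu.
  assert (Z0 : Cmod 0 < 1) by (rewrite Cmod_0; lra).
  assert (u0 : u <> 0%C) by (apply Cmod_gt_0; lra).
  pose proof (Cmod_ge_0 a) as Ha0.
  set (s := RtoC (1 - Cmod a ^ 2)).
  assert (Ha2 : 0 < 1 - Cmod a ^ 2) by nra.
  assert (s0 : s <> 0%C) by (apply RtoC_neq_0; lra).
  assert (Es : s = (1 - a * Cconj a)%C).
  { unfold s. rewrite RtoC_minus, <- Cmod2_conj. reflexivity. }
  set (den := fun z => (1 + Cconj a * (u * z))%C).
  assert (Nden : forall z, Cmod z < 1 -> den z <> 0%C).
  { intros z Hz E. assert (M : (Cconj a * (u * z))%C = (- (1))%C).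
    { replace (Cconj a * (u * z))%C with (den z - 1)%C by (unfold den; ring). rewrite E. ring. }
    apply (f_equal Cmod) in M. rewrite !Cmod_mult, Cmod_conj, Hu, Cmod_opp, Cmod_1, Rmult_1_l in M.
    pose proof (Cmod_ge_0 z). nra. }
  set (phi := fun z => ((u * z + a) * / den z)%C).
  assert (Dphi : forall z, Cmod z < 1 -> Cmod (phi z) < 1).
  { intros z Hz. unfold phi. specialize (Nden z Hz). rewrite Cmod_mult, Cmod_inv by auto.
    assert (Dp : 0 < Cmod (den z)) by now apply Cmod_gt_0.
    apply (Rmult_lt_reg_r (Cmod (den z))); auto. rewrite Rmult_assoc, Rinv_l, Rmult_1_r, Rmult_1_l by lra.
    pose proof (moebius_gap a (u * z)) as Gp. rewrite (Cmod_mult u z), Hu, Rmult_1_l in Gp. fold (den z) in Gp.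
    pose proof (Cmod_ge_0 z). assert (0 < (1 - Cmod a ^ 2) * (1 - Cmod z ^ 2)) by (apply Rmult_lt_0_compat; nra).
    pose proof (Cmod_ge_0 (u * z + a)). nra. }
  assert (Hden : hol den (fun _ => Cconj a * u)%C).
  { apply hol_ext with (fun z => 1 + Cconj a * (u * z))%C (fun z => 0 + (0 * (u * z) + Cconj a * (0 * z + u * 1)))%C.
    reflexivity. intros; ring.
    apply (hol_plus (fun _ => RtoC 1) (fun _ => RtoC 0)). apply hol_const.
    apply (hol_mult (fun _ => Cconj a) (fun _ => RtoC 0)). apply hol_const.
    apply (hol_mult (fun _ => u) (fun _ => RtoC 0)). apply hol_const. apply hol_id. }
  assert (Hiden : hol (fun z => / den z)%C (fun z => - (Cconj a * u) / (den z * den z))%C) by now apply (hol_inv den).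
  set (phi' := fun z => (u * s / (den z * den z))%C).
  assert (Hphi : hol phi phi').
  { apply hol_ext with (fun z => (u * z + a) * / den z)%C (fun z => ((0 * z + u * 1) + 0) * / den z + (u * z + a) * (- (Cconj a * u) / (den z * den z)))%C.
    reflexivity. intros z Hz. specialize (Nden z Hz). unfold phi'. rewrite Es.
    replace (((0 * z + u * 1) + 0) * / den z + (u * z + a) * (- (Cconj a * u) / (den z * den z)))%C with
      ((u * den z - (u * z + a) * (Cconj a * u)) / (den z * den z))%C by (field; auto).
    f_equal. unfold den. ring.
    apply hol_mult; auto. apply (hol_plus (fun z => u * z)%C _ (fun _ => a)).
    apply (hol_mult (fun _ => u) (fun _ => RtoC 0)). apply hol_const. apply hol_id. apply hol_const. }
  assert (Iphi : forall z w, Cmod z < 1 -> Cmod w < 1 -> phi z = phi w -> z = w).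
  { intros z w Hz Hw E. pose proof (Nden z Hz). pose proof (Nden w Hw). unfold phi in E.
    assert (X : ((u * z + a) * den w - (u * w + a) * den z)%C = 0%C).
    { replace ((u * z + a) * den w)%C with ((u * z + a) * / den z * (den z * den w))%C by (field; auto).
      rewrite E. field. auto. }
    assert (Y : ((u * s) * (z - w))%C = 0%C). { rewrite <- X, Es. unfold den. ring. }
    apply Cmult_integral_C in Y as [Y|Y]. apply Cmult_integral_C in Y as [Y|Y]; contradiction.
    replace z with (z - w + w)%C by ring. rewrite Y. ring. }
  assert (phi0 : phi 0%C = a). { unfold phi, den. replace (1 + Cconj a * (u * 0))%C with (RtoC 1) by ring. field. }
  assert (den0 : den 0%C = 1%C) by (unfold den; ring).
  (* The inverse of the derivative of [H (phi z)] at 0, since [phi' 0 = u s] and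
     [H' a = exp (L a)]. *)
  set (c := (/ (u * s * Cexp (L a)))%C).
  assert (Nc : (u * s * Cexp (L a))%C <> 0%C). { repeat apply Cmult_neq_0; auto. apply Cexp_neq_0. }
  set (f := fun z => (c * (H (phi z) - H a))%C).
  (* In this exponential form the derivative visibly does not vanish, and differentiating it once
     more brings in [L']. *)
  set (f' := fun z => (Cexp (L (phi z) - L a) * (/ den z * / den z))%C).
  assert (Hf : hol f f').
  { apply hol_ext with f (fun z => 0 * (H (phi z) - H a) + c * (Cexp (L (phi z)) * phi' z - 0))%C. reflexivity.
    intros z Hz. specialize (Nden z Hz). unfold f', phi', c. rewrite Cexp_minus.
    field. repeat split; auto. apply Cexp_neq_0.
    apply (hol_mult (fun _ => c) (fun _ => RtoC 0)). apply hol_const.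
    apply (hol_minus (fun z => H (phi z)) _ (fun _ => H a)).
    apply (hol_comp H (fun z => Cexp (L z)) phi phi'); auto. apply hol_const. }
  assert (f0 : f 0%C = 0%C). { unfold f. rewrite phi0. ring. }
  assert (f'0 : f' 0%C = 1%C). { unfold f'. rewrite phi0, den0. replace (L a - L a)%C with (RtoC 0) by ring. rewrite Cexp_0. field. }
  assert (Nf' : forall z, Cmod z < 1 -> f' z <> 0%C).
  { intros z Hz E. unfold f' in E. apply Cmult_integral_C in E as [E|E]. now apply Cexp_neq_0 in E.
    specialize (Nden z Hz). apply Cmult_integral_C in E as [E|E];
    (assert (X : (den z * / den z)%C = 0%C) by (rewrite E; ring); rewrite Cinv_r in X by auto; injection X; lra). }
  set (k := fun z => diff_quot f f' z 0).
  assert (Hk : hol k (C_derive k)) by now apply hol_diff_quot.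
  assert (fk : forall z, f z = (z * k z)%C).
  { intros z. pose proof (diff_quot_spec f f' z 0) as S. rewrite f0 in S. replace (f z) with (f z - 0)%C by ring. rewrite S. unfold k. ring. }
  assert (f'k : forall z, Cmod z < 1 -> f' z = (k z + z * C_derive k z)%C).
  { intros z Hz. rewrite <- (is_C_derive_unique f z (f' z)) by now apply Hf.
    apply is_C_derive_unique. apply cder_ext_loc with (fun z => z * k z)%C 1. lra. intros; now rewrite fk.
    eapply cder_eq. apply cder_mult. apply cder_id. apply Hk; auto. cbv beta. ring. }
  assert (B : fst (C_derive k 0%C) <= 2).
  { apply (second_coef_bound k (C_derive k)); auto.
    - unfold k. now rewrite diff_quot_diag.
    - intros z w Hz Hw E. rewrite <- !fk in E. apply Iphi; auto. apply Inj; auto.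
      unfold f in E. assert (X : (c * (H (phi z) - H (phi w)))%C = 0%C).
      { replace (c * (H (phi z) - H (phi w)))%C with (c * (H (phi z) - H a) - c * (H (phi w) - H a))%C by ring. rewrite E. ring. }
      apply Cmult_integral_C in X as [X|X].
      assert (Y : (u * s * Cexp (L a) * c)%C = 0%C) by (rewrite X; ring). unfold c in Y. rewrite Cinv_r in Y by auto. injection Y; lra.
      replace (H (phi z)) with (H (phi z) - H (phi w) + H (phi w))%C by ring. rewrite X. ring.
    - intros z Hz. rewrite <- f'k by auto. auto. }
  (* Both sides are f'' (0). *)
  assert (K2 : (2 * C_derive k 0)%C = (u * (s * L' a - 2 * Cconj a))%C).
  { assert (D1 : cder f' 0 (2 * C_derive k 0)%C).
    { apply cder_ext_loc with (fun z => k z + z * C_derive k z)%C 1. lra.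
      intros z Hz. symmetry. apply f'k. now replace (z - 0)%C with z in Hz by ring.
      pose proof (hol_deriv k _ Hk) as Hk2.
      eapply cder_eq. apply cder_plus. apply Hk; auto. apply cder_mult. apply cder_id. apply Hk2; auto. cbv beta. ring. }
    assert (D2 : exists f2, hol f' f2 /\ f2 0%C = (u * (s * L' a - 2 * Cconj a))%C).
    { eexists. split.
      apply (hol_mult (fun z => Cexp (L (phi z) - L a)%C) (fun z => Cexp (L (phi z) - L a) * (L' (phi z) * phi' z - 0))%C (fun z => / den z * / den z)%C).
      apply (hol_exp (fun z => L (phi z) - L a)%C). apply (hol_minus (fun z => L (phi z)) _ (fun _ => L a)). apply (hol_comp L L' phi phi'); auto. apply hol_const.
      apply hol_mult; exact Hiden.
      cbv beta. unfold phi'. rewrite phi0, den0. replace (L a - L a)%C with (RtoC 0) by ring. rewrite Cexp_0. field. }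
    destruct D2 as [f2 [Hf2 E2]]. rewrite <- E2.
    apply is_C_derive_unique in D1. rewrite <- D1. apply is_C_derive_unique. apply Hf2; auto. }
  fold s. rewrite <- K2. cbn. cbn in B. lra.
Qed.

(** The rotation [conj b / |b|] turns [b] into [|b|]; for [b = 0] there is nothing to rotate. *)
Lemma pre_schwarzian_bound (a : C) : Cmod a < 1 -> Cmod ((1 - Cmod a ^ 2)%R * L' a - 2 * Cconj a)%C <= 4.
Proof.
  intros Ha. set (b := ((1 - Cmod a ^ 2)%R * L' a - 2 * Cconj a)%C).
  destruct (Req_EM_T (Cmod b) 0) as [e|n]. rewrite e; lra.
  pose proof (Cmod_ge_0 b).
  assert (nb : RtoC (Cmod b) <> 0%C) by now apply RtoC_neq_0.
  pose proof (pre_schwarzian_re_bound a (Cconj b / RtoC (Cmod b))%C Ha) as K. fold b in K.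
  replace (Cconj b / RtoC (Cmod b) * b)%C with (RtoC (Cmod b)) in K.
  apply K. rewrite Cmod_div, Cmod_conj, Cmod_R, Rabs_pos_eq by (auto; lra). field. auto.
  replace (Cconj b / RtoC (Cmod b) * b)%C with ((b * Cconj b) / RtoC (Cmod b))%C by (field; auto).
  rewrite <- Cmod2_conj. rewrite RtoC_pow. field. auto.
Qed.

End KoebeTransform.

(** * Distortion *)

Lemma analytic_cder (F : C -> C) (z : C) : analytic_on_disk F -> Cmod z < 1 -> cder F z (C_derive F z).
Proof. intros HF Hz. apply C_derive_correct; [exact z|]. apply HF. exact Hz. Qed.

Lemma hol_analytic (F F' : C -> C) : hol F F' -> analytic_on_disk F.
Proof. intros HF z Hz. exists (F' z). apply HF. exact Hz. Qed.

(** The class only asks for complex differentiability. [H' = exp L] is continuous because [L] is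
    differentiable; Cauchy's formula then makes [H''] continuous, and [L' = H'' / H'] follows. *)
Lemma S1_log_hol (H L : C -> C) : S1 H -> is_log_branch (C_derive H) L ->
  hol H (fun z => Cexp (L z)) /\ hol L (C_derive L).
Proof.
  intros [AH _] [AL [_ EL]].
  assert (HH : hol H (fun z => Cexp (L z))).
  { intros z Hz. split. rewrite EL by exact Hz. now apply analytic_cder.
    apply continuous_Cexp. eapply cder_continuous. now apply analytic_cder. }
  split; auto. intros z Hz. split. now apply analytic_cder.
  pose proof (hol_deriv _ _ HH) as H2.
  destruct (disk_open z 1 Hz) as [A B].
  apply (ccont_ext_loc (fun z => C_derive (fun z => Cexp (L z)) z / Cexp (L z))%C _ z (1 - Cmod z)); auto.
  - intros w Hw. specialize (B w Hw).
    assert (E : C_derive (fun z => Cexp (L z)) w = (Cexp (L w) * C_derive L w)%C).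
    { apply is_C_derive_unique. apply (cder_comp Cexp L). apply cder_Cexp. now apply analytic_cder. }
    rewrite E. field. apply Cexp_neq_0.
  - apply continuous_Cdiv.
    destruct (H2 z Hz) as [D _]. eapply cder_continuous. apply (hol_deriv _ _ H2). exact Hz.
    apply continuous_Cexp. eapply cder_continuous. now apply analytic_cder. apply Cexp_neq_0.
Qed.

(** On the ray through [z] the derivative of the real part of [L] lies between
    [(2 t - 4) / (1 - t^2)] and [(2 t + 4) / (1 - t^2)]. These are the derivatives of
    [ln (1 - t) - 3 ln (1 + t)] and [ln (1 + t) - 3 ln (1 - t)], and all three functions vanish at
    0. *)
Lemma koebe_distortion (H L : C -> C) (z : C) : S1 H -> is_log_branch (C_derive H) L -> Cmod z < 1 ->
  ln (1 - Cmod z) - 3 * ln (1 + Cmod z) <= fst (L z) <= ln (1 + Cmod z) - 3 * ln (1 - Cmod z).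
Proof.
  intros SH LB Hz. destruct (S1_log_hol H L SH LB) as [HH HL]. destruct SH as [_ [Inj _]]. destruct LB as [_ [L0 _]].
  pose proof (Cmod_ge_0 z). set (r := Cmod z) in *.
  destruct (Req_EM_T r 0) as [e|n].
  (* At the centre there is no direction [z / r], but both bounds and [L] are 0. *)
  { apply Cmod_eq_0 in e. subst z. unfold r. rewrite Cmod_0, L0, Rminus_0_r, Rplus_0_r, ln_1. cbn. lra. }
  assert (nr : RtoC r <> 0%C) by now apply RtoC_neq_0.
  set (e := (z / RtoC r)%C).
  assert (He : Cmod e = 1). { unfold e. rewrite Cmod_div, Cmod_R, Rabs_pos_eq by auto. fold r. field. auto. }
  assert (Ez : z = (RtoC r * e)%C) by (unfold e; field; auto).
  assert (Hte : forall t, 0 <= t -> Cmod (RtoC t * e)%C = t) by (intros; rewrite Cmod_mult, He, Cmod_R, Rabs_pos_eq; lra).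
  set (psi := fun t => fst (L (RtoC t * e)%C)). set (psi' := fun t => fst (C_derive L (RtoC t * e) * e)%C).
  assert (Dpsi : forall t, 0 <= t <= r -> is_derive psi t (psi' t)).
  { intros t Ht. apply rcder_fst. apply (cder_comp_curve L (fun t => RtoC t * e)%C). apply HL. rewrite Hte; lra. apply rcder_scale. }
  assert (Bpsi : forall t, 0 <= t <= r -> 2 * t - 4 <= (1 - t ^ 2) * psi' t <= 2 * t + 4).
  { intros t Ht. pose proof (pre_schwarzian_bound H L (C_derive L) HH HL Inj (RtoC t * e)%C) as K. rewrite Hte in K by lra.
    specialize (K ltac:(lra)).
    (* Multiplying by the unimodular [e] produces the radial derivative and makes the conjugate term
       the real number [2 t]. *)
    apply (Rmult_le_compat_r (Cmod e)) in K; [|rewrite He; lra]. rewrite <- Cmod_mult, He, Rmult_1_r in K.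
    assert (Ec : (Cconj e * e)%C = 1%C). { rewrite Cmult_comm, <- Cmod2_conj, He. unfold RtoC; cbn. f_equal; ring. }
    replace (((1 - t ^ 2)%R * C_derive L (RtoC t * e) - 2 * Cconj (RtoC t * e)) * e)%C with
      (RtoC (1 - t ^ 2) * (C_derive L (RtoC t * e) * e) - RtoC (2 * t))%C in K.
    - pose proof (fst_le_Cmod (RtoC (1 - t ^ 2) * (C_derive L (RtoC t * e) * e) - RtoC (2 * t))%C) as K2.
      assert (K3 := Rle_trans _ _ _ K2 K). unfold psi'. set (v := (C_derive L (RtoC t * e) * e)%C) in *.
      assert (Ev : fst (RtoC (1 - t ^ 2) * v - RtoC (2 * t))%C = (1 - t ^ 2) * fst v - 2 * t) by (cbn; ring).
      rewrite Ev in K3. pose proof (Rle_abs ((1 - t ^ 2) * fst v - 2 * t)). pose proof (Rle_abs (- ((1 - t ^ 2) * fst v - 2 * t))). rewrite Rabs_Ropp in *. lra.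
    - rewrite Cmult_conj. assert (Et : Cconj (RtoC t) = RtoC t) by (unfold Cconj, RtoC; cbn; f_equal; ring). rewrite Et.
      rewrite RtoC_mult.
      replace ((RtoC (1 - t ^ 2) * C_derive L (RtoC t * e) - 2 * (RtoC t * Cconj e)) * e)%C with
       (RtoC (1 - t ^ 2) * (C_derive L (RtoC t * e) * e) - 2 * RtoC t * (Cconj e * e))%C by ring. rewrite Ec. ring. }
  assert (Bd : forall t, 0 <= t <= r -> / (1 + t) * (2 * t - 4) * / (1 - t) <= psi' t <= / (1 + t) * (2 * t + 4) * / (1 - t)).
  { intros t Ht. specialize (Bpsi t Ht).
    assert (0 < / (1 + t)) by (apply Rinv_0_lt_compat; lra). assert (0 < / (1 - t)) by (apply Rinv_0_lt_compat; lra).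
    replace (psi' t) with (/ (1 + t) * ((1 - t ^ 2) * psi' t) * / (1 - t)) by (field; lra).
    split; (apply Rmult_le_compat_r; [lra|]; apply Rmult_le_compat_l; lra). }
  assert (P0 : psi 0 = 0). { unfold psi. replace (RtoC 0 * e)%C with (RtoC 0) by ring. rewrite L0. reflexivity. }
  assert (Pr : psi r = fst (L z)) by (unfold psi; now rewrite <- Ez).
  rewrite <- Pr. split.
  - assert (M : psi 0 - (ln (1 - 0) - 3 * ln (1 + 0)) <= psi r - (ln (1 - r) - 3 * ln (1 + r))).
    { apply (derive_nonneg_le (fun t => psi t - (ln (1 - t) - 3 * ln (1 + t))) (fun t => psi' t - / (1 + t) * (2 * t - 4) * / (1 - t))). lra.
      - intros t Ht. apply (is_derive_minus (K := R_AbsRing) (V := R_NormedModule) psi). now apply Dpsi.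
        auto_derive. lra. field. lra.
      - intros t Ht. specialize (Bd t Ht). lra. }
    replace (1 + 0) with 1 in M by ring. replace (1 - 0) with 1 in M by ring. rewrite P0, ln_1 in M. lra.
  - assert (M : (ln (1 + 0) - 3 * ln (1 - 0)) - psi 0 <= (ln (1 + r) - 3 * ln (1 - r)) - psi r).
    { apply (derive_nonneg_le (fun t => (ln (1 + t) - 3 * ln (1 - t)) - psi t) (fun t => / (1 + t) * (2 * t + 4) * / (1 - t) - psi' t)). lra.
      - intros t Ht. apply (is_derive_minus (K := R_AbsRing) (V := R_NormedModule) (fun t => ln (1 + t) - 3 * ln (1 - t)) psi).
        auto_derive. lra. field. lra. now apply Dpsi.
      - intros t Ht. specialize (Bd t Ht). lra. }
    replace (1 + 0) with 1 in M by ring. replace (1 - 0) with 1 in M by ring. rewrite P0, ln_1 in M. lra.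
Qed.

Lemma ln_cube (x : R) : 0 < x -> ln (x ^ 3) = 3 * ln x.
Proof. intros H. replace (x ^ 3) with (x * x ^ 2) by ring. rewrite ln_mult, ln_sqr by (auto; apply pow_lt; auto). ring. Qed.

Lemma lower_bound_exp (r lam : R) : 0 <= r < 1 -> lower_bound r lam = exp (lam * (ln (1 - r) - 3 * ln (1 + r))).
Proof. intros H. unfold lower_bound, Rpower. rewrite ln_div, ln_cube; try lra. apply pow_lt; lra. Qed.

Lemma upper_bound_exp (r lam : R) : 0 <= r < 1 -> upper_bound r lam = exp (lam * (ln (1 + r) - 3 * ln (1 - r))).
Proof. intros H. unfold upper_bound, Rpower. rewrite ln_div, ln_cube; try lra. apply pow_lt; lra. Qed.

Lemma exp_le_mono (x y : R) : x <= y -> exp x <= exp y.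
Proof. intros [H|H]. left; now apply exp_increasing. rewrite H; lra. Qed.

Lemma Cmod_Cexp_scal (lam : R) (w : C) : Cmod (Cexp (RtoC lam * w)%C) = exp (lam * fst w).
Proof. rewrite Cmod_Cexp. f_equal. cbn. ring. Qed.

Lemma power_bounds (H P : C -> C) (lam : R) (z : C) : S1 H -> is_power (C_derive H) lam P -> 0 < lam -> Cmod z < 1 ->
  lower_bound (Cmod z) lam <= Cmod (P z) <= upper_bound (Cmod z) lam.
Proof.
  intros SH [L [LB EP]] Hl Hz. pose proof (Cmod_ge_0 z).
  rewrite lower_bound_exp, upper_bound_exp by lra. rewrite EP by exact Hz. rewrite Cmod_Cexp_scal.
  destruct (koebe_distortion H L z SH LB Hz). split; apply exp_le_mono; apply Rmult_le_compat_l; lra.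
Qed.

(** * The Wirtinger derivative of the mapping *)

Lemma rcder_mult (c d : R -> C) (t : R) (v w : C) : rcder c t v -> rcder d t w ->
  rcder (fun s => c s * d s)%C t (v * d t + c t * w)%C.
Proof.
  intros Hc Hd.
  pose proof (rcder_fst _ _ _ Hc) as c1. pose proof (rcder_snd _ _ _ Hc) as c2.
  pose proof (rcder_fst _ _ _ Hd) as d1. pose proof (rcder_snd _ _ _ Hd) as d2.
  assert (M : forall (f g : R -> R) f' g', is_derive f t f' -> is_derive g t g' -> is_derive (fun s => f s * g s) t (f' * g t + f t * g')).
  { intros f g f' g' A B. apply (is_derive_mult (K := R_AbsRing) f g t f' g' A B Rmult_comm). }
  eapply rcder_eq. apply rcder_pair.
  apply (is_derive_minus (K := R_AbsRing) (V := R_NormedModule) (fun s => fst (c s) * fst (d s)) (fun s => snd (c s) * snd (d s))); apply M; eassumption.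
  apply (is_derive_plus (K := R_AbsRing) (V := R_NormedModule) (fun s => fst (c s) * snd (d s)) (fun s => snd (c s) * fst (d s))); apply M; eassumption.
  apply injective_projections; cbn; unfold minus, plus, opp; cbn; ring.
Qed.

Lemma rcder_conj (c : R -> C) (t : R) (v : C) : rcder c t v -> rcder (fun s => Cconj (c s)) t (Cconj v).
Proof.
  intros Hc. apply rcder_pair; cbn. now apply rcder_fst. apply (is_derive_opp (K := R_AbsRing) (V := R_NormedModule)). now apply rcder_snd.
Qed.

Lemma Derive_pair (c d : R -> C) (t e : R) (v : C) : 0 < e -> (forall s, Rabs (s - t) < e -> c s = d s) -> rcder c t v ->
  (Derive (fun s => Re (d s)) t, Derive (fun s => Im (d s)) t) = v.
Proof.
  intros He E D. apply injective_projections; cbn; apply is_derive_unique.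
  apply is_derive_ext_loc with (fun s => fst (c s)). exists (mkposreal e He). intros s Hs. rewrite E; auto. now apply rcder_fst.
  apply is_derive_ext_loc with (fun s => snd (c s)). exists (mkposreal e He). intros s Hs. rewrite E; auto. now apply rcder_snd.
Qed.

(** The partial derivatives are [h' conj g + h conj g'] and [i (h' conj g - h conj g')]. The
    Wirtinger combination keeps the first product and cancels the one containing [g']. *)
Lemma wirtinger_product (f h g : C -> C) (z : C) : analytic_on_disk h -> analytic_on_disk g ->
  (forall w, Cmod w < 1 -> f w = (h w * Cconj (g w))%C) -> Cmod z < 1 ->
  wirtinger_dz f z = (C_derive h z * Cconj (g z))%C.
Proof.
  intros Ah Ag Ef Hz. destruct (disk_open z 1 Hz) as [Ho Hw]. destruct z as [x y].
  pose proof (analytic_cder h _ Ah Hz) as Dh. pose proof (analytic_cder g _ Ag Hz) as Dg.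
  set (h' := C_derive h (x, y)) in *. set (g' := C_derive g (x, y)) in *.
  assert (D : forall (c : R -> C) t v, c t = (x, y) -> rcder c t v -> rcder (fun s => h (c s) * Cconj (g (c s)))%C t (h' * v * Cconj (g (x, y)) + h (x, y) * Cconj (g' * v))%C).
  { intros c t v E Hc. rewrite <- E. apply (rcder_mult (fun s => h (c s)) (fun s => Cconj (g (c s)))).
    apply cder_comp_curve; auto. now rewrite E. apply (rcder_conj (fun s => g (c s))). apply cder_comp_curve; auto. now rewrite E. }
  assert (Ex : dx f (x, y) = (h' * 1 * Cconj (g (x, y)) + h (x, y) * Cconj (g' * 1))%C).
  { unfold dx. cbn [Re Im fst snd]. apply (Derive_pair (fun s => h (s, y) * Cconj (g (s, y)))%C (fun s => f (s, y)) x (1 - Cmod (x, y))); auto.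
    - intros s Hs. symmetry. apply Ef. apply Hw. replace ((s, y) - (x, y))%C with (RtoC (s - x)). now rewrite Cmod_R.
      unfold RtoC, Cminus, Cplus, Copp; cbn. f_equal; ring.
    - apply (D (fun s => (s, y))); auto. apply rcder_pair; cbn. apply (is_derive_id (K := R_AbsRing)). apply (is_derive_const (K := R_AbsRing) (V := R_NormedModule)). }
  assert (Ey : dy f (x, y) = (h' * Ci * Cconj (g (x, y)) + h (x, y) * Cconj (g' * Ci))%C).
  { unfold dy. cbn [Re Im fst snd]. apply (Derive_pair (fun s => h (x, s) * Cconj (g (x, s)))%C (fun s => f (x, s)) y (1 - Cmod (x, y))); auto.
    - intros s Hs. symmetry. apply Ef. apply Hw. replace ((x, s) - (x, y))%C with (Ci * RtoC (s - y))%C. now rewrite Cmod_mult, Cmod_Ci, Cmod_R, Rmult_1_l.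
      unfold RtoC, Ci, Cmult, Cminus, Cplus, Copp; cbn. f_equal; ring.
    - apply (D (fun s => (x, s))); auto. apply rcder_pair; cbn. apply (is_derive_const (K := R_AbsRing) (V := R_NormedModule)). apply (is_derive_id (K := R_AbsRing)). }
  unfold wirtinger_dz. rewrite Ex, Ey, !Cmult_conj.
  assert (E1 : Cconj Ci = (- Ci)%C) by (unfold Cconj, Ci, Copp; cbn; f_equal; ring).
  assert (E2 : Cconj 1 = 1%C) by (unfold Cconj, RtoC; cbn; f_equal; ring).
  assert (E3 : (Ci * Ci)%C = (- (1))%C) by (unfold Cmult, Ci, Copp, RtoC; cbn; f_equal; ring).
  rewrite E1, E2. set (gz := Cconj (g (x, y))). set (hz := h (x, y)). set (gc := Cconj g').
  replace (h' * 1 * gz + hz * (gc * 1) - Ci * (h' * Ci * gz + hz * (gc * - Ci)))%C with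
    (h' * gz + hz * gc - (Ci * Ci) * (h' * gz - hz * gc))%C by ring.
  rewrite E3. field.
Qed.

Lemma is_power_hol (H P L : C -> C) (lam : R) : S1 H -> is_log_branch (C_derive H) L ->
  (forall z, in_disk z -> P z = Cexp (RtoC lam * L z)%C) ->
  hol P (fun z => P z * (RtoC lam * C_derive L z))%C.
Proof.
  intros SH LB EP. destruct (S1_log_hol H L SH LB) as [_ HL].
  apply hol_ext with (fun z => Cexp (RtoC lam * L z)%C) (fun z => Cexp (RtoC lam * L z) * (0 * L z + RtoC lam * C_derive L z))%C.
  intros z Hz. now rewrite EP. intros z Hz. rewrite EP by exact Hz. ring.
  apply (hol_exp (fun z => RtoC lam * L z)%C). apply (hol_mult (fun _ => RtoC lam) (fun _ => RtoC 0)); auto. apply hol_const.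
Qed.

(** [conj g] cancels in [f_z / f], which leaves [h' / h = lam L']. This is why the norm estimate
    involves only [lam1] and [H]. *)
Lemma log_derivative_modulus (f h g H L : C -> C) (lam : R) (z : C) : S1 H -> is_log_branch (C_derive H) L -> 0 < lam ->
  (forall z, in_disk z -> h z = Cexp (RtoC lam * L z)%C) -> nonvanishing_logharmonic f h g -> Cmod z < 1 ->
  Cmod (wirtinger_dz f z / f z)%C = lam * Cmod (C_derive L z).
Proof.
  intros SH LB Hl EP [Ah [Ag [Nhg [Ef _]]]] Hz.
  rewrite (wirtinger_product f h g) by auto. rewrite Ef by exact Hz.
  destruct (Nhg z Hz) as [Nh Ng].
  assert (Ncg : Cconj (g z) <> 0%C). { intros E. apply Ng. rewrite <- (Cconj_conj (g z)), E. unfold Cconj, RtoC; cbn; f_equal; ring. }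
  rewrite (is_C_derive_unique h z _ (proj1 (is_power_hol H h L lam SH LB EP z Hz))).
  replace (h z * (RtoC lam * C_derive L z) * Cconj (g z) / (h z * Cconj (g z)))%C with (RtoC lam * C_derive L z)%C by (field; auto).
  rewrite Cmod_mult, Cmod_R, Rabs_pos_eq; lra.
Qed.

Lemma preschwarzian_bound (f h g H L : C -> C) (lam : R) : S1 H -> is_log_branch (C_derive H) L -> 0 < lam ->
  (forall z, in_disk z -> h z = Cexp (RtoC lam * L z)%C) -> nonvanishing_logharmonic f h g ->
  Rbar_le (preschwarzian_norm f) (Finite (6 * lam)).
Proof.
  intros SH LB Hl EP NL. unfold preschwarzian_norm. apply Lub_Rbar_correct.
  intros x [z [Hz ->]]. unfold in_disk in Hz. rewrite (log_derivative_modulus f h g H L lam) by auto.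
  destruct (S1_log_hol H L SH LB) as [HH HL]. destruct SH as [_ [Inj _]].
  pose proof (pre_schwarzian_bound H L (C_derive L) HH HL Inj z Hz) as K. pose proof (Cmod_ge_0 z).
  assert (0 < 1 - Cmod z ^ 2) by nra.
  assert (B : (1 - Cmod z ^ 2) * Cmod (C_derive L z) <= 6).
  { rewrite <- (Rabs_pos_eq (1 - Cmod z ^ 2)) by lra. rewrite <- Cmod_R, <- Cmod_mult.
    replace ((1 - Cmod z ^ 2)%R * C_derive L z)%C with (((1 - Cmod z ^ 2)%R * C_derive L z - 2 * Cconj z) + 2 * Cconj z)%C by ring.
    eapply Rle_trans. apply Cmod_triangle. rewrite (Cmod_mult 2), Cmod_R, Cmod_conj, Rabs_pos_eq by lra. lra. }
  cbn -[pow]. replace ((1 - Cmod z ^ 2) * (lam * Cmod (C_derive L z))) with (lam * ((1 - Cmod z ^ 2) * Cmod (C_derive L z))) by ring. nra.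
Qed.

(** * The Koebe function *)

Definition koebe (z : C) : C := (z / ((1 - z) * (1 - z)))%C.
Definition koebe_deriv (z : C) : C := ((1 + z) / ((1 - z) * (1 - z) * (1 - z)))%C.

Lemma one_minus_neq_0 (z : C) : Cmod z < 1 -> (1 - z)%C <> 0%C.
Proof.
  intros Hz E. assert (X : z = 1%C) by (replace z with (1 - (1 - z))%C by ring; rewrite E; ring).
  rewrite X, Cmod_1 in Hz. lra.
Qed.

Lemma one_plus_neq_0 (z : C) : Cmod z < 1 -> (1 + z)%C <> 0%C.
Proof.
  intros Hz. replace (1 + z)%C with (1 - - z)%C by ring. apply one_minus_neq_0. now rewrite Cmod_opp.
Qed.

Lemma hol_one_minus : hol (fun z => 1 - z)%C (fun _ => 0 - 1)%C.
Proof. apply (hol_minus (fun _ => RtoC 1) (fun _ => RtoC 0) (fun z => z) (fun _ => RtoC 1)). apply hol_const. apply hol_id. Qed.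

Lemma hol_koebe : hol koebe koebe_deriv.
Proof.
  assert (H2 : hol (fun z => (1 - z) * (1 - z))%C (fun z => (0 - 1) * (1 - z) + (1 - z) * (0 - 1))%C).
  { apply (hol_mult (fun z => 1 - z)%C (fun _ => 0 - 1)%C); apply hol_one_minus. }
  eapply hol_ext; [| |apply hol_mult; [apply hol_id|apply (hol_inv _ _) with (2 := H2)]].
  - reflexivity.
  - intros z Hz. cbv beta. pose proof (one_minus_neq_0 z Hz). unfold koebe_deriv. field. auto.
  - intros z Hz. apply Cmult_neq_0; now apply one_minus_neq_0.
Qed.

(** The derivative is displayed as the function times its logarithmic derivative
    [1 / (1 + z) + 3 / (1 - z)], so that [koebe_log] can read off [L']. *)
Lemma hol_koebe_deriv : hol koebe_deriv (fun z => koebe_deriv z * ((4 + 2 * z) / ((1 - z) * (1 + z))))%C.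
Proof.
  assert (H3 : hol (fun z => (1 - z) * (1 - z) * (1 - z))%C (fun z => ((0 - 1) * (1 - z) + (1 - z) * (0 - 1)) * (1 - z) + (1 - z) * (1 - z) * (0 - 1))%C).
  { apply (hol_mult (fun z => (1 - z) * (1 - z))%C (fun z => (0 - 1) * (1 - z) + (1 - z) * (0 - 1))%C); [|apply hol_one_minus].
    apply (hol_mult (fun z => 1 - z)%C (fun _ => 0 - 1)%C); apply hol_one_minus. }
  eapply hol_ext; [| |apply hol_mult; [apply (hol_plus (fun _ => RtoC 1) (fun _ => RtoC 0)); [apply hol_const|apply hol_id]|apply (hol_inv _ _) with (2 := H3)]].
  - reflexivity.
  - intros z Hz. cbv beta. pose proof (one_minus_neq_0 z Hz). pose proof (one_plus_neq_0 z Hz). unfold koebe_deriv. field. auto.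
  - intros z Hz. repeat apply Cmult_neq_0; now apply one_minus_neq_0.
Qed.

Lemma koebe_deriv_neq_0 (z : C) : Cmod z < 1 -> koebe_deriv z <> 0%C.
Proof.
  intros Hz E. pose proof (one_minus_neq_0 z Hz) as N. apply (one_plus_neq_0 z Hz).
  replace (1 + z)%C with (koebe_deriv z * ((1 - z) * (1 - z) * (1 - z)))%C by (unfold koebe_deriv; field; auto). rewrite E. ring.
Qed.

(** [koebe z - koebe w] has numerator [(z - w) (1 - z w)], and the second factor does not vanish in
    the disk. *)
Lemma koebe_inj (z w : C) : Cmod z < 1 -> Cmod w < 1 -> koebe z = koebe w -> z = w.
Proof.
  intros Hz Hw E. pose proof (one_minus_neq_0 z Hz) as Nz. pose proof (one_minus_neq_0 w Hw) as Nw.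
  assert (X : ((z - w) * (1 - z * w))%C = 0%C).
  { replace ((z - w) * (1 - z * w))%C with ((koebe z - koebe w) * ((1 - z) * (1 - z) * ((1 - w) * (1 - w))))%C by (unfold koebe; field; auto).
    rewrite E. ring. }
  apply Cmult_integral_C in X as [X|X].
  - replace z with (z - w + w)%C by ring. rewrite X. ring.
  - exfalso. revert X. apply one_minus_neq_0. rewrite Cmod_mult. pose proof (Cmod_ge_0 z). pose proof (Cmod_ge_0 w). nra.
Qed.

Lemma S1_koebe : S1 koebe.
Proof.
  split; [|split].
  - apply (hol_analytic _ _ hol_koebe).
  - intros z w Hz Hw. now apply koebe_inj.
  - apply is_C_derive_unique. apply cder_eq with (koebe_deriv 0). apply hol_koebe. rewrite Cmod_0; lra. unfold koebe_deriv. field.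
Qed.

Lemma koebe_log : exists L, is_log_branch (C_derive koebe) L /\
  forall z, Cmod z < 1 -> C_derive L z = ((4 + 2 * z) / ((1 - z) * (1 + z)))%C.
Proof.
  destruct (log_branch koebe_deriv _ hol_koebe_deriv koebe_deriv_neq_0) as [L [HL [L0 EL]]].
  exists L. split; [split; [|split]|]; auto.
  - apply (hol_analytic _ _ HL).
  - intros z Hz. rewrite (is_C_derive_unique koebe z (koebe_deriv z)) by now apply hol_koebe.
    rewrite EL by exact Hz. replace (koebe_deriv 0) with (RtoC 1). ring. unfold koebe_deriv. field.
  - intros z Hz. apply is_C_derive_unique. apply cder_eq with (1 := proj1 (HL z Hz)).
    pose proof (koebe_deriv_neq_0 z Hz). pose proof (one_minus_neq_0 z Hz). pose proof (one_plus_neq_0 z Hz). field. auto.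
Qed.

(** The real axis carries both extremes: [x = r] attains the upper distortion bound and [x = - r]
    the lower one. *)
Lemma koebe_log_re (L : C -> C) (x : R) : is_log_branch (C_derive koebe) L -> -1 < x < 1 ->
  fst (L (RtoC x)) = ln (1 + x) - 3 * ln (1 - x).
Proof.
  intros [_ [_ EL]] Hx.
  assert (Hz : Cmod (RtoC x) < 1) by (rewrite Cmod_R; apply Rabs_def1; lra).
  specialize (EL _ Hz). rewrite (is_C_derive_unique koebe _ (koebe_deriv x)) in EL by now apply hol_koebe.
  rewrite <- (ln_exp (fst (L x))), <- Cmod_Cexp, EL.
  replace (koebe_deriv x) with (RtoC ((1 + x) / (1 - x) ^ 3)).
  - assert (0 < (1 - x) ^ 3) by (apply pow_lt; lra).
    rewrite Cmod_R, Rabs_pos_eq, ln_div, ln_cube; try lra. left. apply Rdiv_lt_0_compat; lra.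
  - unfold koebe_deriv. rewrite RtoC_div, RtoC_pow, RtoC_plus, RtoC_minus. field. now apply one_minus_neq_0.
    apply pow_nonzero. lra.
Qed.

Lemma koebe_mapping (lam1 lam2 : R) (L : C -> C) : 0 < lam2 < lam1 -> is_log_branch (C_derive koebe) L ->
  mapping_class lam1 lam2 koebe koebe (fun z => Cexp (RtoC lam1 * L z) * Cconj (Cexp (RtoC lam2 * L z)))%C
    (fun z => Cexp (RtoC lam1 * L z)%C) (fun z => Cexp (RtoC lam2 * L z)%C).
Proof.
  intros Hl LB.
  assert (HP : forall lam, hol (fun z => Cexp (RtoC lam * L z)%C) (fun z => Cexp (RtoC lam * L z) * (RtoC lam * C_derive L z))%C).
  { intros lam. apply (is_power_hol koebe (fun z => Cexp (RtoC lam * L z)%C) L lam S1_koebe LB). reflexivity. }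
  split; [apply S1_koebe|split; [apply S1_koebe|]].
  split; [now exists L|split; [now exists L|]].
  split; [apply (hol_analytic _ _ (HP lam1))|split; [apply (hol_analytic _ _ (HP lam2))|]].
  split; [intros; split; apply Cexp_neq_0|split; [reflexivity|]].
  exists (fun _ => RtoC (lam2 / lam1)). split; [apply (hol_analytic _ _ (hol_const _))|split].
  - intros z _. unfold in_disk. rewrite Cmod_R, Rabs_pos_eq.
    apply (Rmult_lt_reg_r lam1). lra. unfold Rdiv. rewrite Rmult_assoc, Rinv_l; lra.
    left. apply Rdiv_lt_0_compat; lra.
  - intros z Hz. rewrite (is_C_derive_unique _ z _ (proj1 (HP lam1 z Hz))), (is_C_derive_unique _ z _ (proj1 (HP lam2 z Hz))).
    rewrite RtoC_div by lra. field. repeat split; try apply Cexp_neq_0. apply RtoC_neq_0; lra.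
Qed.

Lemma is_lub_Rbar_max (E : R -> Prop) (l : R) : (forall x, E x -> x <= l) -> E l -> is_lub_Rbar E (Finite l).
Proof. intros U M. split. intros x Hx. now apply U. intros b Hb. now apply (Hb l). Qed.

Lemma is_glb_Rbar_min (E : R -> Prop) (l : R) : (forall x, E x -> l <= x) -> E l -> is_glb_Rbar E (Finite l).
Proof. intros U M. split. intros x Hx. now apply U. intros b Hb. now apply (Hb l). Qed.

Lemma modulus_bounds (lam1 lam2 : R) (H G f h g : C -> C) (z : C) : 0 < lam1 -> 0 < lam2 ->
  mapping_class lam1 lam2 H G f h g -> Cmod z < 1 ->
  (lower_bound (Cmod z) lam1 <= Cmod (h z) <= upper_bound (Cmod z) lam1) /\
  (lower_bound (Cmod z) lam2 <= Cmod (g z) <= upper_bound (Cmod z) lam2) /\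
  (lower_bound (Cmod z) (lam1 + lam2) <= Cmod (f z) <= upper_bound (Cmod z) (lam1 + lam2)).
Proof.
  intros h1 h2 [SH [SG [PH [PG [_ [_ [_ [Ef _]]]]]]]] Hz.
  pose proof (power_bounds H h lam1 z SH PH h1 Hz) as B1. pose proof (power_bounds G g lam2 z SG PG h2 Hz) as B2.
  split; [auto|split; [auto|]]. rewrite Ef by exact Hz. rewrite Cmod_mult, Cmod_conj.
  unfold lower_bound, upper_bound in *. rewrite !Rpower_plus.
  assert (P : forall x y, 0 <= Rpower x y) by (intros; left; apply exp_pos).
  split; apply Rmult_le_compat; auto; try apply Cmod_ge_0; lra.
Qed.

(** On the positive radius [(1 - x^2) |L' x| = 4 + 2 x], which tends to 6 as [x] tends to 1. *)
Lemma koebe_norm (lam1 lam2 : R) (L : C -> C) : 0 < lam2 < lam1 -> is_log_branch (C_derive koebe) L ->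
  (forall z, Cmod z < 1 -> C_derive L z = ((4 + 2 * z) / ((1 - z) * (1 + z)))%C) ->
  preschwarzian_norm (fun z => Cexp (RtoC lam1 * L z) * Cconj (Cexp (RtoC lam2 * L z)))%C = Finite (6 * lam1).
Proof.
  intros Hl LB EL. pose proof (koebe_mapping lam1 lam2 L Hl LB) as [SK [_ [_ [_ NL]]]].
  set (f := fun z => (Cexp (RtoC lam1 * L z) * Cconj (Cexp (RtoC lam2 * L z)))%C) in *.
  apply Rbar_le_antisym.
  - apply (preschwarzian_bound f (fun z => Cexp (RtoC lam1 * L z)%C) (fun z => Cexp (RtoC lam2 * L z)%C) koebe L lam1 SK LB); auto. lra.
  - assert (X : forall x, 0 <= x < 1 -> Rbar_le (Finite (lam1 * (4 + 2 * x))) (preschwarzian_norm f)).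
    { intros x Hx. unfold preschwarzian_norm. apply Lub_Rbar_correct. exists (RtoC x).
      assert (Mx : Cmod (RtoC x) = x) by (rewrite Cmod_R, Rabs_pos_eq; lra).
      split. unfold in_disk. lra.
      rewrite (log_derivative_modulus f (fun z => Cexp (RtoC lam1 * L z)%C) (fun z => Cexp (RtoC lam2 * L z)%C) koebe L lam1) by (auto; lra).
      rewrite EL, Mx by lra.
      replace ((4 + 2 * RtoC x) / ((1 - RtoC x) * (1 + RtoC x)))%C with (RtoC ((4 + 2 * x) / ((1 - x) * (1 + x)))).
      rewrite Cmod_R, Rabs_pos_eq. field. lra.
      left. apply Rdiv_lt_0_compat. lra. apply Rmult_lt_0_compat; lra.
      rewrite RtoC_div by (apply Rgt_not_eq, Rmult_lt_0_compat; lra). now rewrite RtoC_mult, RtoC_plus, RtoC_mult, RtoC_minus, RtoC_plus. }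
    destruct (preschwarzian_norm f) as [b| |].
    + cbn in *. apply Rnot_lt_le. intros N. set (d := 6 * lam1 - b) in *.
      assert (0 <= b). { pose proof (X 0 ltac:(lra)). lra. }
      assert (Hd : d / (4 * lam1) <= 3 / 2). { apply (Rmult_le_reg_r (4 * lam1)). lra. unfold Rdiv. rewrite Rmult_assoc, Rinv_l by lra. unfold d; lra. }
      assert (Hd0 : 0 < d / (4 * lam1)). { apply Rdiv_lt_0_compat; unfold d; lra. }
      (* The point [1 - d / (4 lam1)] gives the value [6 lam1 - d / 2], above [b = 6 lam1 - d]. If
         that point were negative, [b] would be below [2 lam1], and the value [4 lam1] at 0 already
         contradicts it. *)
      destruct (Rle_dec (d / (4 * lam1)) 1).
      * specialize (X (1 - d / (4 * lam1)) ltac:(lra)).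
        replace (lam1 * (4 + 2 * (1 - d / (4 * lam1)))) with (6 * lam1 - d / 2) in X by (field; lra). unfold d in *. lra.
      * specialize (X 0 ltac:(lra)).
        assert (4 * lam1 < d). { apply Rnot_le_lt. intros Le. apply n. apply (Rmult_le_reg_r (4 * lam1)). lra. unfold Rdiv. rewrite Rmult_assoc, Rinv_l by lra. lra. }
        unfold d in *. lra.
    + exact I.
    + specialize (X 0 ltac:(lra)). exact X.
Qed.

Theorem theorem3p7 (lam1 lam2 : R) (hlam1 : 0 < lam1) (hlam2 : 0 < lam2) :
  (forall H G f h g : C -> C, mapping_class lam1 lam2 H G f h g ->
     (forall (z : C) (r : R), Cmod z = r -> r < 1 ->
        (lower_bound r lam1 <= Cmod (h z) <= upper_bound r lam1) /\
        (lower_bound r lam2 <= Cmod (g z) <= upper_bound r lam2) /\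
        (lower_bound r (lam1 + lam2) <= Cmod (f z) <= upper_bound r (lam1 + lam2))) /\
     Rbar_le (preschwarzian_norm f) (Finite (6 * lam1)))
  /\
  (lam2 < lam1 ->
     (forall r : R, 0 <= r < 1 ->
        is_glb_Rbar (class_values lam1 lam2 r (fun f h g z => Cmod (h z)))
          (Finite (lower_bound r lam1)) /\
        is_lub_Rbar (class_values lam1 lam2 r (fun f h g z => Cmod (h z)))
          (Finite (upper_bound r lam1)) /\
        is_glb_Rbar (class_values lam1 lam2 r (fun f h g z => Cmod (g z)))
          (Finite (lower_bound r lam2)) /\
        is_lub_Rbar (class_values lam1 lam2 r (fun f h g z => Cmod (g z)))
          (Finite (upper_bound r lam2)) /\
        is_glb_Rbar (class_values lam1 lam2 r (fun f h g z => Cmod (f z)))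
          (Finite (lower_bound r (lam1 + lam2))) /\
        is_lub_Rbar (class_values lam1 lam2 r (fun f h g z => Cmod (f z)))
          (Finite (upper_bound r (lam1 + lam2)))) /\
     is_lub_Rbar
       (fun x : R => exists H G f h g : C -> C,
          mapping_class lam1 lam2 H G f h g /\ preschwarzian_norm f = Finite x)
       (Finite (6 * lam1))).
Proof.
  assert (Bound : forall H G f h g : C -> C, mapping_class lam1 lam2 H G f h g -> Rbar_le (preschwarzian_norm f) (Finite (6 * lam1))).
  { intros H G f h g [SH [_ [[L [LB EP]] [_ NL]]]]. now apply (preschwarzian_bound f h g H L lam1). }
  split.
  - intros H G f h g M. split. intros z r <- Hr. now apply (modulus_bounds lam1 lam2 H G f h g).
    now apply (Bound H G f h g).
  - intros Hl. destruct koebe_log as [L [LB EL]].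
    pose proof (koebe_mapping lam1 lam2 L (conj hlam2 Hl) LB) as KM.
    split.
    + intros r Hr.
      assert (Up : Cmod (RtoC r) = r) by (rewrite Cmod_R, Rabs_pos_eq; lra).
      assert (Lo : Cmod (RtoC (- r)) = r) by (rewrite Cmod_R, Rabs_Ropp, Rabs_pos_eq; lra).
      assert (Vu : forall lam, Cmod (Cexp (RtoC lam * L (RtoC r))%C) = upper_bound r lam).
      { intros lam. rewrite Cmod_Cexp_scal, koebe_log_re, upper_bound_exp by (auto; lra). reflexivity. }
      assert (Vl : forall lam, Cmod (Cexp (RtoC lam * L (RtoC (- r)))%C) = lower_bound r lam).
      { intros lam. rewrite Cmod_Cexp_scal, koebe_log_re, lower_bound_exp by (auto; lra). f_equal. f_equal. f_equal. f_equal. f_equal. ring. }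
      assert (MB := fun H G f h g z M => modulus_bounds lam1 lam2 H G f h g z hlam1 hlam2 M).
      (* One mapping witnesses every bound, so membership is proved for an arbitrary quantity [Q],
         at [r] here and at [- r] next. *)
      assert (Pu : forall Q : (C -> C) -> (C -> C) -> (C -> C) -> C -> R, class_values lam1 lam2 r Q
        (Q (fun z => Cexp (RtoC lam1 * L z) * Cconj (Cexp (RtoC lam2 * L z)))%C (fun z => Cexp (RtoC lam1 * L z)%C) (fun z => Cexp (RtoC lam2 * L z)%C) (RtoC r))).
      { intros Q. eexists koebe, koebe, _, _, _, (RtoC r). split; [exact KM|split; [exact Up|reflexivity]]. }
      assert (Pl : forall Q : (C -> C) -> (C -> C) -> (C -> C) -> C -> R, class_values lam1 lam2 r Q
        (Q (fun z => Cexp (RtoC lam1 * L z) * Cconj (Cexp (RtoC lam2 * L z)))%C (fun z => Cexp (RtoC lam1 * L z)%C) (fun z => Cexp (RtoC lam2 * L z)%C) (RtoC (- r)))).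
      { intros Q. eexists koebe, koebe, _, _, _, (RtoC (- r)). split; [exact KM|split; [exact Lo|reflexivity]]. }
      split; [|split; [|split; [|split; [|split]]]].
      * apply is_glb_Rbar_min. intros x (H & G & f & h & g & z & M & <- & ->). apply (MB _ _ _ _ _ _ M). lra.
        rewrite <- Vl. exact (Pl (fun f h g z => Cmod (h z))).
      * apply is_lub_Rbar_max. intros x (H & G & f & h & g & z & M & <- & ->). apply (MB _ _ _ _ _ _ M). lra.
        rewrite <- Vu. exact (Pu (fun f h g z => Cmod (h z))).
      * apply is_glb_Rbar_min. intros x (H & G & f & h & g & z & M & <- & ->). apply (MB _ _ _ _ _ _ M). lra.
        rewrite <- Vl. exact (Pl (fun f h g z => Cmod (g z))).
      * apply is_lub_Rbar_max. intros x (H & G & f & h & g & z & M & <- & ->). apply (MB _ _ _ _ _ _ M). lra.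
        rewrite <- Vu. exact (Pu (fun f h g z => Cmod (g z))).
      * apply is_glb_Rbar_min. intros x (H & G & f & h & g & z & M & <- & ->). apply (MB _ _ _ _ _ _ M). lra.
        (* The bound for [f] is the product of those for [h] and [g]. It is attained because both
           factors are extremal at the same point. *)
        unfold lower_bound. rewrite Rpower_plus. fold (lower_bound r lam1) (lower_bound r lam2).
        rewrite <- !Vl, <- (Cmod_conj (Cexp (RtoC lam2 * _)%C)), <- Cmod_mult. exact (Pl (fun f h g z => Cmod (f z))).
      * apply is_lub_Rbar_max. intros x (H & G & f & h & g & z & M & <- & ->). apply (MB _ _ _ _ _ _ M). lra.
        unfold upper_bound. rewrite Rpower_plus. fold (upper_bound r lam1) (upper_bound r lam2).
        rewrite <- !Vu, <- (Cmod_conj (Cexp (RtoC lam2 * _)%C)), <- Cmod_mult. exact (Pu (fun f h g z => Cmod (f z))).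
    + apply is_lub_Rbar_max.
      * intros x (H & G & f & h & g & M & E). specialize (Bound _ _ _ _ _ M). rewrite E in Bound. exact Bound.
      (* The norm of this mapping equals [6 lam1], so the supremum over the class is attained. *)
      * do 5 eexists. split. exact KM. now apply koebe_norm.
Qed.
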